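(* Let $n\ge 1$, let $\mu=(\mu_1,\ldots,\mu_\ell)$ be a partition of $n$, and let $x=(x_1,\ldots,x_m)$ be variables, $m\geq 1$ arbitrary. Then $$\widetilde{g}_{\mu}(x;v)=\sum_{\lambda\in\mathcal{SP}_n}2^{-\frac{\ell(\lambda)+\delta(\lambda)}{2}}\,Q_{\lambda}(x)\,\zeta^{\lambda}(T_{w_{\mu}}).$$
   Context: Hecke-Clifford algebra. Let $v$ be an indeterminate. $\mathcal{H}_n^c$ is the associative superalgebra over $\mathbb{C}(v^{1/2})$ with even generators $T_1,\ldots,T_{n-1}$ and odd generators $c_1,\ldots,c_n$ and relations: $(T_i-v)(T_i+1)=0$; $T_iT_j=T_jT_i$ for $|i-j|>1$; $T_iT_{i+1}T_i=T_{i+1}T_iT_{i+1}$; $c_i^2=1$, $c_ic_j=-c_jc_i$ for $i\ne j$; $T_ic_j=c_jT_i$ for $j\neq i,i+1$; $T_ic_i=c_{i+1}T_i$. Let $[k]_v=\frac{v^k-v^{-k}}{v-v^{-1}}$, $\mathbb{K}=\mathbb{C}(v^{1/2})(\sqrt{[1]_v},\ldots,\sqrt{[n]_v})$, and $\mathcal{H}_{n,\mathbb{K}}^c=\mathbb{K}\otimes_{\mathbb{C}(v^{1/2})}\mathcal{H}_n^c$. For a composition $\gamma=(\gamma_1,\ldots,\gamma_\ell)$ of $n$ (positive parts) put $T_{\gamma,j}=T_{\gamma_1+\cdots+\gamma_{j-1}+1}T_{\gamma_1+\cdots+\gamma_{j-1}+2}\cdots T_{\gamma_1+\cdots+\gamma_j-1}$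 (equal to $1$ if $\gamma_j=1$) and $T_{w_\gamma}=T_{\gamma,1}T_{\gamma,2}\cdots T_{\gamma,\ell}$. Combinatorics. $\mathcal{SP}_n$ is the set of strict partitions of $n$ (distinct nonzero parts), $\mathcal{OP}_n$ the set of partitions of $n$ with all parts odd, $\ell(\lambda)$ the number of nonzero parts, $\delta(\lambda)=0$ if $\ell(\lambda)$ is even and $1$ if it is odd. $Q_\lambda$ is the Schur $Q$-function (Macdonald, Ch. III.8: the Hall-Littlewood function $Q_\lambda(x;t)$ at $t=-1$, so e.g. $Q_{(1)}=2\sum_i x_i$). Characters. All modules over superalgebras are $\mathbb{Z}_2$-graded, isomorphisms are not required to be even, and characters are ordinary traces (not supertraces). Let $\mathfrak{H}_n^c=\mathcal{C}_n\rtimes S_n$ be the specialization of $\mathcal{H}_n^c$ at $v=1$ (over $\mathbb C$; $T_i$ becomes $s_i=(i,i+1)$). It is known that the irreducible $\mathfrak{H}_n^c$-modules are $U_1^\lambda$, $\lambda\in\mathcal{SP}_n$, where $U_1^\lambda$, with character $\zeta_1^\lambda$, is determined by the requirement that $\sum_{\mu\in\mathcal{OP}_n}z_\mu^{-1}\zeta_1^\lambda(w_\mu)p_\mu$ equals $Q_\lambda$ up to a power of $2$ (here $w_\mu\in S_n$ is a permutation of cycle type $\mu$, $p_\mu$ is the power sum and $z_\mu=\prod_i i^{m_i}m_i!$, $m_i$ the multiplicity of $i$ in $\mu$). It is known that $\mathcal{H}_{n,\mathbb{K}}^c$ is split semisimple and its irreducible modules are $U^\lambda$, $\lambda\in\mathcal{SP}_n$,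 with character $\zeta^\lambda$, labelled so that the specialization of $\zeta^\lambda$ at $v=1$ is $\zeta_1^\lambda$. Symmetric functions. Define $g_n(x;v)$ by $\sum_{n\geq 0}g_n(x;v)t^n=\prod_i\frac{1-tx_i}{1+tx_i}\cdot\frac{1+vtx_i}{1-vtx_i}$, and put $\widetilde{g}_n(x;v)=\frac{1}{v-1}g_n(x;v)$ and $\widetilde{g}_\mu(x;v)=\widetilde{g}_{\mu_1}(x;v)\cdots\widetilde{g}_{\mu_\ell}(x;v)$ for a partition $\mu=(\mu_1,\ldots,\mu_\ell)$ with nonzero parts. *)

(* Defs.v *)
From HB Require Import structures.
From mathcomp Require Import all_boot all_order all_algebra perm falgebra fieldext.
From mathcomp Require Import complex mpoly boolp reals.
From mathcomp Require Import generic_quotient.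

Set Implicit Arguments.
Unset Strict Implicit.
Unset Printing Implicit Defensive.

Import GRing.Theory.
Local Open Scope ring_scope.
Local Open Scope quotient_scope.

(* H_n^c over a field k with parameter v: the free associative unital
   k-algebra on the generators, modulo the congruence generated by the
   defining relations.
   From hc_quad on, the constructors are the defining relations of H_n^c; the
   others are those of a congruence and of a k-algebra.
   Generators are numbered from 0: the i-th T is T_(i+1), the j-th c is c_(j+1). *)

Inductive hc_term (n : nat) (k : Type) : Type :=
| HScal of k
| HT of 'I_n.-1
| HC of 'I_n
| HAdd of hc_term n k & hc_term n k
| HMul of hc_term n k & hc_term n k.

Arguments HScal {n k}.
Arguments HT {n k}.
Arguments HC {n k}.

HB.instance Definition _ n (k : Type) := gen_eqMixin (hc_term n k).
HB.instance Definition _ n (k : Type) := gen_choiceMixin (hc_term n k).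

Section HeckeClifford.
Variables (n : nat) (k : fieldType) (v : k).

Local Notation "x +' y" := (HAdd x y) (at level 50, left associativity).
Local Notation "x *' y" := (HMul x y) (at level 40, left associativity).
Reserved Notation "x ~' y" (at level 70).

Inductive hc_cong : hc_term n k -> hc_term n k -> Prop :=
| hc_refl x : x ~' x
| hc_sym x y : x ~' y -> y ~' x
| hc_trans x y z : x ~' y -> y ~' z -> x ~' z
| hc_add x x' y y' : x ~' x' -> y ~' y' -> x +' y ~' x' +' y'
| hc_mul x x' y y' : x ~' x' -> y ~' y' -> x *' y ~' x' *' y'
| hc_addA x y z : x +' (y +' z) ~' x +' y +' z
| hc_addC x y : x +' y ~' y +' x
| hc_add0 x : HScal 0 +' x ~' x
| hc_addN x : HScal (-1) *' x +' x ~' HScal 0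
| hc_mulA x y z : x *' (y *' z) ~' x *' y *' z
| hc_mul1l x : HScal 1 *' x ~' x
| hc_mul1r x : x *' HScal 1 ~' x
| hc_mulDl x y z : (x +' y) *' z ~' x *' z +' y *' z
| hc_mulDr x y z : x *' (y +' z) ~' x *' y +' x *' z
| hc_scalD a b : HScal (a + b) ~' HScal a +' HScal b
| hc_scalM a b : HScal (a * b) ~' HScal a *' HScal b
| hc_scalC a x : HScal a *' x ~' x *' HScal a
| hc_quad i : (HT i +' HScal (- v)) *' (HT i +' HScal 1) ~' HScal 0
| hc_far (i j : 'I_n.-1) : (i.+1 < j)%N || (j.+1 < i)%N ->
    HT i *' HT j ~' HT j *' HT i
| hc_braid (i j : 'I_n.-1) : j = i.+1 :> nat ->
    HT i *' HT j *' HT i ~' HT j *' HT i *' HT j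
| hc_cliff i : HC i *' HC i ~' HScal 1
| hc_anti i j : i != j -> HC i *' HC j ~' HScal (-1) *' (HC j *' HC i)
| hc_TCfar (i : 'I_n.-1) (j : 'I_n) : j <> i :> nat -> j <> i.+1 :> nat ->
    HT i *' HC j ~' HC j *' HT i
| hc_TC (i : 'I_n.-1) (j j' : 'I_n) : j = i :> nat -> j' = i.+1 :> nat ->
    HT i *' HC j ~' HC j' *' HT i
where "x ~' y" := (hc_cong x y).

Definition hc_congb (x y : hc_term n k) : bool := `[< hc_cong x y >].

Lemma hc_congb_refl : reflexive hc_congb.
Proof. by move=> x; apply/asboolP; exact: hc_refl. Qed.

Lemma hc_congb_sym : ssrbool.symmetric hc_congb.
Proof. by move=> x y; apply/asboolP/asboolP; exact: hc_sym. Qed.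

Lemma hc_congb_trans : transitive hc_congb.
Proof.
by move=> y x z /asboolP xy /asboolP yz; apply/asboolP; exact: hc_trans xy yz.
Qed.

Canonical hc_equiv := EquivRel hc_congb hc_congb_refl hc_congb_sym hc_congb_trans.

Definition hecke_clifford := {eq_quot hc_equiv}.
HB.instance Definition _ := EqQuotient.on hecke_clifford.
HB.instance Definition _ := Choice.on hecke_clifford.

Local Notation H := hecke_clifford.

Definition hc_class (x : hc_term n k) : H := \pi_H x.

Lemma hc_classP x y : hc_cong x y <-> hc_class x = hc_class y.
Proof.
split=> [xy|/eqmodP/asboolP//]; apply/eqmodP; exact/asboolP.
Qed.

Lemma hc_reprP x : hc_cong (repr (hc_class x)) x.
Proof. by apply/hc_classP; rewrite /hc_class reprK. Qed.

Definition hc_addq (x y : H) : H := hc_class (HAdd (repr x) (repr y)).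
Definition hc_mulq (x y : H) : H := hc_class (HMul (repr x) (repr y)).
Definition hc_oppq (x : H) : H := hc_class (HMul (HScal (-1)) (repr x)).
Definition hc_scaleq (a : k) (x : H) : H := hc_class (HMul (HScal a) (repr x)).

Lemma hc_addqE x y : hc_addq (hc_class x) (hc_class y) = hc_class (HAdd x y).
Proof. by apply/hc_classP; apply: hc_add; exact: hc_reprP. Qed.

Lemma hc_mulqE x y : hc_mulq (hc_class x) (hc_class y) = hc_class (HMul x y).
Proof. by apply/hc_classP; apply: hc_mul; exact: hc_reprP. Qed.

Lemma hc_oppqE x : hc_oppq (hc_class x) = hc_class (HMul (HScal (-1)) x).
Proof. by apply/hc_classP; apply: hc_mul (hc_refl _) (hc_reprP _). Qed.

Lemma hc_scaleqE a x : hc_scaleq a (hc_class x) = hc_class (HMul (HScal a) x).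
Proof. by apply/hc_classP; apply: hc_mul (hc_refl _) (hc_reprP _). Qed.

Lemma hc_classW (P : H -> Prop) : (forall x, P (hc_class x)) -> forall x, P x.
Proof. by move=> Pc x; rewrite -[x]reprK; exact: Pc. Qed.

Let hcE := (hc_addqE, hc_mulqE, hc_oppqE, hc_scaleqE).

Fact hc_addqA : associative hc_addq.
Proof.
elim/hc_classW=> x; elim/hc_classW=> y; elim/hc_classW=> z; rewrite !hcE.
by apply/hc_classP; exact: hc_addA.
Qed.

Fact hc_addqC : commutative hc_addq.
Proof.
elim/hc_classW=> x; elim/hc_classW=> y; rewrite !hcE.
by apply/hc_classP; exact: hc_addC.
Qed.

Fact hc_add0q : left_id (hc_class (HScal 0)) hc_addq.
Proof. by elim/hc_classW=> x; rewrite !hcE; apply/hc_classP; exact: hc_add0. Qed.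

Fact hc_addNq : left_inverse (hc_class (HScal 0)) hc_oppq hc_addq.
Proof. by elim/hc_classW=> x; rewrite !hcE; apply/hc_classP; exact: hc_addN. Qed.

HB.instance Definition _ :=
  GRing.isZmodule.Build H hc_addqA hc_addqC hc_add0q hc_addNq.

Fact hc_mulqA : associative hc_mulq.
Proof.
elim/hc_classW=> x; elim/hc_classW=> y; elim/hc_classW=> z; rewrite !hcE.
by apply/hc_classP; exact: hc_mulA.
Qed.

Fact hc_mul1q : left_id (hc_class (HScal 1)) hc_mulq.
Proof. by elim/hc_classW=> x; rewrite !hcE; apply/hc_classP; exact: hc_mul1l. Qed.

Fact hc_mulq1 : right_id (hc_class (HScal 1)) hc_mulq.
Proof. by elim/hc_classW=> x; rewrite !hcE; apply/hc_classP; exact: hc_mul1r. Qed.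

Fact hc_mulqDl : left_distributive hc_mulq +%R.
Proof.
elim/hc_classW=> x; elim/hc_classW=> y; elim/hc_classW=> z.
by rewrite /GRing.add /= !hcE; apply/hc_classP; exact: hc_mulDl.
Qed.

Fact hc_mulqDr : right_distributive hc_mulq +%R.
Proof.
elim/hc_classW=> x; elim/hc_classW=> y; elim/hc_classW=> z.
by rewrite /GRing.add /= !hcE; apply/hc_classP; exact: hc_mulDr.
Qed.

HB.instance Definition _ := GRing.Zmodule_isPzRing.Build H
  hc_mulqA hc_mul1q hc_mulq1 hc_mulqDl hc_mulqDr.

Fact hc_scaleqA a b x : hc_scaleq a (hc_scaleq b x) = hc_scaleq (a * b) x.
Proof.
elim/hc_classW: x => x; rewrite !hcE; apply/hc_classP.
apply: hc_trans (hc_mulA _ _ _) _; apply: hc_mul (hc_refl _).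
exact/hc_sym/hc_scalM.
Qed.

Fact hc_scale1q : left_id 1 hc_scaleq.
Proof. by elim/hc_classW=> x; rewrite !hcE; apply/hc_classP; exact: hc_mul1l. Qed.

Fact hc_scaleqDr : right_distributive hc_scaleq +%R.
Proof.
move=> a; elim/hc_classW=> x; elim/hc_classW=> y.
by rewrite /GRing.add /= !hcE; apply/hc_classP; exact: hc_mulDr.
Qed.

Fact hc_scaleqDl x : {morph hc_scaleq^~ x : a b / a + b}.
Proof.
move=> a b; elim/hc_classW: x => x; rewrite [RHS]/GRing.add /= !hcE.
apply/hc_classP; apply: hc_trans (hc_mulDl _ _ _).
exact: hc_mul (hc_scalD _ _) (hc_refl _).
Qed.

HB.instance Definition _ := GRing.Zmodule_isLmodule.Build k H
  hc_scaleqA hc_scale1q hc_scaleqDr hc_scaleqDl.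

(* H is only given the pzRingType and lmodType structures, since algType
   would require 1 != 0; the two lemmas below complete the algebra laws. *)

Lemma hc_scalerAl a (x y : H) : a *: (x * y) = (a *: x) * y.
Proof.
elim/hc_classW: x => x; elim/hc_classW: y => y.
by rewrite /GRing.scale /GRing.mul /= !hcE; apply/hc_classP; exact: hc_mulA.
Qed.

Lemma hc_scalerAr a (x y : H) : a *: (x * y) = x * (a *: y).
Proof.
elim/hc_classW: x => x; elim/hc_classW: y => y.
rewrite /GRing.scale /GRing.mul /= !hcE; apply/hc_classP.
apply: hc_trans (hc_mulA _ _ _) _; apply: hc_trans (hc_sym (hc_mulA _ _ _)).
exact: hc_mul (hc_scalC _ _) (hc_refl _).
Qed.

Definition hcT (i : 'I_n.-1) : H := hc_class (HT i).
Definition hcc (j : 'I_n) : H := hc_class (HC j).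

(* hc_homog b x: x is homogeneous of parity b (true = odd) *)
Inductive hc_homog : bool -> H -> Prop :=
| homog_scal a : hc_homog false (a *: (1 : H))
| homog_T i : hc_homog false (hcT i)
| homog_c j : hc_homog true (hcc j)
| homog_0 b : hc_homog b 0
| homog_add b x y : hc_homog b x -> hc_homog b y -> hc_homog b (x + y)
| homog_mul b b' x y : hc_homog b x -> hc_homog b' y ->
    hc_homog (b (+) b') (x * y).

Definition hc_word (w : seq ('I_n.-1 + 'I_n)) : H :=
  \prod_(s <- w) match s with inl i => hcT i | inr j => hcc j end.

(* T_(w_ga); with 0-based generators the j-th factor is the product of the
   hcT i for i = s, ..., s + ga_j - 2, where s is the sum of the parts before
   the j-th. All these i are < n.-1 when ga is a composition of n, so that
   pmap insub drops none of them. *)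
Definition hc_Tw (ga : seq nat) : H :=
  \prod_(j < size ga)
    \prod_(i <- pmap insub (iota (sumn (take j ga)) (nth 0%N ga j).-1)) hcT i.

(* Finite-dimensional graded left modules, on column vectors. *)
Record supermodule := Supermodule {
  smdim : nat;
  smact : {linear H -> 'M[k]_smdim};
  smact_mul : monoid_morphism smact;
  smpart : bool -> {vspace 'cV[k]_smdim};
  smpart_direct : directv (smpart false + smpart true);
  smpart_full : (smpart false + smpart true)%VS = fullv;
  smpart_act : forall b b' (x : H) (u : 'cV[k]_smdim),
    hc_homog b x -> u \in smpart b' -> smact x *m u \in smpart (b (+) b')
}.

Definition smchar (M : supermodule) (x : H) : k := \tr (smact M x).

Definition graded_submodule (M : supermodule) (W : {vspace 'cV[k]_(smdim M)}) :=
  (forall (x : H) u, u \in W -> smact M x *m u \in W) /\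
  W = (W :&: smpart M false + W :&: smpart M true)%VS.

Definition sm_irreducible (M : supermodule) :=
  (0 < smdim M)%N /\
  forall W, graded_submodule (M := M) W -> W = 0%VS \/ W = fullv.

Definition sm_hom (b : bool) (M N : supermodule)
    (f : 'M[k]_(smdim N, smdim M)) :=
  (forall b' (u : 'cV[k]_(smdim M)),
     u \in smpart M b' -> f *m u \in smpart N (b (+) b')) /\
  (forall b' (x : H), hc_homog b' x ->
     f *m smact M x = (-1) ^+ (b && b') *: (smact N x *m f)).

(* A morphism is a sum of an even and an odd one. *)
Definition sm_iso (M N : supermodule) :=
  exists f0 f1 : 'M[k]_(smdim N, smdim M),
    [/\ sm_hom false f0, sm_hom true f1 &
        bijective (fun u : 'cV[k]_(smdim M) => (f0 + f1) *m u)].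

Definition all_irreducibles (I : Type) (U : I -> supermodule) :=
  [/\ forall i, sm_irreducible (U i),
      forall i j, sm_iso (U i) (U j) -> i = j &
      forall M, sm_irreducible M -> exists i, sm_iso M (U i)].

End HeckeClifford.

Arguments hcT {n k v}.
Arguments hcc {n k v}.
Arguments hc_word {n k v}.
Arguments hc_Tw {n k v}.

Definition is_partition (n : nat) (s : seq nat) :=
  [&& sorted geq s, all (leq 1) s & sumn s == n].

Definition npartition (n : nat) :=
  {s : n.-bseq 'I_n.+1 | is_partition n (map val s)}.

Definition parts (n : nat) (la : npartition n) : seq nat := map val (val la).

Definition SP (n : nat) := {la : npartition n | uniq (parts la)}.

Definition SP_parts (n : nat) (la : SP n) : seq nat := parts (val la).

Definition is_OP (n : nat) (mu : npartition n) := all odd (parts mu).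

Definition zmu (mu : seq nat) : nat :=
  \prod_(1 <= i < (sumn mu).+1) (i ^ count_mem i mu * (count_mem i mu)`!)%N.

Section SymmetricFunctions.
Variables (k : fieldType) (m : nat).

Definition symfrac := {fraction {mpoly k[m]}}.

Definition scst (a : k) : symfrac := tofrac (a%:MP_[m]).
Definition svar (i : 'I_m) : symfrac := tofrac ('X_i : {mpoly k[m]}).

Definition psum (mu : seq nat) : symfrac :=
  \prod_(r <- mu) \sum_(i < m) svar i ^+ r.

(* The sum over S_m / S_m^la in Macdonald III.(2.2) runs over the coset
   representatives that are increasing on every block of equal la_i.  This
   form, unlike the sum over S_m divided by v_la(t), makes sense at t = -1. *)
Definition hl_P (t : k) (la : seq nat) : symfrac :=
  if (size la <= m)%N then
    \sum_(w : 'S_m | [forall i : 'I_m, forall j : 'I_m,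
              ((i < j)%N && (nth 0%N la i == nth 0%N la j)) ==> (w i < w j)%N])
      (\prod_(i < m) svar (w i) ^+ nth 0%N la i) *
      (\prod_(i < m) \prod_(j < m | (nth 0%N la j < nth 0%N la i)%N)
         ((svar (w i) - scst t * svar (w j)) / (svar (w i) - svar (w j))))
  else 0.

Definition hl_b (t : k) (la : seq nat) : k :=
  \prod_(1 <= i < (sumn la).+1) \prod_(1 <= r < (count_mem i la).+1) (1 - t ^+ r).

Definition hl_Q (t : k) (la : seq nat) : symfrac := scst (hl_b t la) * hl_P t la.

Definition schurQ (la : seq nat) : symfrac := hl_Q (-1) la.

(* power series in t, as coefficient sequences *)
Section PowerSeries.
Variable A : comNzRingType.

Definition ps_one (j : nat) : A := (j == 0%N)%:R.
Definition ps_mul (f g : nat -> A) (j : nat) : A :=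
  \sum_(i < j.+1) f i * g (j - i)%N.
(* 1 + a t *)
Definition ps_lin (a : A) (j : nat) : A :=
  if j is j'.+1 then (if j' is _.+1 then 0 else a) else 1.
(* 1 / (1 - a t) *)
Definition ps_geom (a : A) (j : nat) : A := a ^+ j.
End PowerSeries.

Definition gseries (v : k) : nat -> {mpoly k[m]} :=
  \big[@ps_mul {mpoly k[m]}/@ps_one {mpoly k[m]}]_(i < m)
    ps_mul (ps_mul (ps_lin (- 'X_i)) (ps_geom (- 'X_i)))
           (ps_mul (ps_lin (v%:MP * 'X_i)) (ps_geom (v%:MP * 'X_i))).

Definition gtilde (v : k) (r : nat) : {mpoly k[m]} := (v - 1)^-1 *: gseries v r.

Definition gtilde_mu (v : k) (mu : seq nat) : symfrac :=
  tofrac (\prod_(r <- mu) gtilde v r).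

End SymmetricFunctions.

Section BaseFields.
Variable R : realType.

Definition Cq := {fraction {poly R[i]}}.

(* the indeterminate of Cq is v^(1/2) *)
Definition vhalf : Cq := tofrac ('X : {poly R[i]}).
Definition vq : Cq := vhalf ^+ 2.

Definition qint (j : nat) : Cq := (vq ^+ j - vq ^- j) / (vq - vq^-1).

(* K = Cq(sqrt [1]_v, ..., sqrt [n]_v), with r i a square root of [i+1]_v *)
Definition sqrt_extension (n : nat) (K : fieldExtType Cq) (r : 'I_n -> K) :=
  (forall i, r i ^+ 2 = (qint i.+1)%:A) /\
  <<1 & [seq r i | i : 'I_n]>>%VS = fullv.

Definition vK (K : fieldExtType Cq) : K := vq%:A.

Definition constK (K : fieldExtType Cq) (a : R[i]) : K :=
  (tofrac (a%:P : {poly R[i]}) : Cq)%:A.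

(* A specialization v = 1: a ring morphism phi to the complex numbers, defined
   on a subring O of K that contains C[v], fixing C and sending v to 1. *)
Definition specialization_at_1 (K : fieldExtType Cq)
    (O : {pred K}) (phi : K -> R[i]) :=
  [/\ subring_closed O,
      {in O &, {morph phi : x y / x + y}},
      {in O &, {morph phi : x y / x * y}},
      forall a, constK K a \in O /\ phi (constK K a) = a &
      vK K \in O /\ phi (vK K) = 1].

(* zeta specializes to zeta1 on the form spanned by the words in the T_i, c_j *)
Definition char_specializes (n : nat) (K : fieldExtType Cq)
    (O : {pred K}) (phi : K -> R[i])
    (M : supermodule n (vK K)) (M1 : supermodule n (1 : R[i])) :=
  forall w : seq ('I_n.-1 + 'I_n),
    smchar M (hc_word w) \in O /\
    phi (smchar M (hc_word w)) = smchar M1 (hc_word w).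

(* At v = 1, T_(w_mu) is a permutation
   of cycle type mu.  The identity of symmetric functions is stated in N
   variables for all N. *)
Definition schurQ_labelling (n : nat) (U1 : SP n -> supermodule n (1 : R[i])) :=
  forall la : SP n, exists a : int, forall N : nat,
    \sum_(mu : npartition n | is_OP mu)
      scst N ((zmu (parts mu))%:R^-1 * smchar (U1 la) (hc_Tw (parts mu)))
        * psum _ N (parts mu)
    = scst N (2%:R ^ a) * schurQ _ N (SP_parts la).

End BaseFields.

(* (l(la) + delta(la)) / 2, an integer *)
Definition half_len (la : seq nat) : nat := ((size la + odd (size la))./2)%N.

(* Main.v *)
Require Import Defs.
From HB Require Import structures.
From mathcomp Require Import all_boot all_order all_algebra perm falgebra fieldext.
From mathcomp Require Import complex mpoly boolp reals.
From mathcomp Require Import ring zify.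

Set Implicit Arguments.
Unset Strict Implicit.
Unset Printing Implicit Defensive.

Import Order.TTheory GRing.Theory.
Local Open Scope ring_scope.

(** Let the Hecke algebra act on sequences of [n] colours from [1 .. m] in the
    classical way, and induce this action to the Hecke-Clifford algebra. The
    induced module has the sequences of [n] pairs (parity, colour) as a basis,
    and is the direct sum of weight modules, one for each content [alpha] of
    the sequence of colours, that is, for each monomial [x^alpha] of degree
    [n]. The theorem comes from computing the traces of [T_(w_mu)] on the weight
    modules, weighted by [x^alpha], in two ways.

    On the one hand, the indices of the generators in [T_(w_mu)] increase, so a
    diagonal entry is a product over neighbouring positions ([word_op_diag]).
    The sum over all basis vectors then factors over the parts of [mu]
    ([weight_trace_Tw]), and a part [r] contributes a weighted count of chains
    of length [r]. A transfer computation shows that this count is the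
    coefficient of [t^r] in the product defining [g_r], divided by [v - 1]
    ([chain_sum_gf]); at [v = 1] and [r] odd it is twice the power sum [p_r]
    ([chain_sum_v1]). On the other hand, the character of every graded module
    is a sum of irreducible characters ([char_decomposition]). Hence the
    product of the [g_r / (v - 1)] is the sum over [la] of
    [zeta^la (T_(w_mu)) A_la (x)], where [A_la] is the generating polynomial of
    the multiplicities of [U^la] in the weight modules
    ([chain_sum_characters], [mult_poly]).

    It remains to see that [A_la] is [Q_la] up to the right power of [2]. The
    multiplicities are natural numbers, so this may be done after specializing
    [v] to [1], where characters specialize to the given ones. With
    [l = size la], and with [2^a] the power of [2] by which the labelling of
    [U_1^la] differs from [Q_la], the Cauchy kernel, expanded in odd power sums
    ([qfam_cauchy]), becomes the sum of the products [2^a A_la (x) Q_la (y)].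
    To compare this with [Q_la], one writes [Q_la] as an integer combination of
    products of the [q_r] ([Qrec_qexp]): the Hall-Littlewood sum at [t = -1] is
    an iterated residue of the generating series of the [q_r]
    ([schurQ_Qrec]). Products of the [q_r] are coefficients of the Cauchy
    kernel, so this combination gives a linear functional on polynomials; the
    matrix of the values of these functionals on the [Q_la] is symmetric,
    because the kernel is, and triangular, because of leading monomials. It is
    therefore diagonal, which means that [Q_la = 2^(l + a) A_la] ([Q_aw]).

    The exponent [a] is found from the weight [(1, .., 1)], whose weight module
    is the regular module ([sum_ones_trace]). By Schur orthogonality for
    supermodules, [U_1^la] occurs there [d / h] times, where [d] is its
    dimension and [h] is [1] or [2]; comparing coefficients of [x_1 .. x_n]
    gives [d = 2^(l + 2 a) d / h]. So [l + 2 a] is [0] or [1], and [l + a] is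
    half of [l], rounded up ([Q_mult_normalized]). *)

(** * Power series and the functions q_r *)

Section PowerSeriesLaw.
Variable A : comNzRingType.
Implicit Types (f g h : nat -> A) (x : A).

(** Products of coefficient sequences are computed on truncations, which live in
    the polynomial ring: this gives associativity and commutativity for free. *)
Definition trunc_ps (N : nat) f : {poly A} := \poly_(i < N.+1) f i.

Lemma ps_mul_trunc N f g j : (j <= N)%N ->
  ps_mul f g j = (trunc_ps N f * trunc_ps N g)`_j.
Proof.
move=> jN; rewrite coefM; apply: eq_bigr => i _; rewrite !coef_poly.
by rewrite ltnS (leq_trans _ jN) ?leq_ord // ltnS (leq_trans (leq_subr _ _) jN).
Qed.

Fact ps_mulC : commutative (@ps_mul A).
Proof. by move=> f g; apply/funext=> j; rewrite !(ps_mul_trunc _ _ (leqnn j)) mulrC. Qed.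

Lemma trunc_ps_mul N f g j : (j <= N)%N ->
  (trunc_ps N (ps_mul f g))`_j = (trunc_ps N f * trunc_ps N g)`_j.
Proof. by move=> jN; rewrite coef_poly ltnS jN (ps_mul_trunc _ _ jN). Qed.

Lemma coef_mul_trunc (p q r : {poly A}) N j : (j <= N)%N ->
  (forall i, (i <= N)%N -> p`_i = q`_i) -> (r * p)`_j = (r * q)`_j.
Proof.
move=> jN pq; rewrite !coefM; apply: eq_bigr => i _.
by rewrite pq // (leq_trans (leq_subr _ _) jN).
Qed.

Fact ps_mulA : associative (@ps_mul A).
Proof.
move=> f g h; apply/funext=> j; rewrite !(ps_mul_trunc _ _ (leqnn j)).
rewrite (coef_mul_trunc _ (leqnn j) (@trunc_ps_mul j g h)) mulrA mulrC.
rewrite [in RHS]mulrC; apply/esym/(coef_mul_trunc _ (leqnn j)).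
by move=> i ij; rewrite trunc_ps_mul.
Qed.

Fact ps_mul1 : left_id (@ps_one A) (@ps_mul A).
Proof.
move=> f; apply/funext=> j; rewrite /ps_mul big_ord_recl /= subn0 /ps_one mul1r.
by rewrite big1 ?addr0 // => i _; rewrite mul0r.
Qed.

HB.instance Definition _ :=
  Monoid.isComLaw.Build (nat -> A) (@ps_one A) (@ps_mul A) ps_mulA ps_mulC ps_mul1.

Lemma big_ps_trunc (I : Type) (r : seq I) (P : pred I) (F : I -> nat -> A) N j :
  (j <= N)%N ->
  (\big[@ps_mul A/@ps_one A]_(i <- r | P i) F i) j =
    (\prod_(i <- r | P i) trunc_ps N (F i))`_j.
Proof.
elim: r j => [|i r IH] j jN; first by rewrite !big_nil coef1.
rewrite !big_cons; case: (P i) => //; last exact: IH.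
rewrite (ps_mul_trunc _ _ jN); apply: (coef_mul_trunc _ jN) => k kN.
by rewrite coef_poly ltnS kN IH.
Qed.

Lemma ps_lin0 x f : ps_mul (ps_lin x) f 0 = f 0.
Proof. by rewrite /ps_mul big_ord1 /= mul1r. Qed.

Lemma ps_linS x f j : ps_mul (ps_lin x) f j.+1 = f j.+1 + x * f j.
Proof.
rewrite /ps_mul !big_ord_recl /= mul1r subn0 subSS subn0 big1 ?addr0 //.
by move=> i _; rewrite /= mul0r.
Qed.

Lemma ps_lin_geom x : ps_mul (ps_lin (- x)) (ps_geom x) = @ps_one A.
Proof.
apply/funext=> -[|j]; first by rewrite ps_lin0.
by rewrite ps_linS /ps_geom exprS mulNr subrr.
Qed.

(** The generating series of the [q_r] in the single variable [x]. *)
Definition qser x := ps_mul (ps_lin x) (ps_geom x).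

Lemma qser0 x : qser x 0 = 1.
Proof. by rewrite /qser ps_lin0. Qed.

Lemma qserS x j : qser x j.+1 = x ^+ j.+1 *+ 2.
Proof. by rewrite /qser ps_linS /ps_geom -exprS mulr2n. Qed.

Lemma qserK x : ps_mul (qser (- x)) (qser x) = @ps_one A.
Proof.
rewrite /qser (ps_mulC (ps_lin x)) Monoid.mulmACA /= ps_lin_geom ps_mul1.
by rewrite ps_mulC -{1}(opprK x) ps_lin_geom.
Qed.

Variable I : finType.
Implicit Types (S : {set I}) (y : I -> A).

(** [qfam S y r] is the function [q_r] in the variables [y i], [i] in [S]. *)
Definition qfam S y : nat -> A := \big[@ps_mul A/@ps_one A]_(i in S) qser (y i).

Lemma qfam_rem S y i : i \in S ->
  qfam (S :\ i) y = ps_mul (qser (- y i)) (qfam S y).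
Proof.
move=> iS; rewrite [in RHS]/qfam (big_setD1 i) //= ps_mulA qserK.
by rewrite ps_mul1.
Qed.

Lemma qfam0 S y : qfam S y 0 = 1.
Proof.
rewrite /qfam; elim/big_rec: _ => [//|i f _ IH].
by rewrite /ps_mul big_ord1 qser0 mul1r.
Qed.

Definition qprod S y (be : seq nat) : A := \prod_(b <- be) qfam S y b.

End PowerSeriesLaw.

Definition flip_coef (s : nat) : int := if s is 0 then 1 else 2 * (-1) ^+ s.

Lemma qser_flip (A : comNzRingType) (x : A) s :
  qser (- x) s = (flip_coef s)%:~R * x ^+ s.
Proof.
case: s => [|s]; first by rewrite qser0 mul1r.
have -> : (flip_coef s.+1)%:~R = (-1) ^+ s.+1 *+ 2 :> A.
  rewrite /flip_coef intrM mulr_natl; congr (_ *+ _).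
  by elim: s.+1 => [|k IH]; rewrite ?expr0 // !exprS intrM IH.
by rewrite qserS mulrnAl -exprNn.
Qed.

(** Removing the variable [y_i] divides the generating series by [qser (y_i)],
    that is, multiplies it by [qser (- y_i)]. The entries of [raise be] are the
    terms that this produces in [qprod]: a coefficient, an exponent of [y_i], and
    a new list of degrees. *)
Fixpoint raise (be : seq nat) : seq (int * (nat * seq nat)) :=
  if be is b :: be' then
    [seq (flip_coef s * ca.1, ((s + ca.2.1)%N, (b - s)%N :: ca.2.2))
      | s <- iota 0 b.+1, ca <- raise be']
  else [:: (1, (0%N, [::]))].

(** The coefficients and degrees in the expansion of [Q_la] in products of the
    [q_r], that is, of Macdonald's product of raising operators
    [(1 - R_ij) / (1 + R_ij)]. *)
Fixpoint qexp (la : seq nat) : seq (int * seq nat) :=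
  if la is r :: la' then
    [seq (cb.1 * ca.1, (r + ca.2.1)%N :: ca.2.2) | cb <- qexp la', ca <- raise cb.2]
  else [:: (1, [::])].

Lemma qprod_rem (A : comNzRingType) (I : finType) (S : {set I}) (y : I -> A) i be :
  i \in S -> qprod (S :\ i) y be =
    \sum_(ca <- raise be) ca.1%:~R * y i ^+ ca.2.1 * qprod S y ca.2.2.
Proof.
move=> iS; elim: be => [|b be IH].
  by rewrite /qprod /= big_nil big_seq1 /= big_nil !mulr1.
rewrite /qprod big_cons -/(qprod _ y be) IH (qfam_rem _ iS) big_allpairs_dep.
rewrite /ps_mul mulr_suml -[iota 0 b.+1]/(index_iota 0 b.+1) big_mkord.
apply: eq_bigr => s _; rewrite mulr_sumr; apply: eq_bigr => ca _ /=.
by rewrite qser_flip big_cons -/(qprod _ _ ca.2.2) rmorphM /= exprD; ring.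
Qed.

Section QFraction.
Variables (F : fieldType) (I : finType) (y : I -> F).
Hypotheses (y_inj : injective y) (y_neq0 : forall i, y i != 0).
Implicit Types S : {set I}.

(** The residue, up to elementary factors, of the generating series of the [q_r]
    at its pole [1 / y_i]. *)
Definition qres S i : F := \prod_(j in S :\ i) ((y i + y j) / (y i - y j)).

Local Notation lin a := (1 + a *: 'X : {poly F}).

Lemma size_lin a : (size (lin a) <= 2)%N.
Proof.
rewrite (leq_trans (size_polyD _ _)) // geq_max size_poly1.
by rewrite (leq_trans (size_scale_leq _ _)) ?size_polyX.
Qed.

Lemma size_prod_lin S (a : I -> F) : (size (\prod_(i in S) lin (a i))%R <= #|S|.+1)%N.
Proof.
rewrite -sum1_card; elim/big_rec2: _ => [|i p n _ IH]; first by rewrite size_poly1.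
rewrite (leq_trans (size_polyMleq _ _)) // add1n.
by have := leq_add (size_lin (a i)) IH; case: (size _ + size _)%N.
Qed.

Lemma horner_lin a b : (lin a).[b] = 1 + a * b.
Proof. by rewrite !hornerE. Qed.

(** Partial fractions, cleared of denominators: both sides have degree at most
    [#|S|] and agree at [0] and at the [#|S|] distinct points [1 / y_i]. *)
Lemma qfam_poly S :
  \prod_(i in S) lin (y i) - \prod_(i in S) lin (- y i) =
  \sum_(i in S) (y i *+ 2 * qres S i) *: ('X * \prod_(j in S :\ i) lin (- y j)).
Proof.
apply/eqP; rewrite -subr_eq0; apply/eqP.
set p := _ - _.
pose s := 0 :: [seq (y i)^-1 | i <- enum S].
have us : uniq s.
  rewrite /s /= map_inj_uniq ?enum_uniq ?andbT; last by move=> i j /invr_inj/y_inj.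
  by apply/mapP=> -[i _ /esym/eqP]; rewrite invr_eq0 (negPf (y_neq0 i)).
apply: (@roots_geq_poly_eq0 _ _ s) => //; last first.
  rewrite /s /= size_map -cardE /p.
  apply: (leq_trans (size_polyD _ _)); rewrite geq_max size_polyN; apply/andP; split.
    apply: (leq_trans (size_polyD _ _)); rewrite geq_max size_polyN.
    by rewrite !size_prod_lin.
  apply: (leq_trans (size_sum _ _ _)); apply/bigmax_leqP => i iS.
  apply: (leq_trans (size_scale_leq _ _)); apply: (leq_trans (size_polyMleq _ _)).
  rewrite size_polyX add2n /= (cardsD1 i S) iS add1n ltnS.
  exact: size_prod_lin.
apply/allP => b; rewrite inE => /orP[/eqP->|bS].
  apply/rootP; rewrite /p !(hornerD, hornerN) !horner_prod big1; last by move=> i _; rewrite horner_lin mulr0 addr0.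
  rewrite big1; last by move=> i _; rewrite horner_lin mulr0 addr0.
  by rewrite subrr horner_sum big1 ?subrr // => i _; rewrite hornerZ hornerM hornerX mul0r mulr0.
have [i iS ->] : exists2 i, i \in S & b = (y i)^-1.
  by have [i iS ->] := mapP bS; exists i => //; rewrite mem_enum in iS.
apply/rootP; rewrite /p !(hornerD, hornerN) !horner_prod horner_sum.
rewrite [X in _ - X - _](big_setD1 i) //= horner_lin mulNr divff // subrr mul0r subr0.
rewrite (big_setD1 i) //= horner_lin divff // [X in _ - X](big_setD1 i) //=.
rewrite [X in _ - (_ + X)]big1 ?addr0; last first.
  move=> j /setD1P[ji jS]; rewrite hornerZ hornerM horner_prod (big_setD1 i) /=; last first.
    by rewrite !inE iS eq_sym ji.
  by rewrite horner_lin mulNr divff // subrr mul0r !mulr0.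
rewrite hornerZ hornerM hornerX horner_prod.
have -> : \prod_(j in S :\ i) (lin (y j)).[(y i)^-1] =
    qres S i * \prod_(j in S :\ i) (lin (- y j)).[(y i)^-1].
  rewrite -big_split /=; apply: eq_bigr => j /setD1P[ji jS].
  have h : y i - y j != 0 by rewrite subr_eq0 (inj_eq y_inj) eq_sym.
  by rewrite !horner_lin; field; rewrite h y_neq0.
by rewrite -mulr_natl; field.
Qed.

End QFraction.

(** * Partial fractions and the residue recursion *)

Section PartialFractions.
Variables (F : fieldType) (I : finType) (y : I -> F).
Hypotheses (y_inj : injective y) (y_neq0 : forall i, y i != 0).
Implicit Types S : {set I}.

Local Notation lin a := (1 + a *: 'X : {poly F}).

Definition ps_poly (p : {poly F}) : nat -> F := fun j => p`_j.

Lemma ps_polyM p q : ps_poly (p * q) = ps_mul (ps_poly p) (ps_poly q).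
Proof. by apply/funext=> j; rewrite /ps_poly coefM. Qed.

Lemma ps_poly_lin a : ps_poly (lin a) = ps_lin a.
Proof.
apply/funext=> -[|[|j]]; rewrite /ps_poly coefD coefZ coef1 coefX /=.
- by rewrite mulr0 addr0.
- by rewrite mulr1 add0r.
- by rewrite mulr0 addr0.
Qed.

Lemma ps_poly_prod S (a : I -> F) :
  ps_poly (\prod_(i in S) lin (a i)) = \big[@ps_mul F/@ps_one F]_(i in S) ps_lin (a i).
Proof.
elim/big_rec2: _ => [|i f p _ <-]; last by rewrite ps_polyM ps_poly_lin.
by apply/funext=> j; rewrite /ps_poly coef1.
Qed.

(** The partial fraction decomposition, read off coefficientwise: multiplying
    [qfam_poly] by the product of the geometric series divides out the
    denominators. *)
Lemma qfam_residues S r : (0 < r)%N ->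
  qfam S y r = \sum_(i in S) y i ^+ r *+ 2 * qres y S i.
Proof.
case: r => // r _.
pose G := \big[@ps_mul F/@ps_one F]_(i in S) ps_geom (y i).
have GK i : i \in S ->
    ps_mul (ps_poly (\prod_(j in S :\ i) lin (- y j))) G = ps_geom (y i).
  move=> iS; have -> : G = ps_mul (ps_geom (y i)) (\big[@ps_mul F/@ps_one F]_(j in S :\ i) ps_geom (y j)).
    by rewrite /G (big_setD1 i).
  rewrite ps_mulA (ps_mulC _ (ps_geom _)) -ps_mulA ps_poly_prod -big_split /=.
  by rewrite big1 ?(ps_mulC _ (@ps_one F)) ?ps_mul1 // => j _; exact: ps_lin_geom.
have /(congr1 (fun p => ps_mul (ps_poly p) G r.+1)) := qfam_poly y_inj y_neq0 S.
have mulBl p q : ps_mul (ps_poly (p - q)) G = ps_mul (ps_poly p) G \- ps_mul (ps_poly q) G.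
  apply/funext=> j; rewrite /ps_mul /= -sumrB; apply: eq_bigr => i _.
  by rewrite /ps_poly coefB mulrBl.
rewrite mulBl /= !ps_poly_prod /G -!big_split /= -/G.
rewrite (_ : \big[_/_]_(i in S) ps_mul (ps_lin (- _)) _ = @ps_one F); last first.
  by rewrite big1 // => j _; exact: ps_lin_geom.
rewrite {2}/ps_one /= subr0 -/(qfam S y) => ->.
rewrite /ps_mul; under [LHS]eq_bigr => j _ do rewrite /ps_poly coef_sum mulr_suml.
rewrite exchange_big /=; apply: eq_bigr => i iS.
under eq_bigr => j _ do rewrite coefZ -mulrA.
rewrite -mulr_sumr big_ord_recl /= coefXM /= mul0r add0r.
under eq_bigr => j _ do rewrite coefXM /= subSS.
have /(congr1 (fun f => f r)) := GK i iS; rewrite /ps_mul /ps_poly => ->.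
by rewrite /ps_geom exprS; ring.
Qed.

(** Iterated residues, one variable being removed at each step. On strict
    partitions these sums are the Hall-Littlewood sums at [t = -1]. *)
Fixpoint Qrec (la : seq nat) S : F :=
  if la is r :: la' then
    \sum_(i in S) y i ^+ r *+ 2 * qres y S i * Qrec la' (S :\ i)
  else 1.

(** The residues of the first step recombine to [q_r] by [qfam_residues], once
    the inner [q]-functions, which miss the variable [y_i], are rewritten in all
    the variables by [qprod_rem]. *)
Lemma Qrec_qexp la S : all (leq 1) la ->
  Qrec la S = \sum_(ca <- qexp la) ca.1%:~R * qprod S y ca.2.
Proof.
elim: la S => [|r la IH] S; first by rewrite big_seq1 /qprod big_nil mulr1.
case/andP=> r_gt0 /IH{IH}IH; rewrite big_allpairs_dep /=.
under eq_bigr => i iS.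
  rewrite IH mulr_sumr; under eq_bigr => cb _ do rewrite (qprod_rem _ _ iS).
  over.
rewrite exchange_big /=; apply: eq_bigr => cb _.
under eq_bigr => i _ do rewrite 2!mulr_sumr.
rewrite exchange_big /=; apply: eq_bigr => ca _.
rewrite /qprod big_cons -/(qprod _ _ _) qfam_residues ?addn_gt0 ?r_gt0 //.
rewrite mulr_suml mulr_sumr; apply: eq_bigr => i _.
by rewrite intrM exprD; ring.
Qed.

End PartialFractions.

Lemma raise_lex be ca : ca \in raise be ->
  [/\ size ca.2.2 = size be, (ca.2.1 + sumn ca.2.2 = sumn be)%N
    & ca.2.1 = 0%N -> ca.1 = 1 /\ ca.2.2 = be].
Proof.
elim: be ca => [|b be IH] ca; first by rewrite inE => /eqP->.
case/allpairsPdep=> s [ca' [sb /IH[IH1 IH2 IH3] ->]] /=.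
move: sb; rewrite -[_ \in _]/(s \in iota 0 b.+1) mem_iota ltnS => /andP[_ sb].
split; first by rewrite IH1.
  by rewrite -IH2 addnACA subnKC.
move=> /eqP; rewrite addn_eq0 => /andP[/eqP-> /eqP/IH3[-> ->]].
by rewrite subn0 mulr1.
Qed.

Lemma raise_head be : exists2 t, raise be = (1, (0%N, be)) :: t &
  forall ca, ca \in t -> (0 < ca.2.1)%N.
Proof.
elim: be => [|b be [t IH tP]]; first by exists [::].
pose f s (ca : int * (nat * seq nat)) :=
  (flip_coef s * ca.1, ((s + ca.2.1)%N, (b - s)%N :: ca.2.2)).
have -> : raise (b :: be) = [seq f 0%N ca | ca <- raise be] ++
    [seq f s ca | s <- iota 1 b, ca <- raise be] by [].
rewrite {1}IH /= {1}/f /= subn0 mulr1; eexists; first by [].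
move=> ca; rewrite mem_cat => /orP[/mapP[ca' /tP ca'P ->] //|].
by case/allpairsPdep=> s [ca' [+ _ ->]]; rewrite mem_iota /=; case: s.
Qed.

Lemma qexp_size la ca : ca \in qexp la ->
  size ca.2 = size la /\ sumn ca.2 = sumn la.
Proof.
elim: la ca => [|r la IH] ca; first by rewrite inE => /eqP->.
case/allpairsPdep=> cb [ca' [/IH[IH1 IH2] /raise_lex[h1 h2 _] ->]] /=.
by rewrite h1 IH1 -IH2 -h2 addnA.
Qed.

(** Raising operators only move boxes to earlier rows, so that every other term
    is lexicographically larger than [la]. *)
Lemma qexp_head la : exists2 t, qexp la = (1, la) :: t &
  forall ca, ca \in t -> (la < ca.2 :> seqlexi nat)%O.
Proof.
elim: la => [|r la [t IH tP]]; first by exists [::].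
have [u uE uP] := raise_head la.
rewrite /= IH /= uE /= addn0 mulr1; eexists; first by [].
move=> ca; rewrite mem_cat => /orP[/mapP[cb /uP cbP ->] /=|].
  rewrite ltxi_cons /= leEnat leq_addr /=.
  by rewrite -{2}[r]addn0 leq_add2l leqNgt cbP.
case/allpairsPdep=> cb [ca' [/tP lacb /raise_lex[_ _ h] ->]] /=.
rewrite ltxi_cons leEnat leq_addr /=; apply/implyP.
rewrite -{2}[r]addn0 leq_add2l leqn0 => /eqP /h[_ ->] //.
Qed.

(** * Coset representatives for strict partitions *)

Section CosetRepresentatives.
Variables (m : nat) (la : seq nat).
Hypotheses (la_dec : sorted gtn la) (la_pos : all (leq 1) la) (la_m : (size la <= m)%N).

(** The index set of the Hall-Littlewood sum. For a strict partition the only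
    block with more than one element is the block of zero parts. *)
Definition block_increasing (w : 'S_m) :=
  [forall i : 'I_m, forall j : 'I_m,
     ((i < j)%N && (nth 0%N la i == nth 0%N la j)) ==> (w i < w j)%N].

Definition has_prefix (p : seq 'I_m) (w : 'S_m) :=
  [forall i : 'I_m, (i < size p)%N ==> (w i == nth (w i) p i)].

Lemma nth_strict_lt (i j : nat) : (i < size la)%N ->
  (nth 0%N la j < nth 0%N la i)%N = (i < j)%N.
Proof.
move=> il; have nth_gt0 k : (k < size la)%N -> (0 < nth 0%N la k)%N.
  by move=> kl; apply: (allP la_pos); rewrite mem_nth.
have lt a b : (a < b)%N -> (b < size la)%N -> (nth 0%N la b < nth 0%N la a)%N.
  move=> ab bl; apply: (sorted_ltn_nth (leT := gtn)) => //.
  - by move=> x y z /= h1 h2; exact: ltn_trans h2 h1.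
  - by rewrite inE (ltn_trans ab).
have [jl|jl] := ltnP j (size la); last by rewrite nth_default // nth_gt0 // (leq_trans il).
case: (ltngtP i j) => [ij|ji|->]; [by rewrite lt | | by rewrite ltnn].
by apply/negbTE; rewrite -leqNgt ltnW // lt.
Qed.

Lemma block_increasing_tail (w : 'S_m) (i j : 'I_m) : block_increasing w ->
  (size la <= i)%N -> (i < j)%N -> (w i < w j)%N.
Proof.
move=> /forallP/(_ i)/forallP/(_ j)/implyP h li ij; apply: h.
by rewrite ij !nth_default // (leq_trans li) // ltnW.
Qed.

Lemma tail_block_increasing (w : 'S_m) :
  (forall i j : 'I_m, (size la <= i)%N -> (i < j)%N -> (w i < w j)%N) -> block_increasing w.
Proof.
move=> h; apply/forallP=> i; apply/forallP=> j; apply/implyP=> /andP[ij /eqP eq].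
have [il|] := ltnP i (size la); last by move/h; apply.
by have := nth_strict_lt j il; rewrite eq ltnn ij.
Qed.

(** A block-increasing permutation is determined by its values on the nonzero
    parts: the remaining values are taken in increasing order. *)
Lemma block_increasing_unique (p : seq 'I_m) : uniq p -> size p = size la ->
  exists w0 : 'S_m, forall w, block_increasing w && has_prefix p w = (w == w0).
Proof.
move=> pu ps; pose s := p ++ enum [predC p].
have su : uniq s.
  rewrite cat_uniq pu enum_uniq andbT /=; apply/hasPn=> x.
  by rewrite mem_enum.
have ss : size s = m.
  rewrite size_cat -cardE -[X in _ = X]card_ord -(cardC (mem p)); congr (_ + _)%N.
  by apply/esym/card_uniqP.
have sgtn i : i \in 'I_m -> (nth i s i \in s) by move=> _; rewrite mem_nth ?ss.
have f_inj : injective (fun i : 'I_m => nth i s i).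
  move=> i j eq; apply/val_inj/eqP; move/eqP: eq.
  by rewrite (set_nth_default j) ?ss // nth_uniq ?ss.
have tr : transitive (fun x y : 'I_m => (x < y)%N) by move=> x y z; exact: ltn_trans.
have sort_enum (A : {pred 'I_m}) : sorted (fun x y : 'I_m => (x < y)%N) (enum A).
  rewrite {1}/enum_mem -enumT sorted_filter //.
  by rewrite -(@sorted_map _ _ val ltn) val_enum_ord iota_ltn_sorted.
(* the representative lists [p] first and then the other elements in order *)
exists (perm f_inj) => w; apply/andP/eqP => [[wb /forallP wp]|->].
  have ws : [seq w i | i <- enum 'I_m] = s.
    have sw : size [seq w i | i <- enum 'I_m] = m by rewrite size_map size_enum_ord.
    have eqt : take (size p) [seq w i | i <- enum 'I_m] = p.
      have [l0|l0] := posnP (size la).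
        by rewrite ps l0 take0; apply/esym/nilP; rewrite /nilp ps l0.
      pose x0 : 'I_m := Ordinal (leq_trans l0 la_m).
      apply: (@eq_from_nth _ x0); first by rewrite size_takel // sw ps.
      rewrite size_takel ?sw ?ps // => i il.
      have im : (i < m)%N by rewrite (leq_trans il).
      rewrite nth_take // (nth_map x0) ?size_enum_ord //.
      have := wp (Ordinal im); rewrite /= ps il /= => /eqP.
      have -> : nth x0 (enum 'I_m) i = Ordinal im.
        by apply/val_inj; rewrite /= nth_enum_ord.
      by move=> ->; apply: set_nth_default; rewrite ps.
    rewrite -(cat_take_drop (size p) [seq w i | i <- enum 'I_m]) eqt; congr (_ ++ _).
    have wu : uniq [seq w i | i <- enum 'I_m] by rewrite map_inj_uniq ?enum_uniq //; exact: perm_inj.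
    apply: (irr_sorted_eq tr) => //; first by move=> x; rewrite /= ltnn.
      rewrite -map_drop sorted_map.
      apply: (sub_in_sorted (P := [pred i : 'I_m | (size la <= i)%N])
         (e := fun x y : 'I_m => (x < y)%N)).
      - by move=> i j il _ ij; exact: block_increasing_tail.
      - apply/allP=> i; rewrite -ps => /(nthP i)[k]; rewrite size_drop size_enum_ord => km.
        rewrite nth_drop => <-; rewrite inE nth_enum_ord ?leq_addr //.
        by rewrite -ltn_subRL.
      - by apply: drop_sorted; exact: sort_enum.
      exact: sort_enum.
    move=> x; rewrite mem_enum inE /=.
    have : x \in [seq w i | i <- enum 'I_m].
      by apply/mapP; exists (w^-1 x)%g; rewrite ?mem_enum // permKV.
    rewrite -[X in x \in X](cat_take_drop (size p)) mem_cat eqt.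
    move: wu; rewrite -[X in uniq X](cat_take_drop (size p)) eqt cat_uniq => /and3P[_ /hasPn hp _].
    have [xp|xp] /= := boolP (x \in p); last by move=> ->.
    by move=> _; apply/negbTE/negP=> /hp; rewrite /= xp.
  apply/permP=> i; rewrite permE -ws (nth_map i) ?size_enum_ord //.
  by rewrite nth_ord_enum.
split; last first.
  apply/forallP=> i; apply/implyP=> ip; rewrite permE nth_cat ip.
  by apply/eqP/set_nth_default.
apply: tail_block_increasing => i j li ij; rewrite !permE !nth_cat ps.
rewrite !ltnNge li (leq_trans li (ltnW ij)) /=.
have sz k : (size la <= k)%N -> (k < m)%N -> (k - size la < size (enum [predC p]))%N.
  by move=> lk km; rewrite -(ltn_add2l (size p)) -size_cat -/s ss ps subnKC.
have -> : nth i (enum [predC p]) (i - size la) = nth j (enum [predC p]) (i - size la).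
  by apply: set_nth_default; exact: sz.
have lj := leq_trans li (ltnW ij).
rewrite -ltnNge.
have := sorted_ltn_nth tr j (sort_enum [predC p]); apply.
- by rewrite inE sz.
- by rewrite inE sz.
- by rewrite ltn_sub2rE.
Qed.

End CosetRepresentatives.

(** * Schur Q-functions as iterated residues *)

Lemma tofrac_inj (R : idomainType) : injective (@tofrac R).
Proof. by move=> p q /eqP; rewrite tofrac_eq => /eqP. Qed.

(** The factors of the Hall-Littlewood symmetrization at [t = -1], sorted by
    the position that they come from. *)
Definition hl_term (F : fieldType) (m : nat) (y : 'I_m -> F) (la : seq nat) (w : 'S_m) (i : 'I_m) : F :=
  y (w i) ^+ nth 0%N la i *
  \prod_(j < m | (nth 0%N la j < nth 0%N la i)%N)
    ((y (w i) + y (w j)) / (y (w i) - y (w j))).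

Section SchurQResidues.
Variables (k : fieldType) (m : nat).
Local Notation y := (@svar k m).
Implicit Type la : seq nat.

Lemma svar_inj : injective y.
Proof.
move=> i j /tofrac_inj/(congr1 (mcoeff U_(i)%MM)); rewrite !mcoeffXU eqxx.
by case: (j =P i) => [->|_] //= /eqP; rewrite oner_eq0.
Qed.

Lemma svar_neq0 i : y i != 0.
Proof.
rewrite -(rmorph0 (@tofrac _)) (inj_eq (@tofrac_inj _)); apply/eqP.
by move/(congr1 (mcoeff U_(i)%MM)); rewrite mcoeffXU eqxx mcoeff0 => /eqP; rewrite oner_eq0.
Qed.

Lemma Qrec_eq0 la (S : {set 'I_m}) : (#|S| < size la)%N -> Qrec y la S = 0.
Proof.
elim: la S => [|r la IH] S //= Sla; rewrite big1 // => i iS.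
by rewrite IH ?mulr0 //; move: Sla; rewrite (cardsD1 i) iS.
Qed.

Lemma hl_PE la : (size la <= m)%N ->
  hl_P m (-1) la =
    \sum_(w : 'S_m | block_increasing la w) \prod_(i < m) hl_term y la w i.
Proof.
move=> lam; rewrite /hl_P lam; apply: eq_bigr => w _; rewrite -big_split /=.
apply: eq_bigr => i _; congr (_ * _); apply: eq_bigr => j _.
by rewrite /scst !rmorphN !rmorph1 mulN1r opprK.
Qed.

Section Strict.
Variable la : seq nat.
Hypotheses (la_dec : sorted gtn la) (la_pos : all (leq 1) la).

(** Once the first [size p] values of [w] are fixed, the factors from position
    [size p] only involve the variables that remain, and form a residue. *)
Lemma hl_term_res (w : 'S_m) (p : seq 'I_m) (i : 'I_m) : uniq p ->
  has_prefix p w -> i = size p :> nat -> (i < size la)%N ->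
  hl_term y la w i = y (w i) ^+ nth 0%N la i * qres y (~: [set x in p]) (w i).
Proof.
move=> pu /forallP wp ip il; congr (_ * _).
rewrite (reindex_inj (@perm_inj _ (w^-1)%g)) /= /qres.
under eq_bigr => j _ do rewrite permKV.
apply: eq_bigl => j; rewrite !inE nth_strict_lt //.
have [jE|jw] := eqVneq j (w i); first by rewrite jE permK ltnn.
case: ltngtP => [ij||/val_inj ij] /=.
- apply/esym/negP => /nthP -/(_ j)[c kp kj].
  have km : (c < m)%N by rewrite (leq_trans kp) // -ip ltnW.
  have /implyP/(_ kp)/eqP := wp (Ordinal km).
  rewrite /= (set_nth_default j) // kj => wk; move: ij; rewrite -wk permK /=.
  by rewrite ip ltnNge ltnW.
- move=> ji; apply/esym/negbF; have /implyP := wp (w^-1 j)%g.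
  rewrite permKV -ip => /(_ ji)/eqP {1}->; rewrite mem_nth // -ip //.
- by rewrite ij permKV eqxx in jw.
Qed.

(** The coset representatives with a prescribed prefix contribute the residue
    recursion for the remaining parts and variables: sort them by their next
    value. The power of [2] collects one factor of [hl_b] for each part. *)
Lemma hl_prefix_sum (p : seq 'I_m) : (size la <= m)%N -> uniq p -> (size p <= size la)%N ->
  \sum_(w : 'S_m | block_increasing la w && has_prefix p w)
     \prod_(i < m | (size p <= i)%N) hl_term y la w i *+ 2 ^ (size la - size p)
  = Qrec y (drop (size p) la) (~: [set x in p]).
Proof.
move=> lam; have [d] := ubnP (size la - size p)%N.
elim: d p => // d IH p; rewrite ltnS => pd pu pl.
have [pE|pne] := eqVneq (size p) (size la).
  have [w0 w0P] := block_increasing_unique la_dec la_pos lam pu pE.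
  rewrite (eq_bigl _ _ w0P) big_pred1_eq pE subnn drop_size /=.
  rewrite big1 ?mulr1n // => i li; rewrite /hl_term nth_default // expr0 mul1r.
  by rewrite big_pred0 // => j; rewrite ltn0.
have {pne pl} pl : (size p < size la)%N by rewrite ltn_neqAle pne.
rewrite (drop_nth 0%N) //=.
pose i0 : 'I_m := Ordinal (leq_trans pl lam).
have prefixS w x : has_prefix p w && (w i0 == x) = has_prefix (rcons p x) w.
  apply/andP/forallP => [[/forallP wp /eqP wx] i|wp].
    apply/implyP; rewrite size_rcons ltnS leq_eqVlt nth_rcons => /orP[/eqP ip|ip].
      by rewrite ip ltnn eqxx -wx (_ : i = i0) //; apply/val_inj.
    by rewrite ip; exact: (implyP (wp i)).
  split; last first.
    by have := wp i0; rewrite size_rcons ltnSn nth_rcons ltnn eqxx.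
  apply/forallP=> i; apply/implyP => ip; have := wp i.
  by rewrite size_rcons ltnS ltnW // nth_rcons ip.
(* [x] is the next value of [w]; it lies outside the prefix *)
rewrite (partition_big (fun w : 'S_m => w i0) (mem (~: [set x in p]))) /=; last first.
  move=> w /andP[_ /forallP wp]; rewrite !inE; apply/negP => /nthP-/(_ (w i0))[c kp kw].
  have km : (c < m)%N by rewrite (leq_trans kp) // (leq_trans (ltnW pl)).
  have /implyP/(_ kp)/eqP := wp (Ordinal km).
  rewrite /= (set_nth_default (w i0)) // kw => /perm_inj/(congr1 val)/= kE.
  by rewrite kE ltnn in kp.
apply: eq_bigr => x; rewrite !inE => xp.
have pxu : uniq (rcons p x) by rewrite rcons_uniq xp.
have -> : ~: [set z in p] :\ x = ~: [set z in rcons p x].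
  by apply/setP=> z; rewrite !inE mem_rcons inE negb_or.
have := IH (rcons p x); rewrite size_rcons => <- //; last first.
  by apply: leq_trans pd; rewrite subnS prednK // subn_gt0.
rewrite mulr_sumr; apply: eq_big => [w|w]; first by rewrite -andbA prefixS.
move=> /andP[/andP[_ wp] /eqP wx].
rewrite (bigD1 i0) //= (hl_term_res pu wp) // wx.
rewrite (eq_bigl (fun i : 'I_m => (size p < i)%N)); last first.
  by move=> i; rewrite ltn_neqAle andbC -(inj_eq val_inj) /= eq_sym.
rewrite subnS -{1}(@prednK (size la - size p)) ?subn_gt0 // expnS.
by rewrite -mulrnAr -mulr_natl; ring.
Qed.

(** At [t = -1] each part of multiplicity one contributes [1 - t = 2]. *)
Lemma hl_b_strict : hl_b (-1 : k) la = 2 ^+ size la.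
Proof.
have u : uniq la by apply: sorted_uniq la_dec => [x y z /= h1 h2|x]; [exact: ltn_trans h2 h1|rewrite /= ltnn].
rewrite /hl_b.
have -> : 2 ^+ size la = \prod_(i <- la) (2 : k) by rewrite big_const_seq count_predT iter_mulr_1.
rewrite (eq_big_nat _ _ (F2 := fun i => if i \in la then 2 else 1)); last first.
  move=> i _; rewrite count_uniq_mem //; case: (i \in la).
    by rewrite big_nat1 expr1 opprK.
  by rewrite big_geq.
rewrite -big_mkcond /= -big_filter; apply: perm_big; apply: uniq_perm => //.
  by rewrite filter_uniq // iota_uniq.
move=> i; rewrite mem_filter mem_index_iota; case: (boolP (i \in la)) => //= ila.
rewrite ltnS (allP la_pos) //= sumnE (big_rem i) //=; exact: leq_addr.
Qed.

Lemma schurQ_Qrec : schurQ k m la = Qrec y la [set: 'I_m].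
Proof.
rewrite /schurQ /hl_Q hl_b_strict.
have [lam|lam] := leqP (size la) m; last first.
  rewrite /hl_P leqNgt lam mulr0 Qrec_eq0 //.
  by rewrite cardsT card_ord.
have := hl_prefix_sum (p := [::]) lam isT isT; rewrite subn0 drop0 => E.
rewrite (_ : ~: [set x in [::]] = setT) in E; last by apply/setP=> x; rewrite !inE.
rewrite -E hl_PE // mulr_sumr; apply: eq_big => [w|w _].
  by rewrite (_ : has_prefix _ _) ?andbT //; apply/forallP.
by rewrite /scst !rmorphXn !rmorph_nat -natrX mulr_natl.
Qed.

End Strict.
End SchurQResidues.

(** * Schur Q-functions as polynomials *)

Lemma rmorph_qfam (A B : comNzRingType) (f : {rmorphism A -> B}) (I : finType)
    (S : {set I}) (y : I -> A) r :
  f (qfam S y r) = qfam S (fun i => f (y i)) r.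
Proof.
rewrite /qfam; elim/big_rec2: _ r => [|i q p _ IH] r.
  by rewrite /ps_one; case: r => [|r]; rewrite ?rmorph1 ?rmorph0.
rewrite /ps_mul rmorph_sum; apply: eq_bigr => s _; rewrite rmorphM IH; congr (_ * _).
by case: (nat_of_ord s) => [|s']; rewrite ?qser0 ?rmorph1 // !qserS rmorphMn rmorphXn.
Qed.

Lemma rmorph_qprod (A B : comNzRingType) (f : {rmorphism A -> B}) (I : finType)
    (S : {set I}) (y : I -> A) be :
  f (qprod S y be) = qprod S (fun i => f (y i)) be.
Proof. by rewrite /qprod rmorph_prod; apply: eq_bigr => r _; rewrite rmorph_qfam. Qed.

(** The expansion of [Q_la] in products of the [q_r] has integer coefficients,
    hence makes sense over every commutative ring. Identities can so be moved
    between the complex numbers, the integers and the field [K]. *)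
Definition Qpoly (A : comNzRingType) (m : nat) (la : seq nat) : {mpoly A[m]} :=
  \sum_(ca <- qexp la) ca.1%:~R * qprod setT (fun i => 'X_i) ca.2.

Lemma rmorph_Qpoly (A B : comNzRingType) m (f : {rmorphism {mpoly A[m]} -> B}) la :
  f (Qpoly A m la) = \sum_(ca <- qexp la) ca.1%:~R * qprod setT (fun i => f 'X_i) ca.2.
Proof.
rewrite /Qpoly rmorph_sum; apply: eq_bigr => ca _.
by rewrite rmorphM rmorph_qprod rmorph_int.
Qed.

Lemma schurQ_Qpoly (k : fieldType) m la : sorted gtn la -> all (leq 1) la ->
  schurQ k m la = tofrac (Qpoly k m la).
Proof.
move=> la_dec la_pos; rewrite (rmorph_Qpoly (@tofrac {mpoly k[m]})) schurQ_Qrec //.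
by apply: Qrec_qexp => //; [exact: svar_inj|exact: svar_neq0].
Qed.

Lemma map_Qpoly (A B : comNzRingType) (f : {rmorphism A -> B}) m la :
  map_mpoly f (Qpoly A m la) = Qpoly B m la.
Proof.
rewrite (rmorph_Qpoly (map_mpoly f)).
have -> : (fun i : 'I_m => map_mpoly f 'X_i) = (fun i => 'X_i).
  by apply/funext=> i; exact: map_mpolyX.
by [].
Qed.

Section LeadingMonomials.
Variables (A : idomainType) (m : nat).
Implicit Types (p q : {mpoly A[m]}) (u w : 'X_{1..m}).

(** The monomial [u] bounds the leading monomial of [p]; allowing [c = 0] makes
    the notion additive. *)
Definition top_coef p u (c : A) := (mlead p <= u)%O /\ p@_u = c.

Lemma top_coefM p q u w c d :
  top_coef p u c -> top_coef q w d -> top_coef (p * q) (u + w)%MM (c * d).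
Proof.
case=> pu <- [qw <-]; split; last by rewrite mleadcMW.
rewrite (le_trans (mleadM_le _ _)) // lem_add //.
Qed.

Lemma top_coefD p q u c d :
  top_coef p u c -> top_coef q u d -> top_coef (p + q) u (c + d).
Proof.
case=> pu <- [qu <-]; split; last by rewrite mcoeffD.
by rewrite (le_trans (mleadD_le _ _)) // leUx pu.
Qed.

Lemma top_coef_prod (I : Type) (r : seq I) (P : pred I) (F : I -> {mpoly A[m]}) U C :
  (forall i, P i -> top_coef (F i) (U i) (C i)) ->
  top_coef (\prod_(i <- r | P i) F i) (\sum_(i <- r | P i) U i)%MM (\prod_(i <- r | P i) C i).
Proof.
move=> h; elim: r => [|i r IH]; rewrite ?big_nil ?big_cons.
  by split; rewrite ?mlead1 ?lexx ?mcoeff1 ?eqxx.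
by case: ifP => // Pi; apply: top_coefM (h _ Pi) IH.
Qed.

Lemma top_coefX u : top_coef 'X_[u] u 1.
Proof. by split; rewrite ?mleadXm // mcoeffX eqxx. Qed.

Lemma top_coefZ p u c a : top_coef p u c -> top_coef (a *: p) u (a * c).
Proof. by case=> pu <-; split; rewrite ?mcoeffZ // (le_trans (mleadZ_le _ _)). Qed.

Lemma top_coef_lt p u w : (mlead p <= w)%O -> (w < u)%O -> top_coef p u 0.
Proof.
by move=> pw wu; split; [exact: le_trans pw (ltW wu)|rewrite mcoeff_gt_mlead ?(le_lt_trans pw)].
Qed.

Lemma top_coefXD (i j : 'I_m) (a : A) : (i < j)%N -> top_coef ('X_i + a *: 'X_j) U_(i) 1.
Proof.
move=> ij; rewrite -[X in top_coef _ _ X]addr0; apply: top_coefD; first exact: top_coefX.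
rewrite -(mulr0 a); apply: top_coefZ; apply: (@top_coef_lt _ _ U_(j)); rewrite ?mleadXm //.
apply/ltmcP; first by rewrite !mdeg1.
exists i => [l li|]; rewrite !mnm1E.
  by rewrite -!val_eqE /= !gtn_eqF // (ltn_trans li).
by rewrite eqxx -val_eqE /= gtn_eqF.
Qed.

(** Cancellation of a factor of leading coefficient one. It is used to divide by
    a Vandermonde product. *)
Lemma top_coef_divl p q u w c : top_coef p u 1 -> top_coef (p * q) (u + w)%MM c ->
  top_coef q w c.
Proof.
case=> pu pc [pqu pqc].
have p0 : p != 0 by apply: contra_eq_neq pc => ->; rewrite mcoeff0 eq_sym oner_neq0.
have pE : mlead p = u.
  apply/eqP; rewrite eq_le pu /= leNgt; apply/negP => /mcoeff_gt_mlead.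
  by rewrite pc => /eqP; rewrite oner_eq0.
have qw : (mlead q <= w)%O.
  have [->|q0] := eqVneq q 0; first by rewrite mlead0 le0m.
  by move: pqu; rewrite mleadM // pE lemc_add2r.
by split=> //; move: pqc; rewrite mleadcMW // pc mul1r.
Qed.

End LeadingMonomials.

Definition part_mnm (m : nat) (s : seq nat) : 'X_{1..m} := [multinom nth 0%N s i | i < m].

Lemma mdeg_part_mnm m s : (size s <= m)%N -> mdeg (part_mnm m s) = sumn s.
Proof.
move=> sm; rewrite mdegE sumnE (big_nth 0%N) big_mkord (big_ord_widen m (nth 0%N s)) //.
rewrite [RHS]big_mkcond /=; apply: eq_bigr => i _; rewrite mnmE; case: ltnP => // h.
by rewrite nth_default.
Qed.

Lemma part_mnm_lt (m : nat) (s t : seq nat) : (size s <= m)%N -> size s = size t -> sumn s = sumn t ->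
  (s < t :> seqlexi nat)%O -> (part_mnm m s < part_mnm m t)%O.
Proof.
move=> sm st sumst lt.
apply/ltmcP; first by rewrite !mdeg_part_mnm // -st.
have : exists2 i, (i < size s)%N & (forall j, (j < i)%N -> nth 0%N s j = nth 0%N t j) /\ (nth 0%N s i < nth 0%N t i)%N.
  elim: s t st {sm sumst} lt => [|x s IH] [|z t] //= [st].
  rewrite ltxi_cons leEnat leq_eqVlt => /andP[/orP[/eqP->|xz _]].
    rewrite leqnn => /(IH t st)[i si [h1 h2]].
    by exists i.+1 => //; split=> // -[|j] //; rewrite ltnS; exact: h1.
  by exists 0%N => //.
case=> i si [h1 h2]; have im := leq_trans si sm.
exists (Ordinal im) => [j ji|]; rewrite !mnmE //; exact: h1.
Qed.

(** * Leading monomials of Schur Q-functions *)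

Lemma prod_pairs (A : comNzRingType) m (h : 'I_m -> 'I_m -> A) : (forall i, h i i = 1) ->
  \prod_i \prod_j h i j = \prod_(i < m) \prod_(j < m | (i < j)%N) (h i j * h j i).
Proof.
move=> h1; have split3 i : \prod_j h i j =
    (\prod_(j < m | (i < j)%N) h i j) * \prod_(j < m | (j < i)%N) h i j.
  rewrite (bigID (fun j : 'I_m => (i < j)%N)) /=; congr (_ * _).
  rewrite (bigD1 i) ?ltnn //= h1 mul1r; apply: eq_bigl => j.
  by rewrite -leqNgt andbC -val_eqE /= -ltn_neqAle.
under eq_bigr => i _ do rewrite split3.
rewrite big_split /= [X in _ * X](exchange_big_dep predT) //= -big_split /=.
by apply: eq_bigr => i _; rewrite -big_split.
Qed.

Section QLeading.
Variables (k : fieldType) (m : nat) (la : seq nat).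
Hypotheses (la_dec : sorted gtn la) (la_pos : all (leq 1) la) (la_m : (size la <= m)%N).
Hypothesis two_neq0 : (2 : k) != 0.

Let part_at (w : 'S_m) (i : 'I_m) := nth 0%N la ((w^-1)%g i).

Let pair_coef (w : 'S_m) (i j : 'I_m) : k := if (part_at w j <= part_at w i)%N then 1 else -1.
Let pair_sign (w : 'S_m) (i j : 'I_m) : k := if part_at w i == part_at w j then -1 else 1.

(** The common denominator of the terms of the Hall-Littlewood sum. *)
Definition vandermonde_prod : {mpoly k[m]} :=
  \prod_(i < m) \prod_(j < m | (i < j)%N) ('X_i + (-1) *: 'X_j).

(** The numerator of the term of [w] over the common denominator. A pair [i < j]
    contributes [x_i + x_j], up to sign, if the parts carried by [x_i] and [x_j]
    differ, and the cancelled factor [x_i - x_j] if they agree. *)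
Let num (w : 'S_m) : {mpoly k[m]} :=
  (\prod_(i < m) 'X_i ^+ part_at w i) *
  \prod_(i < m) \prod_(j < m | (i < j)%N) (pair_coef w i j *: ('X_i + pair_sign w i j *: 'X_j)).

Section NumeratorImage.
Variables (F : fieldType) (f : {rmorphism {mpoly k[m]} -> F}).
Hypothesis f_inj : injective f.
Local Notation y := (fun i : 'I_m => f 'X_i).

Lemma image_num (w : 'S_m) :
  f (num w) = f vandermonde_prod * \prod_(i < m) hl_term y la w i.
Proof.
have y_inj i j : f 'X_i = f 'X_j -> i = j.
  move/f_inj/(congr1 (mcoeff U_(i)%MM)); rewrite !mcoeffXU eqxx.
  by case: (j =P i) => [->|_] //= /eqP; rewrite oner_eq0.
rewrite big_split /= mulrCA rmorphM; congr (_ * _).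
  rewrite rmorph_prod [RHS](reindex_inj (@perm_inj _ (w^-1)%g)) /=.
  by apply: eq_bigr => i _; rewrite permKV rmorphXn.
rewrite [X in _ * X](reindex_inj (@perm_inj _ (w^-1)%g)) /=.
pose h (i j : 'I_m) := if (part_at w j < part_at w i)%N then (y i + y j) / (y i - y j) else 1.
have -> : \prod_(i < m) \prod_(j < m | (nth 0%N la j < nth 0%N la ((w^-1)%g i))%N)
    ((f 'X_(w ((w^-1)%g i)) + f 'X_(w j)) / (f 'X_(w ((w^-1)%g i)) - f 'X_(w j)))
    = \prod_i \prod_j h i j.
  apply: eq_bigr => i _; rewrite [LHS](reindex_inj (@perm_inj _ (w^-1)%g)) /=.
  by rewrite big_mkcond /=; apply: eq_bigr => j _; rewrite !permKV.
rewrite prod_pairs => [|i]; last by rewrite /h ltnn.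
rewrite !rmorph_prod -big_split /=; apply: eq_bigr => i _.
rewrite !rmorph_prod -big_split /=; apply: eq_bigr => j ij.
have nz : y i - y j != 0.
  by rewrite subr_eq0; apply/eqP => /y_inj eq; rewrite eq ltnn in ij.
have nz' : y j - y i != 0 by rewrite -opprB oppr_eq0.
rewrite /h /pair_coef /pair_sign; case: ltngtP => lij.
- by rewrite !scaleN1r !scale1r !(rmorphD, rmorphN); field.
- by rewrite !scaleN1r !scale1r !(rmorphD, rmorphN); field.
- by rewrite scale1r !mulr1.
Qed.

End NumeratorImage.

Definition rho : 'X_{1..m} := (\sum_(i < m) \sum_(j < m | (i < j)%N) U_(i))%MM.

Lemma top_vandermonde : top_coef vandermonde_prod rho 1.
Proof.
suff : top_coef vandermonde_prod rho
   (\prod_(i < m) \prod_(j < m | (i < j)%N) (1 : k)).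
  by rewrite big1 // => i _; rewrite big1.
by apply: top_coef_prod => i _; apply: top_coef_prod => j ij; exact: top_coefXD.
Qed.

Let mon_at (w : 'S_m) : 'X_{1..m} := [multinom part_at w i | i < m].

Lemma top_num (w : 'S_m) :
  top_coef (num w) (mon_at w + rho)%MM (\prod_(i < m) \prod_(j < m | (i < j)%N) pair_coef w i j).
Proof.
rewrite -[X in top_coef _ _ X]mul1r; apply: top_coefM.
  have -> : \prod_(i < m) 'X_i ^+ part_at w i = 'X_[mon_at w] :> {mpoly k[m]}.
    by rewrite [RHS]mpolyXE_id; apply: eq_bigr => i _; rewrite mnmE.
  exact: top_coefX.
apply: top_coef_prod => i _; apply: top_coef_prod => j ij.
by rewrite -[X in top_coef _ _ X]mulr1; apply: top_coefZ; exact: top_coefXD.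
Qed.

(** At the first position moved by [w], a part of [la] is replaced by a later,
    smaller one. *)
Lemma mon_at_lt (w : 'S_m) : block_increasing la w -> w != 1%g -> (mon_at w < part_mnm m la)%O.
Proof.
move=> wb w1; have mdegE : mdeg (mon_at w) = mdeg (part_mnm m la).
  rewrite !mdegE [LHS](reindex_inj (@perm_inj _ w)) /=.
  by apply: eq_bigr => i _; rewrite !mnmE /part_at permK.
apply/ltmcP => //.
have ex : exists i : 'I_m, (w^-1)%g i != i.
  case: (pickP (fun i : 'I_m => (w^-1)%g i != i)) => [i h|h]; first by exists i.
  case/eqP: w1; apply: invg_inj; rewrite invg1; apply/permP => i; rewrite perm1.
  by have /negbFE/eqP := h i.
case: (arg_minnP (fun i : 'I_m => i : nat) (P := fun i => (w^-1)%g i != i)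
  (i0 := xchoose ex) (xchooseP ex)) => i wi imin.
have fixed (j : 'I_m) : (j < i)%N -> (w^-1)%g j = j.
  by move=> ji; apply/eqP; apply: contraTT ji => /imin; rewrite -leqNgt.
have iw : (i < (w^-1)%g i)%N.
  rewrite ltn_neqAle val_eqE eq_sym wi /= leqNgt; apply/negP => lt.
  by have /perm_inj/eqP := fixed _ lt; rewrite (negPf wi).
have il : (i < size la)%N.
  rewrite ltnNge; apply/negP => li.
  have wwi : (w i <= i)%N.
    rewrite leqNgt; apply/negP => iwi.
    have := block_increasing_tail wb li iw; rewrite permKV => h.
    by have := ltn_trans h iwi; rewrite ltnn.
  have wni : w i != i by apply: contra wi => /eqP{1}<-; rewrite permK.
  have lt : (w i < i)%N by rewrite ltn_neqAle val_eqE wni.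
  by have := fixed _ lt; rewrite permK => wi'; rewrite -wi' ltnn in lt.
exists i => [j ji|]; rewrite !mnmE /part_at; first by rewrite fixed.
by rewrite nth_strict_lt.
Qed.

(** Among the numerators over the Vandermonde product, that of the identity has
    the largest monomial, and its coefficient is the factor [hl_b], that is
    [2 ^ size la]. *)
Lemma top_coef_Qpoly : top_coef (Qpoly k m la) (part_mnm m la) (2 ^+ size la).
Proof.
apply: (top_coef_divl top_vandermonde).
have -> : vandermonde_prod * Qpoly k m la =
    \sum_(w : 'S_m | block_increasing la w) (2 ^+ size la : k) *: num w.
  apply: tofrac_inj; rewrite tofracM -schurQ_Qpoly //.
  rewrite (raddf_sum (@tofrac {mpoly k[m]})) /schurQ /hl_Q hl_PE // hl_b_strict //.
  rewrite mulrCA !mulr_sumr; apply: eq_bigr => w _.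
  rewrite -(image_num (f := @tofrac {mpoly k[m]}) (@tofrac_inj _)) -tofracM.
  by rewrite mul_mpolyC.
rewrite (bigD1 (1%g : 'S_m)) /=; last first.
  by apply: tail_block_increasing => // i j li ij; rewrite !perm1.
have -> : part_mnm m la = mon_at 1%g by apply/mnmP => i; rewrite !mnmE /part_at invg1 perm1.
rewrite addmC -[X in top_coef _ _ X]addr0; apply: top_coefD.
  rewrite -[X in top_coef _ _ X]mulr1; apply: top_coefZ.
  suff <- : \prod_(i < m) \prod_(j < m | (i < j)%N) pair_coef 1 i j = 1 by exact: top_num.
  apply: big1 => i _; apply: big1 => j ij; rewrite /pair_coef /part_at invg1 !perm1.
  case: ifP => // /negP[]; have [il|il] := ltnP i (size la).
    by rewrite ltnW // nth_strict_lt.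
  by rewrite [X in (X <= _)%N]nth_default // (leq_trans il) // ltnW.
have mw1 : mon_at 1%g = part_mnm m la by apply/mnmP => i; rewrite !mnmE /part_at invg1 perm1.
elim/big_rec: _ => [|w p /andP[wb w1] IH]; first by split; rewrite ?mlead0 ?le0m ?mcoeff0.
rewrite -[X in top_coef _ _ X]addr0; apply: top_coefD => //.
rewrite -(mulr0 (2 ^+ size la)); apply: top_coefZ.
have [h _] := top_num w; apply: (top_coef_lt h).
rewrite ltmc_add2l mw1; exact: mon_at_lt.
Qed.

End QLeading.

(** * The functions q_r in odd power sums *)

Lemma parts_inj n : injective (@parts n).
Proof.
move=> la ka eq; apply/val_inj/val_inj; move: eq; rewrite /parts => /inj_map; apply.
exact: val_inj.
Qed.

Lemma parts_partition n (la : npartition n) : is_partition n (parts la).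
Proof. exact: (valP la). Qed.

Lemma partitionP n s : is_partition n s -> exists la : npartition n, parts la = s.
Proof.
move=> sP; have /and3P[_ spos /eqP ssum] := sP.
have sn : all (fun i => i < n.+1)%N s.
  apply/allP => i is_; rewrite ltnS -ssum sumnE (big_rem i) //=; exact: leq_addr.
have ssz : (size s <= n)%N.
  rewrite -ssum {sP sn ssum}; elim: s spos => //= x s IH /andP[x0 /IH h].
  by rewrite -add1n leq_add.
pose t : seq 'I_n.+1 := [seq inord i | i <- s].
have tE : map val t = s.
  rewrite -map_comp -[RHS]map_id; apply/eq_in_map => i /(allP sn) h.
  by rewrite /= inordK.
have tn : (size t <= n)%N by rewrite size_map.
have tP : is_partition n (map val (Bseq tn : n.-bseq 'I_n.+1)) by rewrite /= tE.
by exists (Sub (Bseq tn) tP); rewrite /parts SubK.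
Qed.

Definition plist n := [seq parts la | la : npartition n].

Lemma plist_uniq n : uniq (plist n).
Proof. by rewrite map_inj_uniq ?enum_uniq //; exact: parts_inj. Qed.

Lemma mem_plist n s : (s \in plist n) = is_partition n s.
Proof.
apply/mapP/idP => [[la _ ->]|/partitionP[la <-]]; first exact: parts_partition.
by exists la => //; rewrite mem_enum.
Qed.

Lemma big_plist (A : nmodType) n (P : pred (seq nat)) (F : seq nat -> A) :
  \sum_(la : npartition n | P (parts la)) F (parts la) = \sum_(s <- plist n | P s) F s.
Proof. by rewrite big_map big_enum_cond. Qed.

Lemma zmu_widen s N : (sumn s <= N)%N ->
  zmu s = (\prod_(1 <= i < N.+1) (i ^ count_mem i s * (count_mem i s)`!))%N.
Proof.
move=> sN; rewrite (@big_cat_nat _ _ _ (sumn s).+1) //= -/(zmu s).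
rewrite [X in (_ * X)%N]big1_seq ?muln1 // => i /andP[_]; rewrite mem_index_iota => /andP[si _].
have -> : count_mem i s = 0%N.
  apply/count_memPn/negP => is_; move: si.
  by rewrite ltnNge sumnE (big_rem i) //= leq_addr.
by [].
Qed.

Lemma zmu_perm s t : perm_eq s t -> zmu s = zmu t.
Proof.
move=> st; rewrite /zmu (perm_sumn st); apply: eq_bigr => i _.
by rewrite (seq.permP st).
Qed.

Lemma zmu_cons r s : (0 < r)%N -> zmu (r :: s) = (r * (count_mem r s).+1 * zmu s)%N.
Proof.
move=> r0; rewrite (@zmu_widen (r :: s) (r + sumn s)) // (@zmu_widen s (r + sumn s)) ?leq_addl //.
have rin : r \in index_iota 1 (r + sumn s).+1 by rewrite mem_index_iota r0 ltnS leq_addr.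
rewrite !(bigD1_seq r rin (iota_uniq _ _)) /= eqxx add1n expnS factS.
rewrite (eq_bigr (fun i => i ^ count_mem i s * (count_mem i s)`!)%N); first by ring.
by move=> i ir; rewrite eq_sym (negPf ir) add0n.
Qed.

Lemma sumn_count s N : (sumn s <= N)%N -> sumn s = (\sum_(1 <= r < N.+1) r * count_mem r s)%N.
Proof.
elim: s => [|x s IH] sN; first by rewrite big1 //= => i _; rewrite muln0.
under eq_bigr => r _ do rewrite /= mulnDr.
rewrite big_split /= -IH; last by apply: leq_trans sN; exact: leq_addl.
congr (_ + _)%N; case: (posnP x) => [->|x0].
  by rewrite big1_seq // => i; rewrite mem_index_iota => /andP[_ /andP[i0 _]]; rewrite ltn_eqF ?muln0.
have xin : x \in index_iota 1 N.+1.
  by rewrite mem_index_iota x0 ltnS (leq_trans _ sN) //= leq_addr.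
rewrite (bigD1_seq x xin (iota_uniq _ _)) /= eqxx muln1 big1 ?addn0 // => i ix.
by rewrite eq_sym (negPf ix) muln0.
Qed.

Section ExponentialFormula.
Variables (k : fieldType) (A : comNzRingType) (c : {rmorphism k -> A}) (f : nat -> A).
Hypothesis k_char0 : forall n, n.+1%:R != 0 :> k.

(** The weight of [s] in the exponential formula; [f r] stands for twice the
    power sum of degree [r]. *)
Definition zweight (s : seq nat) : A := c ((zmu s)%:R^-1) * \prod_(r <- s) f r.

Definition odd_zsum n := \sum_(s <- plist n | all odd s) zweight s.

Lemma plist_rem n r : (0 < r <= n)%N ->
  perm_eq [seq s <- plist n | r \in s] [seq sort geq (r :: t) | t <- plist (n - r)].
Proof.
move=> /andP[r0 rn]; have geq_tot : total geq by move=> x y; exact: leq_total.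
have geq_tr : transitive geq by move=> x y z /= h1 h2; exact: leq_trans h2 h1.
have geq_as : antisymmetric geq by move=> x y; rewrite andbC => /anti_leq.
have pP s : is_partition n s -> sorted geq s by case/and3P.
apply: uniq_perm; first by rewrite filter_uniq ?plist_uniq.
  rewrite map_inj_in_uniq ?plist_uniq // => s t; rewrite !mem_plist => /and3P[ss _ _] /and3P[ts _ _] eq.
  apply: (sorted_eq geq_tr geq_as ss ts).
  by rewrite -(perm_cons r) -(perm_sort geq) eq perm_sort perm_refl.
move=> s; rewrite mem_filter mem_plist; apply/andP/mapP => [[rs sP]|[t]].
  exists (rem r s).
    rewrite mem_plist; have /and3P[ss spos /eqP ssum] := sP; apply/and3P; split.
    - by apply: subseq_sorted ss => //; exact: rem_subseq.
    - by apply/allP => x /mem_rem/(allP spos).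
    - by rewrite -ssum (perm_sumn (perm_to_rem rs)) /= addKn.
  apply: (sorted_eq geq_tr geq_as (pP _ sP)); first exact: sort_sorted.
  by rewrite perm_sym perm_sort perm_sym perm_to_rem.
rewrite mem_plist => /and3P[_ tpos /eqP tsum] ->; split.
  by rewrite mem_sort mem_head.
apply/and3P; split; first exact: sort_sorted.
  by rewrite all_sort /= r0.
by rewrite (perm_sumn (permEl (perm_sort _ _))) /= tsum subnKC.
Qed.

Lemma zweight_cons r t : (0 < r)%N ->
  (r * count_mem r (sort geq (r :: t)))%:R * zweight (sort geq (r :: t)) = f r * zweight t.
Proof.
move=> r0; rewrite /zweight (seq.permP (permEl (perm_sort geq (r :: t)))).
rewrite (zmu_perm (permEl (perm_sort geq (r :: t)))) (perm_big _ (permEl (perm_sort _ _))) /=.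
rewrite big_cons zmu_cons // eqxx add1n mulrA -(rmorph_nat c) -rmorphM.
rewrite mulrCA; congr (_ * (c _ * _)); rewrite [(_ * zmu t)%:R]natrM invfM mulrA divff ?mul1r //.
by rewrite -(prednK r0) mulSn addSn; exact: k_char0.
Qed.

(** Double counting: write [n] as the sum of the parts, and for each size [r]
    remove one part of that size. *)
Lemma odd_zsum_rec n : n%:R * odd_zsum n =
  \sum_(1 <= r < n.+1 | odd r) f r * odd_zsum (n - r).
Proof.
rewrite /odd_zsum mulr_sumr.
transitivity (\sum_(s <- plist n | all odd s) \sum_(1 <= r < n.+1)
    (r * count_mem r s)%:R * zweight s).
  rewrite big_seq_cond [RHS]big_seq_cond; apply: eq_bigr => s /andP[].
  rewrite mem_plist => /and3P[_ _ /eqP sn] _.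
  by rewrite -mulr_suml -natr_sum -sumn_count ?sn.
rewrite exchange_big /= [RHS]big_mkcond /= big_seq_cond [RHS]big_seq_cond.
apply: eq_bigr => r /andP[]; rewrite mem_index_iota => /andP[r0 rn] _.
rewrite (bigID (fun s => r \in s)) /= [X in _ + X]big1 ?addr0; last first.
  by move=> s /andP[_ /count_memPn ->]; rewrite muln0 mul0r.
under eq_bigl => s do rewrite andbC.
rewrite -big_filter_cond (perm_big _ (plist_rem (n := n) (r := r) _)) /=; last by rewrite r0.
rewrite big_map; under eq_bigl => s do rewrite all_sort /=.
case: (odd r) => /=; last by rewrite big_pred0.
by rewrite mulr_sumr; apply: eq_bigr => t _; rewrite zweight_cons.
Qed.

Lemma odd_zsum0 : odd_zsum 0 = 1.
Proof.
have p0 : perm_eq (plist 0) [:: [::]].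
  apply: uniq_perm; rewrite ?plist_uniq // => s; rewrite mem_plist inE.
  by apply/idP/eqP => [/and3P[]|->] //; case: s => //= -[|x] s.
rewrite /odd_zsum (perm_big _ p0) /= big_cons big_nil /= addr0 /zweight big_nil mulr1.
by rewrite /zmu big_nil invr1 rmorph1.
Qed.

Lemma odd_zsum_unique (q : nat -> A) : q 0%N = 1 ->
  (forall n, n%:R * q n = \sum_(1 <= r < n.+1 | odd r) f r * q (n - r)%N) ->
  forall n, q n = odd_zsum n.
Proof.
move=> q0 qrec n; elim/ltn_ind: n => -[|n] IH; first by rewrite odd_zsum0.
have nz : c (n.+1%:R^-1) * n.+1%:R = 1.
  by rewrite -(rmorph_nat c) -rmorphM mulVf ?rmorph1.
rewrite -[q _]mul1r -[odd_zsum _]mul1r -nz -!mulrA qrec odd_zsum_rec; congr (_ * _).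
rewrite big_seq_cond [RHS]big_seq_cond; apply: eq_bigr => r /andP[].
rewrite mem_index_iota => /andP[r0 rn] _; rewrite IH //.
by rewrite ltn_subrL r0.
Qed.

End ExponentialFormula.

Section QPowerSums.
Variables (A : comNzRingType) (I : finType) (S : {set I}) (y : I -> A).

(** The derivation [t d/dt]. *)
Definition ps_euler (g : nat -> A) (n : nat) : A := n%:R * g n.

Lemma ps_eulerM (g h : nat -> A) n :
  ps_euler (ps_mul g h) n = ps_mul (ps_euler g) h n + ps_mul g (ps_euler h) n.
Proof.
rewrite /ps_euler /ps_mul mulr_sumr -big_split /=; apply: eq_bigr => i _.
by rewrite -{1}(subnKC (ltn_ord i : i <= n)%N) natrD; ring.
Qed.

Definition oddpow (x : A) (j : nat) : A := if odd j then x ^+ j *+ 2 else 0.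

Lemma sum_odd n : (\sum_(i < n) odd i = n./2)%N.
Proof.
elim: n => [|n IH]; first by rewrite big_ord0.
by rewrite big_ord_recr IH /= uphalf_half addnC.
Qed.

Lemma ps_euler_qser x n : ps_euler (qser x) n = ps_mul (oddpow x) (qser x) n.
Proof.
rewrite /ps_euler /ps_mul big_ord_recr /= subnn qser0 mulr1.
case: n => [|n]; first by rewrite mul0r big_ord0 add0r.
rewrite qserS (eq_bigr (fun i : 'I_n.+1 => (odd i)%:R * (x ^+ n.+1 *+ 4))); last first.
  move=> i _; have il : (i <= n)%N by rewrite -ltnS.
  rewrite /oddpow (subSn il) qserS; case: (odd i); last by rewrite !mul0r.
  by rewrite mul1r mulrnAl mulrnAr -mulrnA -exprD addnS subnKC.
rewrite -mulr_suml -natr_sum sum_odd /oddpow.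
rewrite -{1}(odd_double_half n.+1) natrD -mul2n natrM.
by case: (odd n.+1); rewrite ?mulr1n ?mulr0n; ring.
Qed.

Lemma ps_euler_qfam n : ps_euler (qfam S y) n =
  ps_mul (fun j => \sum_(i in S) oddpow (y i) j) (qfam S y) n.
Proof.
rewrite /qfam -big_enum /=.
have -> : (fun j => \sum_(i in S) oddpow (y i) j) = (fun j => \sum_(i <- enum S) oddpow (y i) j).
  by apply/funext=> j; rewrite big_enum.
elim: (enum S) n => [|i r IH] n.
  rewrite !big_nil /ps_euler /ps_mul big1 => [|j _]; last by rewrite big_nil mul0r.
  by rewrite /ps_one; case: n => [|n]; rewrite ?mul0r ?mulr0.
rewrite !big_cons; set q := \big[@ps_mul A/@ps_one A]_(j <- r) qser (y j) in IH *.
rewrite ps_eulerM (_ : ps_euler (qser (y i)) = ps_mul (oddpow (y i)) (qser (y i))); last first.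
  by apply/funext=> j; rewrite ps_euler_qser.
rewrite (_ : ps_euler q = ps_mul (fun j => \sum_(i <- r) oddpow (y i) j) q); last by apply/funext.
rewrite ps_mulA (ps_mulC (qser _)) -!ps_mulA -/q /ps_mul -big_split /=.
by apply: eq_bigr => j _; rewrite big_cons mulrDl.
Qed.

(** The logarithmic derivative of [(1 + x t) / (1 - x t)] is the series of odd
    powers of [x], doubled. *)
Lemma qfam_rec n : n%:R * qfam S y n =
  \sum_(1 <= r < n.+1 | odd r) ((\sum_(i in S) y i ^+ r) *+ 2) * qfam S y (n - r).
Proof.
rewrite -[LHS]/(ps_euler _ n) ps_euler_qfam /ps_mul big_ord_recl /= [X in X * _]big1 ?mul0r ?add0r //.
rewrite big_add1 /= big_mkord [RHS]big_mkcond /=; apply: eq_bigr => i _.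
rewrite /oddpow /=; case: ifP => _; last by rewrite big1 ?mul0r.
by rewrite sumrMnl.
Qed.

End QPowerSums.

(** Both sides satisfy the recursion [qfam_rec], which determines them in
    characteristic zero. *)
Lemma qfam_power_sums (k : fieldType) (A : comNzRingType) (c : {rmorphism k -> A})
    (I : finType) (S : {set I}) (y : I -> A) n :
  (forall n, n.+1%:R != 0 :> k) ->
  qfam S y n = \sum_(mu : npartition n | is_OP mu)
    c ((zmu (parts mu))%:R^-1) * \prod_(r <- parts mu) ((\sum_(i in S) y i ^+ r) *+ 2).
Proof.
move=> k0; rewrite (odd_zsum_unique c k0 (qfam0 S y) (qfam_rec S y)).
by rewrite /odd_zsum /zweight -big_plist.
Qed.

(** * The Cauchy kernel *)

Definition ppoly (k : comNzRingType) (N : nat) (mu : seq nat) : {mpoly k[N]} :=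
  \prod_(r <- mu) \sum_(j < N) 'X_j ^+ r.

Lemma map_ppoly (k A : comNzRingType) (c : {rmorphism k -> A}) N mu :
  map_mpoly c (ppoly k N mu) = ppoly A N mu.
Proof.
rewrite /ppoly rmorph_prod; apply: eq_bigr => r _; rewrite rmorph_sum; apply: eq_bigr => j _.
by rewrite rmorphXn /= map_mpolyX.
Qed.

Lemma qfamT (A : comNzRingType) (I : finType) (y : I -> A) :
  qfam setT y = \big[@ps_mul A/@ps_one A]_i qser (y i).
Proof. by apply: eq_bigl => i; rewrite inE. Qed.

Lemma qfam_scale (A : comNzRingType) (I : finType) (S : {set I}) (y : I -> A) a b :
  qfam S (fun i => y i * a) b = qfam S y b * a ^+ b.
Proof.
rewrite /qfam; elim/big_rec2: _ b => [|i q p _ IH] b.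
  by case: b => [|b]; rewrite /ps_one ?mulr1 ?mul0r.
rewrite /ps_mul mulr_suml; apply: eq_bigr => s _; rewrite IH.
have -> : qser (y i * a) s = qser (y i) s * a ^+ s.
  by case: (nat_of_ord s) => [|s']; rewrite ?qser0 ?mulr1 // !qserS exprMn mulrnAl.
have -> : a ^+ b = a ^+ s * a ^+ (b - s) by rewrite -exprD subnKC // -ltnS.
by ring.
Qed.

Section ProductCoefficient.
Variables (A : comNzRingType) (N : nat) (q : nat -> A).

(** The monomial [y^be] records how the degree [n] is distributed over the
    factors. *)
Lemma coef_ps_vars n (be : 'X_{1..N}) : mdeg be = n ->
  ((\big[@ps_mul {mpoly A[N]}/@ps_one {mpoly A[N]}]_(j < N)
      (fun b => (q b)%:MP * 'X_j ^+ b)) n)@_be = \prod_(j < N) q (be j).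
Proof.
move=> bn; rewrite (big_ps_trunc _ _ _ (leqnn n)).
under eq_bigr => j _ do rewrite /trunc_ps poly_def.
rewrite bigA_distr_bigA /= coef_sum raddf_sum /=.
have bj j : (be j < n.+1)%N by rewrite ltnS -bn mdegE (bigD1 j) //= leq_addr.
pose f0 : {ffun 'I_N -> 'I_n.+1} := [ffun j => Ordinal (bj j)].
have termE (f : {ffun 'I_N -> 'I_n.+1}) :
    \prod_i (((q (f i))%:MP * 'X_i ^+ f i) *: 'X^(f i)) =
    ((\prod_i q (f i))%:MP * 'X_[[multinom nat_of_ord (f i) | i < N]])
      *: 'X^(\sum_i f i) :> {poly {mpoly A[N]}}.
  rewrite scaler_prod prodrXr big_split -rmorph_prod mpolyXE_id /=.
  by congr (_ * _ *: _); apply: eq_bigr => i _; rewrite mnmE.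
have cE (f : {ffun 'I_N -> 'I_n.+1}) :
    ((\prod_i (((q (f i))%:MP * 'X_i ^+ f i) *: 'X^(f i)) : {poly {mpoly A[N]}})`_n)@_be
    = (f == f0)%:R * \prod_j q (be j).
  rewrite termE coefZ coefXn; have [->|ff0] := eqVneq f f0.
    have -> : (\sum_i f0 i = n)%N.
      by rewrite -[RHS]bn mdegE; apply: eq_bigr => i _; rewrite ffunE.
    rewrite eqxx mulr1 mul1r mcoeffCM mcoeffX.
    have -> : [multinom nat_of_ord (f0 i) | i < N] = be by apply/mnmP => i; rewrite mnmE ffunE.
    by rewrite eqxx mulr1; apply: eq_bigr => i _; rewrite ffunE.
  rewrite mul0r mulr_natr mcoeffMn mcoeffCM mcoeffX.
  case: eqP => [fE|_]; last by rewrite mulr0 mul0rn.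
  by case/eqP: ff0; apply/ffunP => i; apply/val_inj; rewrite ffunE /= -fE mnmE.
rewrite (bigD1 f0) //= cE eqxx mul1r [X in _ + X]big1 ?addr0 // => f ff0.
by rewrite cE (negPf ff0) mul0r.
Qed.

End ProductCoefficient.

(** The Cauchy kernel: the product of the [q_(be j) (x)] is the coefficient of
    [y^be] in the function [q_n] of the variables [x_i y_j], and the power sums
    of these variables factor. *)
Lemma qfam_cauchy (k : fieldType) (A : comNzRingType) (c : {rmorphism k -> A}) (I : finType)
    (x : I -> A) N (be : 'X_{1..N}) n :
  (forall n, n.+1%:R != 0 :> k) -> mdeg be = n ->
  \prod_(j < N) qfam setT x (be j) =
  \sum_(mu : npartition n | is_OP mu)
    c ((zmu (parts mu))%:R^-1) * \prod_(r <- parts mu) ((\sum_i x i ^+ r) *+ 2)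
      * c ((ppoly k N (parts mu))@_be).
Proof.
move=> k0 bn; rewrite -(coef_ps_vars _ bn).
pose z (ij : 'I_N * I) : {mpoly A[N]} := (x ij.2)%:MP * 'X_(ij.1).
have -> : \big[@ps_mul {mpoly A[N]}/@ps_one {mpoly A[N]}]_(j < N)
   (fun b => (qfam setT x b)%:MP * 'X_j ^+ b) = qfam setT z.
  rewrite (qfamT z) -(pair_bigA _ (fun j i => qser (z (j, i)))) /=.
  apply: eq_bigr => j _; apply/funext=> b.
  by rewrite rmorph_qfam -qfam_scale qfamT.
rewrite (qfam_power_sums (@mpolyC N A \o c : {rmorphism k -> {mpoly A[N]}})) //.
rewrite raddf_sum /=; apply: eq_bigr => mu _.
rewrite mcoeffCM -mulrA; congr (_ * _).
have -> : \prod_(r <- parts mu) ((\sum_(i in setT) z i ^+ r) *+ 2) =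
    (\prod_(r <- parts mu) ((\sum_i x i ^+ r) *+ 2))%:MP * ppoly A N (parts mu).
  rewrite rmorph_prod -big_split; apply: eq_bigr => r _ /=.
  have -> : \sum_(i in setT) z i ^+ r = \sum_i z i ^+ r by apply: eq_bigl => i; rewrite inE.
  rewrite -(pair_bigA _ (fun j i => z (j, i) ^+ r)) /=.
  rewrite rmorphMn /= mulrnAl rmorph_sum mulr_sumr; congr (_ *+ _).
  apply: eq_bigr => j _; rewrite mulr_suml; apply: eq_bigr => i _.
  by rewrite /z exprMn rmorphXn.
by rewrite mcoeffCM -(map_ppoly c) mcoeff_map_mpoly.
Qed.

(** * Recognizing Schur Q-functions from a character table *)

Section StrictPartitions.
Variable n : nat.
Implicit Type la : SP n.

Lemma SP_partition la : is_partition n (SP_parts la).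
Proof. exact: parts_partition. Qed.

Lemma SP_pos la : all (leq 1) (SP_parts la).
Proof. by case/and3P: (SP_partition la). Qed.

Lemma SP_sumn la : sumn (SP_parts la) = n.
Proof. by case/and3P: (SP_partition la) => _ _ /eqP. Qed.

Lemma SP_sorted la : sorted gtn (SP_parts la).
Proof.
have /and3P[h _ _] := SP_partition la; have := valP la; rewrite -/(SP_parts la).
rewrite gtn_sorted_uniq_geq => -> //.
Qed.

Lemma SP_size la : (size (SP_parts la) <= n)%N.
Proof.
rewrite -{2}(SP_sumn la); elim: (SP_parts la) (SP_pos la) => //= x s IH /andP[x0 /IH h].
by rewrite -add1n leq_add.
Qed.

Lemma part_mnm_SP_inj : injective (fun la : SP n => part_mnm n (SP_parts la)).
Proof.
move=> la ka /mnmP eq; apply/val_inj/parts_inj; rewrite -![parts _]/(SP_parts _).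
have nth_eq i : nth 0%N (SP_parts la) i = nth 0%N (SP_parts ka) i.
  have [i_n|n_i] := ltnP i n; first by have := eq (Ordinal i_n); rewrite !mnmE.
  by rewrite !nth_default // (leq_trans (SP_size _)).
have le (l1 l2 : SP n) : (forall i, nth 0%N (SP_parts l1) i = nth 0%N (SP_parts l2) i) ->
    (size (SP_parts l1) <= size (SP_parts l2))%N.
  move=> h; rewrite leqNgt; apply/negP => lt.
  have := allP (SP_pos l1) _ (mem_nth 0%N lt); rewrite h nth_default //.
apply: (@eq_from_nth _ 0%N) => // ; apply/eqP; rewrite eqn_leq !le //.
Qed.

End StrictPartitions.

Lemma qprod_part_mnm (A : comNzRingType) (I : finType) (S : {set I}) (y : I -> A) N be :
  (size be <= N)%N -> qprod S y be = \prod_(j < N) qfam S y (part_mnm N be j).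
Proof.
move=> sN; rewrite /qprod (big_nth 0%N) big_mkord.
rewrite (big_ord_widen N (fun i => qfam S y (nth 0%N be i))) // big_mkcond /=.
apply: eq_bigr => i _; rewrite mnmE; case: ltnP => // h.
by rewrite nth_default // qfam0.
Qed.

Section QDiagonal.
Variables (k : fieldType) (n : nat).
Hypothesis k_char0 : forall n, n.+1%:R != 0 :> k.
Implicit Types la nu ka : SP n.
Local Notation Q la := (Qpoly k n (@SP_parts n la)).
Local Notation top la := (part_mnm n (@SP_parts n la)).

Let two_neq0 : (2 : k) != 0 := k_char0 1.

Lemma topQ la : top_coef (Q la) (top la) (2 ^+ size (SP_parts la)).
Proof. by apply: top_coef_Qpoly => //; [exact: SP_sorted|exact: SP_pos|exact: SP_size]. Qed.

(** The leading monomials are distinct, and their coefficients are powers of [2]. *)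
Lemma Q_free (c : SP n -> k) : \sum_(la : SP n) c la *: Q la = 0 -> forall la, c la = 0.
Proof.
move=> c0; suff h : [forall la, c la == 0] by move=> la; apply/eqP; move/forallP: h.
apply: contraT; rewrite negb_forall => /existsP[l0 cl0].
case: (@arg_maxP _ _ _ l0 (fun la => c la != 0) (fun la => top la) cl0) => l cl lmax.
have := congr1 (mcoeff (top l)) c0; rewrite mcoeff0 raddf_sum /= (bigD1 l) //= mcoeffZ.
have [_ ->] := topQ l; rewrite big1 => [|la lal].
  by move/eqP; rewrite addr0 mulf_eq0 (negPf cl) expf_eq0 (negPf two_neq0) andbF.
rewrite mcoeffZ; have [->|cla] := eqVneq (c la) 0; first by rewrite mul0r.
rewrite mcoeff_gt_mlead ?mulr0 //; have [h _] := topQ la; apply: le_lt_trans h _.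
by rewrite lt_neqAle (inj_eq (@part_mnm_SP_inj n)) lal; exact: lmax.
Qed.

(** The combination of coefficients that corresponds to the expansion of [Q_la]
    in products of the [q_r]: by the Cauchy kernel, products of the [q_r] are
    coefficients of monomials. *)
Definition qdual (la : SP n) (f : {mpoly k[n]}) : k :=
  \sum_(ca <- qexp (SP_parts la)) ca.1%:~R * f@_(part_mnm n ca.2).

Lemma qdual_linear la (c : SP n -> k) (f : SP n -> {mpoly k[n]}) :
  qdual la (\sum_nu c nu *: f nu) = \sum_nu c nu * qdual la (f nu).
Proof.
rewrite /qdual; under [RHS]eq_bigr => nu _ do rewrite mulr_sumr.
rewrite [RHS]exchange_big /=; apply: eq_bigr => ca _.
rewrite raddf_sum mulr_sumr; apply: eq_bigr => nu _ /=.
by rewrite mcoeffZ mulrCA.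
Qed.

(** The functional [qdual la] only sees monomials that are at least [la], by
    [qexp_head]. *)
Lemma qdual_gt la nu : (top nu < top la)%O -> qdual la (Q nu) = 0.
Proof.
move=> lt; have [h _] := topQ nu; rewrite /qdual.
have [t tE tP] := qexp_head (SP_parts la); rewrite big_seq_cond big1 // => ca; rewrite andbT.
move=> caq; rewrite mcoeff_gt_mlead ?mulr0 //; apply: le_lt_trans h _.
have [sz sm] := qexp_size caq; move: caq; rewrite tE inE => /predU1P[->//|/tP tc].
by apply: lt_trans lt _; apply: part_mnm_lt => //; exact: SP_size.
Qed.

Lemma qdual_diag la : qdual la (Q la) = 2 ^+ size (SP_parts la).
Proof.
have [h1 h2] := topQ la; rewrite /qdual.
have [t tE tP] := qexp_head (SP_parts la); rewrite tE big_cons mul1r h2.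
rewrite big_seq_cond big1 ?addr0 // => ca; rewrite andbT => tc.
rewrite mcoeff_gt_mlead ?mulr0 //; apply: le_lt_trans h1 _.
have [|sz sm] := @qexp_size (SP_parts la) ca; first by rewrite tE inE tc orbT.
by apply: part_mnm_lt; rewrite ?SP_size //; exact: tP.
Qed.

Variables (zeta : SP n -> npartition n -> k) (e : SP n -> k).
Variable aw : forall m, SP n -> {mpoly k[m]}.
Hypothesis aw_psum : forall m (mu : npartition n), is_OP mu ->
  \prod_(r <- parts mu) ((\sum_(i < m) 'X_i ^+ r) *+ 2) = \sum_la zeta la mu *: aw m la.
Hypothesis zeta_Q : forall la,
  \sum_(mu : npartition n | is_OP mu)
    ((zmu (parts mu))%:R^-1 * zeta la mu) *: ppoly k n (parts mu) = e la *: Q la.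

Lemma psum2E m mu : \prod_(r <- mu) ((\sum_(i < m) 'X_i ^+ r) *+ 2) = 2 ^+ size mu *: ppoly k m mu.
Proof.
elim: mu => [|r mu IH]; first by rewrite /ppoly !big_nil expr0 scale1r.
by rewrite /ppoly !big_cons IH -/(ppoly k m mu) mulrnAl -mulr_natl exprS -!mul_mpolyC rmorphM rmorph_nat; ring.
Qed.

(** The characters [zeta] provide an expansion of the Cauchy kernel as the sum of
    the products [e la * aw la (x) * Q la (y)]; here the coefficient of a
    monomial in [y] is taken. *)
Lemma q_expand1 m (be : 'X_{1..n}) : mdeg be = n ->
  \prod_(j < n) qfam setT (fun i : 'I_m => 'X_i) (be j) =
  \sum_la (e la * (Q la)@_be) *: aw m la.
Proof.
move=> bn; rewrite (qfam_cauchy (@mpolyC m k) _ k_char0 bn).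
under eq_bigr => mu muP do rewrite aw_psum // mulr_sumr mulr_suml.
rewrite exchange_big /=; apply: eq_bigr => la _.
have -> : e la * (Q la)@_be = (e la *: Q la)@_be by rewrite mcoeffZ.
rewrite -zeta_Q raddf_sum scaler_suml; apply: eq_bigr => mu _ /=.
by rewrite mcoeffZ -!mul_mpolyC !rmorphM /=; ring.
Qed.

(** The same expansion, with the coefficient of a monomial taken on the other
    side: the kernel is symmetric in [x] and [y]. *)
Lemma q_expand2 (be : 'X_{1..n}) : mdeg be = n ->
  \prod_(j < n) qfam setT (fun i : 'I_n => 'X_i) (be j) =
  \sum_la (e la * (aw n la)@_be) *: Q la.
Proof.
move=> bn; rewrite (qfam_cauchy (@mpolyC n k) _ k_char0 bn).
rewrite (eq_bigr (fun mu : npartition n => \sum_la (zeta la mu * (aw n la)@_be) *: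
   ((zmu (parts mu))%:R^-1 *: ppoly k n (parts mu)))); last first.
  move=> mu muP; rewrite -scaler_suml.
  have -> : \sum_la zeta la mu * (aw n la)@_be = (\sum_la zeta la mu *: aw n la)@_be.
    by rewrite raddf_sum; apply: eq_bigr => la _; rewrite /= mcoeffZ.
  rewrite -aw_psum // psum2E /= mcoeffZ -!mul_mpolyC !rmorphM /=; ring.
rewrite exchange_big /=; apply: eq_bigr => la _.
rewrite mulrC -scalerA -zeta_Q scaler_sumr; apply: eq_bigr => mu _.
by rewrite !scalerA; congr (_ *: _); ring.
Qed.

Lemma Q_expand1 m la :
  Qpoly k m (SP_parts la) = \sum_nu (e nu * qdual la (Q nu)) *: aw m nu.
Proof.
rewrite {1}/Qpoly /qdual; under [RHS]eq_bigr => nu _ do rewrite mulr_sumr scaler_suml.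
rewrite [RHS]exchange_big /= big_seq_cond [RHS]big_seq_cond; apply: eq_bigr => ca.
rewrite andbT => /qexp_size[sz sm].
have szn : (size ca.2 <= n)%N by rewrite sz SP_size.
rewrite (qprod_part_mnm _ _ szn) q_expand1; last by rewrite mdeg_part_mnm // sm SP_sumn.
rewrite mulr_sumr; apply: eq_bigr => nu _.
by rewrite mulrCA -[RHS]scalerA scaler_int mulrzl.
Qed.

Lemma Q_expand2 la : Q la = \sum_nu (e nu * qdual la (aw n nu)) *: Q nu.
Proof.
rewrite {1}/Qpoly /qdual; under [RHS]eq_bigr => nu _ do rewrite mulr_sumr scaler_suml.
rewrite [RHS]exchange_big /= big_seq_cond [RHS]big_seq_cond; apply: eq_bigr => ca.
rewrite andbT => /qexp_size[sz sm].
have szn : (size ca.2 <= n)%N by rewrite sz SP_size.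
rewrite (qprod_part_mnm _ _ szn) q_expand2; last by rewrite mdeg_part_mnm // sm SP_sumn.
rewrite mulr_sumr; apply: eq_bigr => nu _.
by rewrite mulrCA -[RHS]scalerA scaler_int mulrzl.
Qed.

(** The functional [qdual la] turns the second expansion into an expansion of
    [Q la] in the linearly independent family of all the [Q nu]. *)
Lemma qdual_aw la nu : e nu * qdual la (aw n nu) = (nu == la)%:R.
Proof.
apply/eqP; rewrite -subr_eq0; apply/eqP.
apply: (@Q_free (fun nu => e nu * qdual la (aw n nu) - (nu == la)%:R)).
under eq_bigr => ka _ do rewrite scalerBl.
rewrite sumrB -Q_expand2 (bigD1 la) //= eqxx scale1r big1 ?addr0 ?subrr //.
by move=> ka /negPf ->; rewrite scale0r.
Qed.

(** Apply [qdual ka] to the first expansion of [Q la] and use [qdual_aw]. *)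
Lemma qdual_sym la ka : qdual ka (Q la) = qdual la (Q ka).
Proof.
rewrite {1}Q_expand1 qdual_linear (bigD1 ka) //= mulrAC qdual_aw eqxx mul1r.
by rewrite big1 ?addr0 // => nu /negPf nuka; rewrite mulrAC qdual_aw nuka mul0r.
Qed.

(** The matrix [qdual la (Q ka)] is symmetric and triangular for the order of
    leading monomials, hence diagonal; its diagonal entries are the leading
    coefficients of the [Q la]. *)
Lemma Q_aw m la : Qpoly k m (SP_parts la) = (2 ^+ size (SP_parts la) * e la) *: aw m la.
Proof.
rewrite Q_expand1 (bigD1 la) //= qdual_diag mulrC big1 ?addr0 // => nu nula.
have : top nu != top la by rewrite (inj_eq (@part_mnm_SP_inj n)).
by rewrite neq_lt => /orP[lt|lt]; [|rewrite qdual_sym]; rewrite qdual_gt // mulr0 scale0r.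
Qed.

End QDiagonal.

(** * Supermodules and parity *)

Section ColumnOperators.
Variable k : fieldType.

Definition colmx m n (f : 'cV[k]_n -> 'cV[k]_m) : 'M[k]_(m, n) :=
  \matrix_(i, j) f (delta_mx j 0) i 0.

Lemma colmxE m n (f : {linear 'cV[k]_n -> 'cV[k]_m}) u : colmx f *m u = f u.
Proof.
rewrite [in RHS](matrix_sum_delta u) linear_sum.
apply/matrixP=> i j; rewrite !mxE summxE; apply: eq_bigr => l _.
by rewrite linear_sum summxE big_ord1 linearZ !mxE ord1 mulrC.
Qed.

Lemma mulmx_colP m n (A B : 'M[k]_(m, n)) :
  (forall u : 'cV_n, A *m u = B *m u) -> A = B.
Proof.
move=> AB; apply/matrixP=> i j; have := AB (delta_mx j 0).
by rewrite -!colE => /colP/(_ i); rewrite !mxE.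
Qed.

Lemma bijective_inverse m d (f : 'M[k]_(m, d)) : bijective (fun u : 'cV[k]_d => f *m u) ->
  exists g : 'M[k]_(d, m), g *m f = 1%:M /\ f *m g = 1%:M.
Proof.
case=> g gK Kg; have fg u : f *m g u = u := Kg u.
have g_lin : linear g.
  by move=> a u w; apply: (can_inj gK); rewrite fg mulmxDr -scalemxAr !fg.
pose g' : {linear 'cV[k]_m -> 'cV[k]_d} := HB.pack g (GRing.isLinear.Build k _ _ _ g g_lin).
have GE u : colmx g' *m u = g u by rewrite colmxE.
by exists (colmx g'); split; apply: mulmx_colP => u; rewrite -mulmxA GE mul1mx.
Qed.

Lemma mem_lker_mx m n (A : 'M[k]_(m, n)) (u : 'cV_n) :
  (u \in lker (linfun (mulmx A : 'cV_n -> 'cV_m))) = (A *m u == 0).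
Proof. by rewrite memv_ker lfunE. Qed.

Definition parity_part d (P : 'M[k]_d) (b : bool) : {vspace 'cV[k]_d} :=
  lker (linfun (mulmx (P - ((-1) ^+ b)%:M) : 'cV_d -> 'cV_d)).

Lemma mem_parity_part d (P : 'M[k]_d) b (u : 'cV[k]_d) :
  (u \in parity_part P b) = (P *m u == (-1) ^+ b *: u).
Proof. by rewrite mem_lker_mx mulmxBl mul_scalar_mx subr_eq0. Qed.

Lemma parity_split d (P : 'M[k]_d) (u : 'cV[k]_d) : (2 : k) != 0 -> P *m P = 1%:M ->
  let u0 := 2^-1 *: (u + P *m u) in let u1 := 2^-1 *: (u - P *m u) in
  [/\ u = u0 + u1, P *m u0 = u0 & P *m u1 = - u1].
Proof.
move=> two PP /=; split.
- by rewrite -scalerDr addrACA subrr addr0 -mulr2n -scaler_nat scalerA mulVf ?scale1r.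
- by rewrite -scalemxAr mulmxDr mulmxA PP mul1mx addrC.
- by rewrite -scalemxAr mulmxBr mulmxA PP mul1mx -scalerN opprB.
Qed.

End ColumnOperators.

Section SuperModules.
Variables (n : nat) (k : fieldType) (v : k).
Hypothesis two_neq0 : (2 : k) != 0.
Local Notation H := (hecke_clifford n v).
Local Notation module := (supermodule n v).

(** Since [2] is invertible, a grading is the same as an involution. This turns
    statements on graded submodules into matrix identities. *)
Lemma sm_parity (M : module) : exists P : 'M[k]_(smdim M),
  P *m P = 1%:M /\ forall b u, (u \in smpart M b) = (P *m u == (-1) ^+ b *: u).
Proof.
pose V0 := smpart M false; pose V1 := smpart M true.
have d01 : (V0 :&: V1)%VS = 0%VS := directv_addP (smpart_direct M).
have d10 : (V1 :&: V0)%VS = 0%VS by rewrite capvC.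
pose f := daddv_pi V0 V1 - daddv_pi V1 V0.
pose P := colmx f; have PE u : P *m u = daddv_pi V0 V1 u - daddv_pi V1 V0 u.
  by rewrite /P colmxE /f /= add_lfunE opp_lfunE.
have ad u : daddv_pi V0 V1 u + daddv_pi V1 V0 u = u.
  by apply: daddv_pi_add => //; rewrite smpart_full memvf.
have P0 u : u \in V0 -> P *m u = u.
  move=> u0; rewrite PE; have := ad u; rewrite (daddv_pi_id d01 u0).
  by rewrite -[RHS]addr0 => /addrI ->; rewrite subr0.
have P1 u : u \in V1 -> P *m u = - u.
  move=> u1; rewrite PE; have := ad u; rewrite (daddv_pi_id d10 u1).
  by rewrite -[RHS]add0r => /addIr ->; rewrite sub0r.
have PP : P *m P = 1%:M.
  apply: mulmx_colP => u; rewrite mul1mx -mulmxA [P *m u]PE mulmxBr.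
  by rewrite P0 ?memv_pi // P1 ?memv_pi // opprK ad.
exists P; split=> // b u; apply/idP/eqP => [ub|Pu].
  by case: b ub => [/P1 ->|/P0 ->]; rewrite ?scaleN1r ?scale1r.
have half (w : 'cV[k]_(smdim M)) : w + w = 0 -> w = 0.
  by move/eqP; rewrite -mulr2n -scaler_nat scaler_eq0 (negPf two_neq0) => /eqP.
move: Pu; rewrite PE -{3}(ad u); case: b => /=.
  rewrite scaleN1r opprD => /addIr aN.
  have /half a0 : daddv_pi V0 V1 u + daddv_pi V0 V1 u = 0 by rewrite {1}aN addNr.
  by rewrite -(ad u) a0 add0r memv_pi.
rewrite scale1r => /addrI bN.
have /half b0 : daddv_pi V1 V0 u + daddv_pi V1 V0 u = 0 by rewrite -{1}bN addNr.
by rewrite -(ad u) b0 addr0 memv_pi.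
Qed.

Definition parity_mx (M : module) : 'M[k]_(smdim M) := projT1 (cid (sm_parity M)).
Local Notation P M := (parity_mx M).

Lemma parity_mxK M : P M *m P M = 1%:M.
Proof. by case: (projT2 (cid (sm_parity M))). Qed.

Lemma mem_smpart (M : module) b u : (u \in smpart M b) = (P M *m u == (-1) ^+ b *: u).
Proof. by case: (projT2 (cid (sm_parity M))). Qed.

Lemma parity_mxC (M : module) b x : hc_homog b x ->
  P M *m smact M x = (-1) ^+ b *: (smact M x *m P M).
Proof.
move=> xb; apply: mulmx_colP => u.
have [uE u0 u1] := parity_split u two_neq0 (parity_mxK M).
set w0 := _ *: _ in uE u0; set w1 := _ *: (_ - _) in uE u1.
have part (b' : bool) (w : 'cV_(smdim M)) : P M *m w = (-1) ^+ b' *: w ->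
    P M *m smact M x *m w = ((-1) ^+ b *: (smact M x *m P M)) *m w.
  move=> /eqP; rewrite -mem_smpart => wb'.
  have := smpart_act xb wb'; rewrite mem_smpart => /eqP; rewrite mulmxA => ->.
  move: wb'; rewrite mem_smpart => /eqP wb'.
  by rewrite -scalemxAl -mulmxA wb' -scalemxAr scalerA signr_addb.
rewrite uE !mulmxDr (part false) ?u0 ?scale1r //.
by rewrite (part true) // u1 scaleN1r.
Qed.

(** Odd elements anticommute with the parity involution. *)
Lemma char_odd (M : module) x : hc_homog true x -> smchar M x = 0.
Proof.
move=> xb; have h : smchar M x = - smchar M x.
  rewrite {1}/smchar -[smact M x]mul1mx -(parity_mxK M) -mulmxA (parity_mxC M xb).
  rewrite -scalemxAr mxtraceZ expr1 mulN1r; congr (- _).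
  by rewrite mxtrace_mulC -mulmxA parity_mxK mulmx1.
apply/eqP; move/eqP: h; rewrite -subr_eq0 opprK -mulr2n -mulr_natl.
by rewrite mulf_eq0 (negPf two_neq0).
Qed.

Section Build.
Variables (d : nat) (A : {linear H -> 'M[k]_d}) (Q : 'M[k]_d).
Hypotheses (A_mul : monoid_morphism A) (QK : Q *m Q = 1%:M).
Hypothesis QA : forall b x, hc_homog b x -> Q *m A x = (-1) ^+ b *: (A x *m Q).

Fact build_direct : directv (parity_part Q false + parity_part Q true).
Proof.
apply/directv_addP/eqP; rewrite -subv0; apply/subvP => u.
rewrite memv_cap !mem_parity_part scale1r scaleN1r memv0 => /andP[/eqP-> ].
by rewrite -subr_eq0 opprK -mulr2n -scaler_nat scaler_eq0 (negPf two_neq0).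
Qed.

Fact build_full : (parity_part Q false + parity_part Q true)%VS = fullv.
Proof.
apply/eqP; rewrite eqEsubv subvf; apply/subvP => u _.
have [uE u0 u1] := parity_split u two_neq0 QK.
rewrite uE; apply: memv_add; rewrite mem_parity_part ?u0 ?u1.
  by rewrite scale1r.
by rewrite scaleN1r.
Qed.

Fact build_act b b' (x : H) (u : 'cV[k]_d) :
  hc_homog b x -> u \in parity_part Q b' -> A x *m u \in parity_part Q (b (+) b').
Proof.
rewrite !mem_parity_part => xb /eqP ub; rewrite mulmxA (QA xb) -scalemxAl -mulmxA ub.
by rewrite -scalemxAr scalerA signr_addb.
Qed.

Definition build_sm : module :=
  Supermodule A_mul build_direct build_full build_act.

End Build.

Section Corner.
Variables (M : module) (e : nat) (i : 'M[k]_(smdim M, e)) (p : 'M[k]_(e, smdim M)).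
Hypotheses (pi1 : p *m i = 1%:M) (ipP : (i *m p) *m P M = P M *m (i *m p)).
Hypothesis act_ip : forall x y,
  (p *m smact M x *m i) *m (p *m smact M y *m i) = p *m smact M (x * y) *m i.

(** The module carried by a subquotient of [M], cut out by the idempotent
    [i *m p] with [p *m i = 1]. *)
Definition corner_act (x : H) : 'M[k]_e := p *m smact M x *m i.

Fact corner_linear : linear corner_act.
Proof.
move=> a x y; rewrite /corner_act linearP mulmxDr mulmxDl.
by rewrite -scalemxAr -scalemxAl.
Qed.

HB.instance Definition _ := GRing.isLinear.Build k H 'M[k]_e *:%R corner_act corner_linear.

Fact corner_monoid : monoid_morphism corner_act.
Proof.
split; last by move=> x y; rewrite /corner_act -act_ip.
by rewrite /corner_act (smact_mul M).1 mulmx1 pi1.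
Qed.

Fact corner_parityK : (p *m P M *m i) *m (p *m P M *m i) = 1%:M.
Proof.
rewrite -!mulmxA (mulmxA i p) (mulmxA (i *m p)) ipP -!mulmxA pi1 mulmx1.
by rewrite (mulmxA (P M)) parity_mxK mul1mx.
Qed.

Fact corner_parityC b x : hc_homog b x ->
  (p *m P M *m i) *m corner_act x = (-1) ^+ b *: (corner_act x *m (p *m P M *m i)).
Proof.
move=> xb; rewrite /corner_act.
have -> : (p *m P M *m i) *m (p *m smact M x *m i) = p *m (P M *m smact M x) *m i.
  rewrite -!mulmxA (mulmxA i p) (mulmxA (P M)) -ipP !mulmxA pi1 mul1mx.
  by rewrite -!mulmxA.
have -> : (p *m smact M x *m i) *m (p *m P M *m i) = p *m (smact M x *m P M) *m i.
  by rewrite -!mulmxA (mulmxA i p) (mulmxA (i *m p)) ipP -!mulmxA pi1 mulmx1.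
by rewrite (parity_mxC M xb) -scalemxAr -scalemxAl.
Qed.

Definition corner_sm : module := build_sm corner_monoid corner_parityK corner_parityC.

Lemma char_corner x : smchar corner_sm x = \tr (smact M x *m (i *m p)).
Proof. by rewrite /smchar /= /corner_act -mulmxA mxtrace_mulC mulmxA. Qed.

End Corner.

End SuperModules.

(** * Decomposition of characters *)

Section CharacterDecomposition.
Variables (n : nat) (k : fieldType) (v : k).
Hypothesis two_neq0 : (2 : k) != 0.
Local Notation H := (hecke_clifford n v).
Local Notation module := (supermodule n v).
Local Notation P M := (parity_mx two_neq0 M).

Lemma smactM (M : module) x y : smact M (x * y) = smact M x *m smact M y.
Proof. exact: (smact_mul M).2. Qed.

Lemma graded_of_parity (M : module) (W : {vspace 'cV[k]_(smdim M)}) :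
  (forall (x : H) u, u \in W -> smact M x *m u \in W) ->
  (forall u, u \in W -> P M *m u \in W) -> graded_submodule W.
Proof.
move=> Wact WP; split=> //; apply/eqP; rewrite eqEsubv subv_add !capvSl !andbT.
apply/subvP => u uW; have [uE u0 u1] := parity_split u two_neq0 (parity_mxK two_neq0 M).
rewrite uE; apply: memv_add; rewrite memv_cap (mem_smpart two_neq0) ?u0 ?u1.
  by rewrite scale1r eqxx andbT memvZ // memvD // WP.
by rewrite scaleN1r eqxx andbT memvZ // memvB // WP.
Qed.

Lemma parity_of_graded (M : module) (W : {vspace 'cV[k]_(smdim M)}) u :
  graded_submodule W -> u \in W -> P M *m u \in W.
Proof.
case=> _ WE; rewrite {1}WE => /memv_addP[u0 /[!memv_cap]/andP[u0W u0P]].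
case=> u1 /[!memv_cap]/andP[u1W u1P] ->; rewrite mulmxDr memvD //.
  by move: u0P; rewrite (mem_smpart two_neq0) => /eqP->; rewrite memvZ.
by move: u1P; rewrite (mem_smpart two_neq0) => /eqP->; rewrite memvZ.
Qed.

(** An isomorphism need not be homogeneous, but it intertwines the even elements;
    odd elements have trace zero on both sides. *)
Lemma sm_iso_char (M N : module) b x : sm_iso M N -> hc_homog b x ->
  smchar M x = smchar N x.
Proof.
case=> f0 [f1 [[_ h0] [_ h1] /bijective_inverse[g [gf fg]]]] xb.
case: b xb => xb; first by rewrite !(char_odd two_neq0).
have fA : (f0 + f1) *m smact M x = smact N x *m (f0 + f1).
  by rewrite mulmxDl (h0 _ _ xb) (h1 _ _ xb) andbF !scale1r mulmxDr.
by rewrite /smchar -[smact M x]mul1mx -gf -mulmxA fA mxtrace_mulC -mulmxA fg mulmx1.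
Qed.

(** Average a projection onto [W] with its conjugate by the parity. *)
Lemma stable_idempotent (M : module) (W : {vspace 'cV[k]_(smdim M)}) : graded_submodule W ->
  exists p : 'M[k]_(smdim M), [/\ forall u, p *m u \in W, forall u, u \in W -> p *m u = u
    & p *m P M = P M *m p].
Proof.
move=> gW; pose q := colmx (projv W).
have qE u : q *m u = projv W u by rewrite /q colmxE.
pose p := 2^-1 *: (q + P M *m q *m P M).
have PK := parity_mxK two_neq0 M.
exists p; split=> [u|u uW|].
- rewrite -scalemxAl memvZ // mulmxDl memvD // ?qE ?memv_proj // -mulmxA -mulmxA qE.
  by apply: parity_of_graded; rewrite ?memv_proj.
- rewrite -scalemxAl mulmxDl qE projv_id // -mulmxA -mulmxA qE projv_id; last first.
    exact: parity_of_graded.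
  by rewrite mulmxA PK mul1mx -mulr2n -scaler_nat scalerA mulVf ?scale1r.
rewrite -scalemxAl -scalemxAr mulmxDl mulmxDr !mulmxA PK mul1mx.
by rewrite -!mulmxA PK mulmx1 addrC.
Qed.

Lemma idempotent_factor d e (C : 'M[k]_(d, e)) (R : 'M[k]_(e, d)) :
  row_full C -> row_free R -> (C *m R) *m (C *m R) = C *m R -> R *m C = 1%:M.
Proof.
move=> /row_fullP[c cE] /row_freeP[r rE] pp.
have := congr1 (fun A => c *m A *m r) pp.
by rewrite /= !mulmxA cE !mul1mx -!mulmxA rE mulmx1.
Qed.

Lemma idempotent_rank d (p : 'M[k]_d) : p *m p = p -> p != 1%:M -> (\rank p < d)%N.
Proof.
move=> pp p1; rewrite ltn_neqAle rank_leq_row andbT; apply: contra p1 => rp.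
have pu : p \in unitmx by rewrite -row_free_unit.
by rewrite -[p]mul1mx -(mulVmx pu) -mulmxA pp eqxx.
Qed.

Lemma corner_factor (M : module) e (C : 'M[k]_(smdim M, e)) (R : 'M[k]_(e, smdim M)) :
  R *m C = 1%:M -> (C *m R) *m P M = P M *m (C *m R) ->
  (forall x y, (C *m R) *m smact M x *m (C *m R) *m smact M y *m (C *m R) =
     (C *m R) *m smact M (x * y) *m (C *m R)) ->
  exists N : module, smdim N = e /\ forall x, smchar N x = \tr (smact M x *m (C *m R)).
Proof.
move=> RC pP pA; have pC : C *m R *m C = C by rewrite -mulmxA RC mulmx1.
have Rp : R *m (C *m R) = R by rewrite mulmxA RC mul1mx.
have act_ip x y : (R *m smact M x *m C) *m (R *m smact M y *m C) = R *m smact M (x * y) *m C.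
  have := congr1 (fun A => R *m A *m C) (pA x y).
  by rewrite /= -!mulmxA RC !mulmx1 !(mulmxA R C) RC !mul1mx.
exists (corner_sm RC pP act_ip); split=> // x; exact: char_corner.
Qed.

Lemma corner_exists (M : module) (p : 'M[k]_(smdim M)) :
  p *m p = p -> p *m P M = P M *m p ->
  (forall x y, p *m smact M x *m p *m smact M y *m p = p *m smact M (x * y) *m p) ->
  exists N : module, smdim N = \rank p /\ forall x, smchar N x = \tr (smact M x *m p).
Proof.
move=> pp pP pA; have := @corner_factor M _ (col_base p) (row_base p).
rewrite mulmx_base; apply=> //.
by apply: idempotent_factor; rewrite ?col_base_full ?row_base_free ?mulmx_base.
Qed.

(** Induction on the dimension. A proper graded submodule has an even projection
    [p] onto it, and the corners of [p] and [1 - p] carry the submodule and the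
    quotient, whose characters add up. *)
Lemma char_decomposition (I : finType) (U : I -> module) : all_irreducibles U ->
  forall M : module, exists m : I -> nat, forall b x, hc_homog b x ->
    smchar M x = \sum_i (m i)%:R * smchar (U i) x.
Proof.
case=> _ _ Uall M; have [d] := ubnP (smdim M); elim: d M => // d IH M; rewrite ltnS => Md.
have [d0|d0] := posnP (smdim M).
  exists (fun=> 0%N) => b x _; rewrite big1 => [|i _]; last by rewrite mul0r.
  by rewrite /smchar /mxtrace big1 // => i; have := ltn_ord i; rewrite {2}d0.
have [irr|nirr] := pselect (sm_irreducible M).
  have [i0 iso] := Uall M irr; exists (fun i => (i == i0 : nat)) => b x xb.
  rewrite (sm_iso_char iso xb) (bigD1 i0) //= eqxx mul1r big1 ?addr0 // => i /negPf->.
  by rewrite mul0r.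
have [W gW [W0 W1]] : exists2 W : {vspace 'cV[k]_(smdim M)}, graded_submodule W &
    W <> 0%VS /\ W <> fullv.
  apply: contrapT => h; apply: nirr; split=> // W gW; apply: contrapT => hW.
  by apply: h; exists W => //; split=> e; apply: hW; [left|right].
have [p [pW Wp pP]] := stable_idempotent gW.
have pp : p *m p = p by apply: mulmx_colP => u; rewrite -mulmxA Wp.
have pAp x : p *m smact M x *m p = smact M x *m p.
  by apply: mulmx_colP => u; rewrite -!mulmxA Wp //; case: gW => h _; exact: h.
pose q := 1%:M - p.
have qq : q *m q = q by rewrite mulmxBl mul1mx mulmxBr mulmx1 pp subrr subr0.
have qP : q *m P M = P M *m q by rewrite mulmxBl mulmxBr mul1mx mulmx1 pP.
have qAp x : q *m smact M x *m p = 0 by rewrite -mulmxA mulmxBl mul1mx mulmxA pAp subrr.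
have [x y|N1 [N1d N1c]] := corner_exists pp pP.
  by rewrite (pAp (x * y)) (pAp x) -!mulmxA (mulmxA p) pAp smactM mulmxA.
have [x y|N2 [N2d N2c]] := corner_exists qq qP.
  have qAq z : q *m smact M z *m q = q *m smact M z.
    transitivity (q *m smact M z *m (1%:M - p)) => //.
    by rewrite mulmxBr mulmx1 qAp subr0.
  by rewrite (qAq x) (qAq (x * y)) -(mulmxA q) -smactM qAq.
have p1 : p != 1%:M.
  apply/eqP => p1; apply: W1; apply/eqP; rewrite eqEsubv subvf; apply/subvP => u _.
  by rewrite -[u]mul1mx -p1 pW.
have q1 : q != 1%:M.
  apply/eqP => q1; apply: W0; apply/eqP; rewrite -subv0; apply/subvP => u uW.
  have p0 : p = 0 by rewrite -[p]opprK -[- p](addKr 1%:M) -/q q1 addNr oppr0.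
  by rewrite -(Wp _ uW) p0 mul0mx mem0v.
have [m1 m1P] : exists m : I -> nat, forall b x, hc_homog b x ->
    smchar N1 x = \sum_i (m i)%:R * smchar (U i) x.
  by apply: IH; rewrite N1d (leq_trans (idempotent_rank pp p1)).
have [m2 m2P] : exists m : I -> nat, forall b x, hc_homog b x ->
    smchar N2 x = \sum_i (m i)%:R * smchar (U i) x.
  by apply: IH; rewrite N2d (leq_trans (idempotent_rank qq q1)).
exists (fun i => m1 i + m2 i)%N => b x xb.
under eq_bigr => i _ do rewrite natrD mulrDl.
rewrite big_split /= -(m1P _ _ xb) -(m2P _ _ xb) N1c N2c -mxtraceD -mulmxDr.
by rewrite addrC subrK mulmx1.
Qed.

(** Kernel and image of [f] are graded submodules. When [f] anticommutes with the
    parity, the odd isomorphism is [f] composed with the parity, which produces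
    the sign rule. *)
Lemma schur_iso (M N : module) (f : 'M[k]_(smdim N, smdim M)) (s : bool) :
  sm_irreducible M -> sm_irreducible N ->
  (forall x, f *m smact M x = smact N x *m f) ->
  f *m P M = (-1) ^+ s *: (P N *m f) -> f != 0 ->
  sm_iso M N /\ bijective (fun u : 'cV[k]_(smdim M) => f *m u).
Proof.
move=> [_ irrM] [_ irrN] fA fP f0.
pose L := linfun (mulmx f : 'cV[k]_(smdim M) -> 'cV[k]_(smdim N)).
have LE u : L u = f *m u by rewrite lfunE.
have PNf : P N *m f = (-1) ^+ s *: (f *m P M).
  by rewrite fP scalerA -signr_addb addbb scale1r.
have gker : graded_submodule (lker L).
  apply: graded_of_parity => [x u|u]; rewrite !mem_lker_mx => /eqP fu.
    by rewrite mulmxA fA -mulmxA fu mulmx0.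
  by rewrite mulmxA fP -scalemxAl -mulmxA fu mulmx0 scaler0.
have gimg : graded_submodule (limg L).
  apply: graded_of_parity => [x u|u] /memv_imgP[w _ ->]; rewrite LE mulmxA.
    by rewrite -fA -mulmxA -LE memv_img ?memvf.
  by rewrite PNf -scalemxAl -mulmxA -LE memvZ // memv_img ?memvf.
have [ker0|kerT] := irrM _ gker; last first.
  case/eqP: f0; apply: mulmx_colP => u; rewrite mul0mx; apply/eqP.
  by rewrite -mem_lker_mx -/L kerT memvf.
have [img0|imgT] := irrN _ gimg.
  case/eqP: f0; apply: mulmx_colP => u; rewrite mul0mx; apply/eqP.
  by rewrite -memv0 -img0 -LE memv_img ?memvf.
have bij : bijective (fun u : 'cV[k]_(smdim M) => f *m u).
  exists (L^-1)%VF => u; first by rewrite -LE lker0_lfunK // ker0.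
  by rewrite -LE limg_lfunVK // imgT memvf.
split=> //; case: s fP PNf => [|] fP PNf; last first.
  exists f, 0; split; last by rewrite addr0.
  - split=> [b u|b x _]; last by rewrite fA scale1r.
    rewrite !(mem_smpart two_neq0) => /eqP Pu.
    by rewrite mulmxA PNf scale1r -mulmxA Pu -scalemxAr.
  - by split=> [b u _|b x _]; rewrite ?mul0mx ?mulmx0 ?scaler0 ?mem0v.
exists 0, (f *m P M); split; last first.
- rewrite add0r; case: bij => g gK Kg.
  exists (fun u => P M *m g u) => u /=.
    by rewrite -mulmxA gK mulmxA parity_mxK mul1mx.
  by rewrite -mulmxA (mulmxA (P M)) parity_mxK mul1mx; exact: Kg.
- split=> [b u|b x xb].
    rewrite !(mem_smpart two_neq0) => /eqP Pu.
    rewrite -[f *m _ *m u]mulmxA Pu -!scalemxAr mulmxA PNf -scalemxAl -mulmxA Pu -scalemxAr.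
    by rewrite !scalerA -!signr_addb; case: b {Pu}.
  rewrite -(mulmxA f) (parity_mxC two_neq0 M xb) -scalemxAr (mulmxA f) fA -(mulmxA (smact N x)).
  by case: b {xb}.
by split=> [b u _|b x _]; rewrite ?mul0mx ?mulmx0 ?scaler0 ?mem0v.
Qed.

End CharacterDecomposition.

(** * Relations of the Hecke-Clifford algebra *)

Section HeckeRelations.
Variables (n : nat) (k : fieldType) (v : k).
Local Notation H := (hecke_clifford n v).
Implicit Types (x y : hc_term n k).

Local Notation cl := (@hc_class n k v).

Lemma hc_classD x y : cl (HAdd x y) = cl x + cl y.
Proof. by rewrite [RHS]/GRing.add /= hc_addqE. Qed.

Lemma hc_classM x y : cl (HMul x y) = cl x * cl y.
Proof. by rewrite [RHS]/GRing.mul /= hc_mulqE. Qed.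

Lemma hc_class1 : cl (HScal 1) = 1.
Proof. by []. Qed.

Lemma hc_classS a : cl (HScal a) = a *: (1 : H).
Proof.
rewrite -hc_class1 [RHS]/GRing.scale /= hc_scaleqE.
by apply/hc_classP; apply: hc_sym; exact: hc_mul1r.
Qed.

Lemma hc_class_ind (P : H -> Prop) :
  (forall a, P (a *: (1 : H))) -> (forall i, P (hcT i)) -> (forall j, P (hcc j)) ->
  (forall f g : H, P f -> P g -> P (f + g)) -> (forall f g : H, P f -> P g -> P (f * g)) ->
  forall f, P f.
Proof.
move=> Ps PT Pc PD PM; apply: hc_classW; elim=> [a|i|j|x Px y Py|x Px y Py].
- by rewrite hc_classS.
- exact: PT.
- exact: Pc.
- by rewrite hc_classD; exact: PD.
- by rewrite hc_classM; exact: PM.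
Qed.

Lemma hcT_quad i : (hcT i - v *: (1 : H)) * (hcT i + 1) = 0.
Proof.
have /hc_classP := hc_quad v i.
by rewrite hc_classM !hc_classD !hc_classS scaleNr scale1r scale0r.
Qed.

Lemma hcT_far (i j : 'I_n.-1) : (i.+1 < j)%N || (j.+1 < i)%N ->
  hcT i * hcT j = hcT j * hcT i :> H.
Proof. by move=> ij; have /hc_classP := hc_far v ij; rewrite !hc_classM. Qed.

Lemma hcT_braid (i j : 'I_n.-1) : j = i.+1 :> nat ->
  hcT i * hcT j * hcT i = hcT j * hcT i * hcT j :> H.
Proof. by move=> ij; have /hc_classP := hc_braid v ij; rewrite !hc_classM. Qed.

Lemma hcc_sq j : hcc j * hcc j = 1 :> H.
Proof. by have /hc_classP := hc_cliff v j; rewrite !hc_classM hc_class1. Qed.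

Lemma hcc_anti i j : i != j -> hcc i * hcc j = - (hcc j * hcc i) :> H.
Proof.
move=> ij; have /hc_classP := hc_anti v ij; rewrite !hc_classM hc_classS => ->.
by rewrite scaleN1r mulN1r.
Qed.

Lemma hcTc_far (i : 'I_n.-1) (j : 'I_n) : j <> i :> nat -> j <> i.+1 :> nat ->
  hcT i * hcc j = hcc j * hcT i :> H.
Proof. by move=> h1 h2; have /hc_classP := hc_TCfar v h1 h2; rewrite !hc_classM. Qed.

Lemma hcTc (i : 'I_n.-1) (j j' : 'I_n) : j = i :> nat -> j' = i.+1 :> nat ->
  hcT i * hcc j = hcc j' * hcT i :> H.
Proof. by move=> h1 h2; have /hc_classP := hc_TC v h1 h2; rewrite !hc_classM. Qed.

End HeckeRelations.

(** Left multiplication by a Coxeter generator permutes the minimal coset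
    representatives [s_j s_(j+1) .. s_(K-1)] up to the parabolic subgroup. *)
Section CosetSum.
Variables (E : zmodType) (a : nat -> {additive E -> E}) (K : nat) (Y : E).
Hypotheses (aK : forall i, (i < K)%N -> involutive (a i))
  (a_far : forall i j, (i < K)%N -> (j < K)%N -> (i.+1 < j)%N -> forall x, a i (a j x) = a j (a i x))
  (a_braid : forall i, (i.+1 < K)%N -> forall x, a i (a i.+1 (a i x)) = a i.+1 (a i (a i.+1 x)))
  (aY : forall i, (i.+1 < K)%N -> a i Y = Y).

Definition coset_act j : E := foldr (fun i => a i) Y (iota j (K - j)).

Lemma coset_actS j : (j < K)%N -> coset_act j = a j (coset_act j.+1).
Proof. by move=> jK; rewrite /coset_act -[(K - j)%N]prednK ?subn_gt0 // -subnS. Qed.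

Lemma coset_act_low i j : (i.+1 < j)%N -> (j <= K)%N -> a i (coset_act j) = coset_act j.
Proof.
move=> ij; have [d] := ubnP (K - j)%N; elim: d j ij => // d IH j ij; rewrite ltnS => Kd jK.
have [jlt|] := ltnP j K; last first.
  move=> Kj; have jE : j = K by apply/eqP; rewrite eqn_leq jK.
  by rewrite jE /coset_act subnn /= aY // (leq_trans ij).
rewrite coset_actS // a_far //; last by apply: leq_trans jK; exact: ltnW.
by rewrite IH //; [exact: ltnW | apply: leq_trans Kd; rewrite subnS prednK ?subn_gt0].
Qed.

Lemma coset_act_high i j : (j < i)%N -> (i < K)%N -> a i (coset_act j) = coset_act j.
Proof.
move=> ji iK; have [d] := ubnP (i - j)%N; elim: d j ji => // d IH j ji; rewrite ltnS => id.
have jK := ltn_trans ji iK; rewrite coset_actS //.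
move: ji; rewrite leq_eqVlt => /orP[/eqP ij|ji].
  rewrite -ij in iK *; rewrite coset_actS // -a_braid // coset_act_low //.
rewrite -a_far // IH //; apply: leq_trans id.
by rewrite subnS prednK // subn_gt0 ltnW.
Qed.

Lemma coset_sum_inv i : (i < K)%N ->
  a i (\sum_(j < K.+1) coset_act j) = \sum_(j < K.+1) coset_act j.
Proof.
move=> iK; rewrite raddf_sum /=.
have iK1 : (i < K.+1)%N by rewrite ltnW.
pose t := tperm (Ordinal iK1) (Ordinal (iK : i.+1 < K.+1)%N).
rewrite [RHS](reindex_inj (@perm_inj _ t)) /=; apply: eq_bigr => j _.
case: tpermP => [->|->|/eqP ni /eqP nj] /=.
- by rewrite coset_actS // aK.
- by rewrite -coset_actS.
have {}ni : (j : nat) <> i by move=> e; case/eqP: ni; apply/val_inj.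
have {}nj : (j : nat) <> i.+1 by move=> e; case/eqP: nj; apply/val_inj.
have [ji|ij] := ltnP j i; first exact: coset_act_high.
apply: coset_act_low; last by rewrite -ltnS.
by rewrite ltn_neqAle (introN eqP (nesym nj)) ltn_neqAle (introN eqP (nesym ni)).
Qed.

End CosetSum.

(** * Averaging over signed permutations *)

Section Averaging.
Variables (n : nat) (k : fieldType).
Local Notation H := (hecke_clifford n (1 : k)).
Local Notation module := (supermodule n (1 : k)).
Local Notation letter := ('I_n.-1 + 'I_n)%type.

Lemma hcT_sq i : hcT i * hcT i = 1 :> H.
Proof.
have := hcT_quad (1 : k) i; rewrite scale1r mulrDr mulr1 mulrBl mul1r addrA subrK.
by move/eqP; rewrite subr_eq0 => /eqP.
Qed.

Lemma hcTc_succ (i : 'I_n.-1) (j j' : 'I_n) : j = i :> nat -> j' = i.+1 :> nat ->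
  hcT i * hcc j' = hcc j * hcT i :> H.
Proof.
move=> ij ij'; have e := hcTc (1 : k) ij ij'.
by rewrite -[LHS]mulr1 -(hcT_sq i) mulrA -(mulrA (hcT i)) -e mulrA hcT_sq mul1r.
Qed.

Lemma hc_word_cat (w1 w2 : seq letter) : hc_word (w1 ++ w2) = hc_word w1 * hc_word w2 :> H.
Proof. by rewrite /hc_word big_cat. Qed.

Lemma hc_word_revK (w : seq letter) : hc_word w * hc_word (rev w) = 1 :> H.
Proof.
elim: w => [|x w IH]; first by rewrite /hc_word !big_nil mulr1.
rewrite rev_cons -cats1 -cat1s !hc_word_cat -mulrA (mulrA (hc_word w)) IH mul1r.
by rewrite /hc_word !big_seq1; case: x => [i|j]; rewrite ?hcT_sq ?hcc_sq.
Qed.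

Definition s_word (i : nat) : seq letter := [seq inl x | x <- pmap insub [:: i]].
Definition c_word (j : nat) : seq letter := [seq inr x | x <- pmap insub [:: j]].

Fixpoint cliff_words (j : nat) : seq (seq letter) :=
  if j is j'.+1 then cliff_words j' ++ [seq c_word j' ++ w | w <- cliff_words j'] else [:: [::]].

(** The words [s_j s_(j+1) .. s_(K-1)] are minimal coset representatives of a
    symmetric group modulo the previous one. *)
Fixpoint perm_words (K : nat) : seq (seq letter) :=
  if K is K'.+1 then
    [seq flatten [seq s_word i | i <- iota j (K' - j)] ++ w | j <- iota 0 K'.+1, w <- perm_words K']
  else [:: [::]].

(** At [v = 1] the generators [s_i] and [c_j] generate a finite group, and these
    words are normal forms of its elements up to sign. The sign does not matter
    below, since a word always occurs together with its inverse. *)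
Definition group_words : seq (seq letter) := [seq s ++ c | s <- perm_words n, c <- cliff_words n].

Variables M N : module.

Definition word_conj (w : seq letter) (X : 'M[k]_(smdim M, smdim N)) :=
  smact M (hc_word w) *m X *m smact N (hc_word (rev w)).

Fact word_conj_linear w : linear (word_conj w).
Proof.
by move=> a X Y; rewrite /word_conj mulmxDr mulmxDl -scalemxAr -scalemxAl.
Qed.

HB.instance Definition _ w := GRing.isLinear.Build k _ _ _ (word_conj w) (word_conj_linear w).

Lemma word_conj_cat w1 w2 X : word_conj (w1 ++ w2) X = word_conj w1 (word_conj w2 X).
Proof.
by rewrite /word_conj rev_cat !hc_word_cat !smactM !mulmxA.
Qed.

Lemma word_conj_nil X : word_conj [::] X = X.
Proof. by rewrite /word_conj /hc_word !big_nil !(smact_mul _).1 mul1mx mulmx1. Qed.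

Lemma word_conj_flatten (f : nat -> seq letter) s X :
  word_conj (flatten [seq f i | i <- s]) X = foldr (fun i => word_conj (f i)) X s.
Proof. by elim: s => [|i s IH] /=; rewrite ?word_conj_nil // word_conj_cat IH. Qed.

Definition average X := \sum_(w <- group_words) word_conj w X.

Let avS Y K := \sum_(s <- perm_words K) word_conj s Y.
Let avC X j := \sum_(c <- cliff_words j) word_conj c X.

Lemma averageE X : average X = avS (avC X n) n.
Proof.
rewrite /average /group_words big_allpairs_dep /=; apply: eq_bigr => s _.
by rewrite raddf_sum; apply: eq_bigr => c _; rewrite word_conj_cat.
Qed.

Let aS i : {additive _ -> _} := word_conj (s_word i).
Let aC j : {additive _ -> _} := word_conj (c_word j).

Lemma avCS X j : avC X j.+1 = avC X j + aC j (avC X j).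
Proof.
rewrite /avC /= big_cat /= big_map; congr (_ + _).
by rewrite raddf_sum; apply: eq_bigr => c _; rewrite word_conj_cat.
Qed.

Lemma avSS Y K : avS Y K.+1 = \sum_(j < K.+1) coset_act aS K (avS Y K) j.
Proof.
rewrite {1}/avS [perm_words K.+1]/(allpairs_dep _ (iota 0 K.+1) _) big_allpairs_dep.
rewrite -[iota 0 K.+1]/(index_iota 0 K.+1) big_mkord; apply: eq_bigr => j _.
rewrite /coset_act -word_conj_flatten raddf_sum; apply: eq_bigr => w _.
by rewrite word_conj_cat.
Qed.

Lemma word_conj_eq w1 w2 :
  hc_word w1 = hc_word w2 :> H -> hc_word (rev w1) = hc_word (rev w2) :> H ->
  word_conj w1 =1 word_conj w2.
Proof. by rewrite /word_conj => e1 e2 X; rewrite e1 e2. Qed.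

Lemma word_conj_eqN w1 w2 :
  hc_word w1 = - hc_word w2 :> H -> hc_word (rev w1) = - hc_word (rev w2) :> H ->
  word_conj w1 =1 word_conj w2.
Proof.
by rewrite /word_conj => e1 e2 X; rewrite e1 e2 (raddfN (smact M)) (raddfN (smact N)) /= mulNmx mulmxN mulNmx opprK.
Qed.

Lemma s_wordE i (h : (i < n.-1)%N) : s_word i = [:: inl (Ordinal h)].
Proof. by rewrite /s_word /= insubT. Qed.

Lemma c_wordE j (h : (j < n)%N) : c_word j = [:: inr (Ordinal h)].
Proof. by rewrite /c_word /= insubT. Qed.

Lemma c_wordN j : ~~ (j < n)%N -> c_word j = [::].
Proof. by move=> h; rewrite /c_word /= insubN. Qed.

Lemma aSK i : involutive (aS i).
Proof.
move=> X; rewrite -[LHS]word_conj_cat -[RHS]word_conj_nil; apply: word_conj_eq.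
  have [h|h] := boolP (i < n.-1)%N; last by rewrite /s_word /= insubN.
  by rewrite (s_wordE h) /hc_word !big_cons !big_nil mulr1 hcT_sq.
have [h|h] := boolP (i < n.-1)%N; last by rewrite /s_word /= insubN.
by rewrite (s_wordE h) /hc_word !big_cons !big_nil mulr1 hcT_sq.
Qed.

Lemma aCK i : involutive (aC i).
Proof.
move=> X; rewrite -[LHS]word_conj_cat -[RHS]word_conj_nil; apply: word_conj_eq;
by (have [h|h] := boolP (i < n)%N; last by rewrite c_wordN);
   rewrite (c_wordE h) /hc_word !big_cons !big_nil mulr1 hcc_sq.
Qed.

Lemma aCC i j X : aC i (aC j X) = aC j (aC i X).
Proof.
have [->//|ij] := eqVneq i j.
have [hi|hi] := boolP (i < n)%N; last by rewrite /aC (c_wordN hi) /= !word_conj_nil.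
have [hj|hj] := boolP (j < n)%N; last by rewrite /aC (c_wordN hj) /= !word_conj_nil.
rewrite -[LHS]word_conj_cat -[RHS]word_conj_cat (c_wordE hi) (c_wordE hj).
by apply: word_conj_eqN; rewrite /hc_word !big_cons !big_nil !mulr1 hcc_anti // eq_sym.
Qed.

(** The sum over the subsets of Clifford generators is stable under each of them. *)
Lemma avC_inv X i j : (i < j)%N -> aC i (avC X j) = avC X j.
Proof.
elim: j => // j IH; rewrite ltnS leq_eqVlt => /orP[/eqP->|ij].
  by rewrite avCS raddfD /= aCK addrC.
by rewrite avCS raddfD [aC i (aC j _)]aCC !(IH ij).
Qed.

(** From [c_j s_i = s_i c_j'], where [s_i] moves [j'] to [j]. *)
Lemma aCS i j X : exists j', aC j (aS i X) = aS i (aC j' X).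
Proof.
have [hi|hi] := boolP (i < n.-1)%N; last first.
  by exists j; rewrite /aS /s_word /= insubN //= !word_conj_nil.
have [hj|hj] := boolP (j < n)%N; last first.
  by exists j; rewrite /aC (c_wordN hj) /= !word_conj_nil.
have hi1 : (i.+1 < n)%N by rewrite -ltn_predRL.
have hi0 := ltnW hi1.
have ok j' (hj' : (j' < n)%N) :
    hcT (Ordinal hi) * hcc (Ordinal hj) = hcc (Ordinal hj') * hcT (Ordinal hi) :> H ->
    hcT (Ordinal hi) * hcc (Ordinal hj') = hcc (Ordinal hj) * hcT (Ordinal hi) :> H ->
    aC j (aS i X) = aS i (aC j' X).
  move=> e1 e2; rewrite -[LHS]word_conj_cat -[RHS]word_conj_cat.
  rewrite (s_wordE hi) (c_wordE hj) (c_wordE hj').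
  by apply: word_conj_eq; rewrite /hc_word !big_cons !big_nil !mulr1.
have [ji|ji] := eqVneq j i.
  exists i.+1; apply: (ok _ hi1); first exact: hcTc.
  exact: hcTc_succ.
have [ji1|ji1] := eqVneq j i.+1.
  exists i; apply: (ok _ hi0); first exact: hcTc_succ.
  exact: hcTc.
by exists j; apply: (ok _ hj); apply: hcTc_far; apply/eqP.
Qed.

Lemma avS_Cinv Y K : (forall j, aC j Y = Y) -> forall j, aC j (avS Y K) = avS Y K.
Proof.
move=> YC; elim: K => [|K IH] j; first by rewrite /avS big_seq1 word_conj_nil.
rewrite avSS raddf_sum; apply: eq_bigr => r _; rewrite /coset_act /=.
elim: (iota r _) j => [|i s IHs] j /=; first exact: IH.
have [j' e] := aCS i j (foldr (fun i => aS i) (avS Y K) s).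
by apply: etrans e _; congr (aS i _); exact: IHs.
Qed.

(** By [coset_sum_inv], one parabolic step at a time. *)
Lemma avS_inv Y K i : (K <= n)%N -> (i.+1 < K)%N -> aS i (avS Y K) = avS Y K.
Proof.
elim: K i => // K IH i Kn; rewrite ltnS => iK.
have Kn1 : (K <= n.-1)%N by rewrite -ltnS prednK // (leq_trans _ Kn).
have lt a : (a < K)%N -> (a < n.-1)%N by move=> h; exact: leq_trans h Kn1.
rewrite avSS; apply: coset_sum_inv => // [i' _|a b aK bK ab x|a aK x|a aK].
- exact: aSK.
- rewrite -[LHS]word_conj_cat -[RHS]word_conj_cat (s_wordE (lt _ aK)) (s_wordE (lt _ bK)).
  by apply: word_conj_eq; rewrite /hc_word !big_cons !big_nil !mulr1 hcT_far //= ab ?orbT.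
- have aK0 := ltnW aK.
  transitivity (word_conj (s_word a ++ s_word a.+1 ++ s_word a) x); first by rewrite !word_conj_cat.
  transitivity (word_conj (s_word a.+1 ++ s_word a ++ s_word a.+1) x); last by rewrite !word_conj_cat.
  rewrite (s_wordE (lt _ aK0)) (s_wordE (lt _ aK)).
  by apply: word_conj_eq; rewrite /hc_word !big_cons !big_nil !mulr1 !mulrA hcT_braid.
- by apply: IH => //; exact: ltnW.
Qed.

(** The average is fixed under conjugation by each letter, hence commutes with
    the generators. *)
Lemma average_comm X x : smact M x *m average X = average X *m smact N x.
Proof.
have letterP l : word_conj [:: l] (average X) = average X.
  rewrite averageE; case: l => [i|j].
    have := @avS_inv (avC X n) n i (leqnn n); rewrite -ltn_predRL => /(_ (ltn_ord i)).
    by rewrite /aS (s_wordE (ltn_ord i)); congr (word_conj [:: inl _] _ = _); apply/val_inj.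
  have Cinv l : aC l (avC X n) = avC X n.
    have [h|h] := boolP (l < n)%N; first exact: avC_inv.
    by rewrite /aC (c_wordN h) /= word_conj_nil.
  have := avS_Cinv n Cinv j.
  by rewrite /aC (c_wordE (ltn_ord j)); congr (word_conj [:: inr _] _ = _); apply/val_inj.
have letter_comm l : smact M (hc_word [:: l]) *m average X = average X *m smact N (hc_word [:: l]).
  rewrite -{2}(letterP l) /word_conj -!mulmxA -smactM.
  by rewrite -[hc_word [:: l] in X in _ *m smact N X]/(hc_word (rev (rev [:: l]))) hc_word_revK (smact_mul _).1 mulmx1.
elim/hc_class_ind: x => [a|i|j|x y IHx IHy|x y IHx IHy].
- by rewrite (linearZ_LR (smact M)) (linearZ_LR (smact N)) /= !(smact_mul _).1 -scalemxAl -scalemxAr mul1mx mulmx1.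
- by have := letter_comm (inl i); rewrite /hc_word !big_seq1.
- by have := letter_comm (inr j); rewrite /hc_word !big_seq1.
- by rewrite (raddfD (smact M)) (raddfD (smact N)) /= mulmxDl mulmxDr IHx IHy.
- by rewrite !smactM -mulmxA IHy mulmxA IHx mulmxA.
Qed.

(** A trace is a sum of diagonal matrix entries, and the product of two of these
    is an entry of a conjugate of an elementary matrix. *)
Lemma char_pairing : \sum_(w <- group_words) smchar M (hc_word w) * smchar N (hc_word (rev w)) =
  \sum_i \sum_j average (delta_mx i j) i j.
Proof.
have tr2 w : smchar M (hc_word w) * smchar N (hc_word (rev w)) =
    \sum_i \sum_j word_conj w (delta_mx i j) i j.
  rewrite /smchar /mxtrace mulr_suml; apply: eq_bigr => i _; rewrite mulr_sumr.
  apply: eq_bigr => j _; rewrite /word_conj !mxE (bigD1 j) //= !mxE (bigD1 i) //= mxE !eqxx mulr1.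
  rewrite big1 => [|l /negPf li]; last by rewrite mxE li mulr0.
  rewrite addr0 big1 ?addr0 // => l /negPf lj; rewrite !mxE big1 ?mul0r // => l' _.
  by rewrite mxE lj andbF mulr0.
under eq_bigr => w _ do rewrite tr2.
rewrite exchange_big /=; apply: eq_bigr => i _; rewrite exchange_big /=.
by apply: eq_bigr => j _; rewrite /average summxE.
Qed.

End Averaging.

(** * Schur orthogonality *)

Section SchurOrthogonality.
Variables (n : nat) (k : closedFieldType).
Hypothesis k_char0 : forall n, n.+1%:R != 0 :> k.
Local Notation H := (hecke_clifford n (1 : k)).
Local Notation module := (supermodule n (1 : k)).
Let two_neq0 : (2 : k) != 0 := k_char0 1.
Local Notation P M := (parity_mx two_neq0 M).

Definition intertwines (M N : module) (F : 'M[k]_(smdim M, smdim N)) :=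
  forall x, F *m smact N x = smact M x *m F.

(** The parts of [F] that commute, resp. anticommute, with the parity. *)
Definition twist (M N : module) (s : bool) (F : 'M[k]_(smdim M, smdim N)) :=
  2^-1 *: (F + (-1) ^+ s *: (P M *m F *m P N)).

Lemma twistE (M N : module) (F : 'M[k]_(smdim M, smdim N)) :
  F = twist false F + twist true F.
Proof.
rewrite /twist -scalerDr scale1r scaleN1r addrACA subrr addr0 -mulr2n -scaler_nat scalerA.
by rewrite mulVf ?scale1r.
Qed.

Lemma twist_intertwines (M N : module) s (F : 'M[k]_(smdim M, smdim N)) :
  intertwines F -> intertwines (twist s F).
Proof.
move=> FA.
have PFPA b x : hc_homog b x ->
    (P M *m F *m P N) *m smact N x = smact M x *m (P M *m F *m P N).
  move=> xb; have PN := parity_mxC two_neq0 N xb; have PM := parity_mxC two_neq0 M xb.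
  rewrite -[LHS]mulmxA PN -scalemxAr [X in _ *: X]mulmxA -(mulmxA (P M) F (smact N x)) FA (mulmxA (P M) (smact M x)) PM.
  by rewrite -!scalemxAl scalerA -signr_addb addbb scale1r -!mulmxA.
have hom b x : hc_homog b x -> twist s F *m smact N x = smact M x *m twist s F.
  move=> xb; rewrite /twist -scalemxAl -scalemxAr; congr (_ *: _).
  by rewrite mulmxDl mulmxDr FA -scalemxAl -scalemxAr (PFPA b x xb).
elim/hc_class_ind => [a|i|j|x y IHx IHy|x y IHx IHy].
- by apply: (hom false); exact: homog_scal.
- by apply: (hom false); exact: homog_T.
- by apply: (hom true); exact: homog_c.
- by rewrite (raddfD (smact N)) (raddfD (smact M)) mulmxDr mulmxDl IHx IHy.
- by rewrite !smactM [LHS]mulmxA IHx -[LHS]mulmxA IHy mulmxA.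
Qed.

Lemma twist_parity (M N : module) s (F : 'M[k]_(smdim M, smdim N)) :
  twist s F *m P N = (-1) ^+ s *: (P M *m twist s F).
Proof.
rewrite /twist -scalemxAl -scalemxAr [RHS]scalerA [_ * 2^-1]mulrC -scalerA; congr (_ *: _).
rewrite mulmxDl mulmxDr -scalemxAl -scalemxAr scalerDr scalerA -signr_addb addbb scale1r.
by rewrite -!mulmxA !parity_mxK mulmx1 !mulmxA parity_mxK mul1mx addrC.
Qed.

Lemma intertwiner_noniso (M N : module) (F : 'M[k]_(smdim M, smdim N)) :
  sm_irreducible M -> sm_irreducible N -> ~ sm_iso N M -> intertwines F -> F = 0.
Proof.
move=> irrM irrN noniso FA.
have t0 s : twist s F = 0.
  apply/eqP; apply: contra_notT noniso => t0.
  by case: (schur_iso irrN irrM (twist_intertwines s FA) (twist_parity s F) t0).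
by rewrite (twistE F) !t0 addr0.
Qed.

Variables (M : module) (irrM : sm_irreducible M).
Local Notation d := (smdim M).

(** An eigenvalue exists over a closed field; subtracting it leaves an endomorphism
    that is not invertible, hence zero by [schur_iso]. *)
Lemma even_scalar (F : 'M[k]_d) : intertwines F -> F *m P M = P M *m F ->
  exists c, F = c%:M.
Proof.
move=> FA FP; have [d0 _] := irrM.
have [c cE] : exists c, eigenvalue F c.
  have [c cr] : exists c, root (char_poly F) c.
    by apply/closed_rootP; rewrite size_char_poly; move: d0; case: d.
  by exists c; rewrite eigenvalue_root_char.
exists c; apply/eqP; rewrite -subr_eq0; apply/negPn/negP => f0.
have [_ /bijective_inverse[g [_ fg]]] : sm_iso M M /\ bijective (fun u : 'cV[k]_d => (F - c%:M) *m u).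
  apply: (@schur_iso _ _ _ two_neq0 _ _ _ false irrM irrM) => //.
    by move=> x; rewrite mulmxBl mulmxBr FA mul_scalar_mx mul_mx_scalar.
  by rewrite scale1r mulmxBl mulmxBr FP mul_scalar_mx mul_mx_scalar.
case/eigenvalueP: cE => w wF /eqP[].
by rewrite -[w]mulmx1 -fg mulmxA mulmxBr wF mul_mx_scalar subrr mul0mx.
Qed.

Lemma twist_trace (F : 'M[k]_d) : \tr (twist true F) = 0.
Proof.
rewrite /twist mxtraceZ mxtraceD mxtraceZ -mulmxA mxtrace_mulC -mulmxA parity_mxK mulmx1.
by rewrite expr1 mulN1r subrr mulr0.
Qed.

Local Notation av := (@average n k M M).
Local Notation gn := ((size (group_words n))%:R : k).

Lemma average_trace X (J : 'M[k]_d) : intertwines J -> \tr (av X *m J) = gn * \tr (X *m J).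
Proof.
move=> JA; rewrite /average mulmx_suml raddf_sum /=.
rewrite (eq_bigr (fun=> \tr (X *m J))) => [|w _].
  by rewrite big_const_seq count_predT iter_addr_0 mulr_natl.
rewrite /word_conj -!mulmxA -JA mxtrace_mulC -!mulmxA -smactM.
have := hc_word_revK k (rev w); rewrite revK => ->.
by rewrite (smact_mul M).1 mulmx1.
Qed.

(** Averages of elementary matrices are endomorphisms of [M]. These are the
    scalars, or the scalars and the multiples of one anticommuting [J] with [J^2]
    scalar. The traces against [1] and [J] determine the coefficients, and each
    of the two contributes the order of the group to the pairing. *)
Lemma average_pairing_irr : exists2 h : nat, (h == 1%N) || (h == 2%N) &
  \sum_i \sum_j av (delta_mx i j) i j = gn * h%:R.
Proof.
have [d0 _] := irrM.
have dn0 : (d%:R : k) != 0 by move: d0; case: d => // d' _; exact: k_char0.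
have avA X : intertwines (av X) by move=> x; rewrite average_comm.
have even X : exists c, twist false (av X) = c%:M.
  apply: even_scalar; first exact: twist_intertwines.
  by rewrite twist_parity scale1r.
have [c cE] : exists c, forall X, twist false (av X) = (c X)%:M.
  by exists (fun X => projT1 (cid (even X))) => X; exact: projT2 (cid (even X)).
have IA : intertwines (1%:M : 'M[k]_d) by move=> x; rewrite mul1mx mulmx1.
have tr_delta (A : 'M[k]_d) i j : \tr (delta_mx i j *m A) = A j i.
  rewrite /mxtrace (bigD1 i) //= mxE (bigD1 j) //= mxE !eqxx mul1r big1 => [|l /negPf lj].
    rewrite addr0 big1 ?addr0 // => l /negPf li; rewrite mxE big1 // => l' _.
    by rewrite mxE li mul0r.
  by rewrite mxE lj andbF mul0r.
have c_val i j : c (delta_mx i j) = gn * (i == j)%:R / d%:R.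
  have := average_trace (delta_mx i j) IA; rewrite tr_delta mulmx1 (twistE (av _)) mxtraceD.
  rewrite twist_trace addr0 cE mxtrace_scalar mxE [j == i]eq_sym => <-.
  by rewrite -[c _ *+ _]mulr_natr mulfK.
have sum_c : \sum_i \sum_j (c (delta_mx i j))%:M i j = gn.
  transitivity (\sum_(i < d) gn / d%:R).
    apply: eq_bigr => i _; rewrite (bigD1 i) //= mxE eqxx c_val eqxx mulr1 big1 ?addr0 // => j.
    by rewrite eq_sym => /negPf ij; rewrite mxE ij.
  by rewrite sumr_const card_ord -[_ / _ *+ _]mulr_natr mulfVK.
(* the two types of irreducible supermodules *)
have [allT|] := pselect (forall F : 'M[k]_d, intertwines F -> twist true F = 0).
  exists 1%N => //; rewrite mulr1 -[RHS]sum_c; apply: eq_bigr => i _; apply: eq_bigr => j _.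
  by rewrite (twistE (av _)) cE allT ?addr0.
move=> /existsNP[F /not_implyP[FA /eqP J0]]; exists 2%N => //.
pose J := twist true F; rewrite -/J in J0.
have JA : intertwines J := twist_intertwines true FA.
have JP : J *m P M = - (P M *m J) by rewrite twist_parity scaleN1r.
have [_ /bijective_inverse[Ji [JiJ JJi]]] : sm_iso M M /\ bijective (fun u : 'cV[k]_d => J *m u).
  by apply: (@schur_iso _ _ _ two_neq0 _ _ _ true irrM irrM) => //; rewrite twist_parity.
have trJ : \tr J = 0 := twist_trace F.
clearbody J.
have odd2 (X Y : 'M[k]_d) : intertwines X -> intertwines Y -> X *m P M = - (P M *m X) ->
    Y *m P M = - (P M *m Y) -> exists e, X *m Y = e%:M.
  move=> XA YA XP YP; apply: even_scalar => [x|]; first by rewrite -mulmxA YA mulmxA XA mulmxA.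
  by rewrite -mulmxA YP mulmxN mulmxA XP mulNmx opprK mulmxA.
have [s sE] := odd2 J J JA JA JP JP.
have s0 : s != 0.
  apply: contraNneq J0 => s0; have := congr1 (mulmx Ji) sE; rewrite mulmxA JiJ mul1mx s0.
  by rewrite raddf0 mulmx0 => ->.
have [beta betaE] : exists beta, forall X, twist true (av X) = beta X *: J.
  have h X : exists b, twist true (av X) = b *: J.
    have XA := twist_intertwines true (avA X).
    have XP : twist true (av X) *m P M = - (P M *m twist true (av X)).
      by rewrite twist_parity scaleN1r.
    have [e eE] := odd2 _ _ XA JA XP JP.
    exists (e / s); have := congr1 (mulmx^~ J) eE.
    rewrite -mulmxA sE mul_mx_scalar mul_scalar_mx mulrC -scalerA => <-.
    by rewrite scalerA mulVf ?scale1r.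
  by exists (fun X => projT1 (cid (h X))) => X; exact: projT2 (cid (h X)).
have trJJ : \tr (J *m J) = s * d%:R by rewrite sE mxtrace_scalar mulr_natr.
have b_val i j : beta (delta_mx i j) = gn * J j i / (s * d%:R).
  have := average_trace (delta_mx i j) JA; rewrite tr_delta => <-.
  rewrite {1}(twistE (av _)) cE betaE mulmxDl mul_scalar_mx -scalemxAl mxtraceD !mxtraceZ.
  by rewrite trJ mulr0 add0r trJJ mulfK // mulf_neq0.
rewrite mulr2n mulrDr mulr1 -{1}sum_c.
transitivity (\sum_i \sum_j ((c (delta_mx i j))%:M i j + beta (delta_mx i j) * J i j)).
  apply: eq_bigr => i _; apply: eq_bigr => j _.
  by rewrite (twistE (av _)) cE betaE mxE [X in _ + X]mxE.
under eq_bigr => i _ do rewrite big_split /=.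
rewrite big_split /=; congr (_ + _).
transitivity (gn / (s * d%:R) * \tr (J *m J)); last by rewrite trJJ mulfVK // mulf_neq0.
rewrite /mxtrace mulr_sumr; apply: eq_bigr => i _; rewrite mxE mulr_sumr; apply: eq_bigr => j _.
by rewrite b_val; ring.
Qed.

(** Schur orthogonality. The endomorphism ring of an irreducible supermodule
    has dimension 1 or 2, because its odd part may be nonzero. *)
Lemma char_pairing_irr : exists2 h : nat, (h == 1%N) || (h == 2%N) &
  \sum_(w <- group_words n) smchar M (hc_word w) * smchar M (hc_word (rev w)) = gn * h%:R.
Proof. by have [h hP hE] := average_pairing_irr; exists h; rewrite // char_pairing. Qed.

End SchurOrthogonality.

Lemma char_pairing_noniso n (k : closedFieldType) (M N : supermodule n (1 : k)) :
  (forall n, n.+1%:R != 0 :> k) -> sm_irreducible M -> sm_irreducible N -> ~ sm_iso N M ->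
  \sum_(w <- group_words n) smchar M (hc_word w) * smchar N (hc_word (rev w)) = 0.
Proof.
move=> k0 irrM irrN niso; rewrite char_pairing big1 // => i _; rewrite big1 // => j _.
have -> : average (delta_mx i j) = 0 :> 'M[k]_(smdim M, smdim N).
  by apply: (intertwiner_noniso k0 irrM irrN niso) => x; rewrite average_comm.
by rewrite mxE.
Qed.

(** * Modules from generators and relations *)

(** A graded module is the same as matrices satisfying the defining relations,
    together with a parity involution. *)
Section ModuleOfGenerators.
Variables (n : nat) (k : fieldType) (v : k) (d : nat).
Hypothesis two_neq0 : (2 : k) != 0.
Variables (gT : 'I_n.-1 -> 'M[k]_d) (gC : 'I_n -> 'M[k]_d) (Q : 'M[k]_d).
Hypotheses
  (g_quad : forall i, (gT i - v%:M) *m (gT i + 1%:M) = 0)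
  (g_far : forall i j : 'I_n.-1, (i.+1 < j)%N -> gT i *m gT j = gT j *m gT i)
  (g_braid : forall i j : 'I_n.-1, j = i.+1 :> nat ->
     gT i *m gT j *m gT i = gT j *m gT i *m gT j)
  (g_cliff : forall i, gC i *m gC i = 1%:M)
  (g_anti : forall i j, i != j -> gC i *m gC j = - (gC j *m gC i))
  (g_TCfar : forall (i : 'I_n.-1) (j : 'I_n), j <> i :> nat -> j <> i.+1 :> nat ->
     gT i *m gC j = gC j *m gT i)
  (g_TC : forall (i : 'I_n.-1) (j j' : 'I_n), j = i :> nat -> j' = i.+1 :> nat ->
     gT i *m gC j = gC j' *m gT i)
  (QK : Q *m Q = 1%:M)
  (QT : forall i, Q *m gT i = gT i *m Q)
  (QC : forall j, Q *m gC j = - (gC j *m Q)).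
Local Notation H := (hecke_clifford n v).

Fixpoint gens_eval (x : hc_term n k) : 'M[k]_d :=
  match x with
  | HScal a => a%:M
  | HT i => gT i
  | HC j => gC j
  | HAdd y z => gens_eval y + gens_eval z
  | HMul y z => gens_eval y *m gens_eval z
  end.

Lemma gens_eval_cong x y : hc_cong v x y -> gens_eval x = gens_eval y.
Proof.
elim=> {x y} //=.
- by move=> x y z _ -> _ ->.
- by move=> x x' y y' _ -> _ ->.
- by move=> x x' y y' _ -> _ ->.
- by move=> x y z; rewrite addrA.
- by move=> x y; rewrite addrC.
- by move=> x; rewrite raddf0 add0r.
- by move=> x; rewrite mul_scalar_mx scaleN1r addNr raddf0.
- by move=> x y z; rewrite mulmxA.
- by move=> x; rewrite mul1mx.
- by move=> x; rewrite mulmx1.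
- by move=> x y z; rewrite mulmxDl.
- by move=> x y z; rewrite mulmxDr.
- by move=> a b; rewrite raddfD.
- by move=> a b; rewrite scalar_mxM.
- by move=> a x; rewrite mul_scalar_mx mul_mx_scalar.
- by move=> i; rewrite raddfN /= g_quad raddf0.
- by move=> i j /orP[|] h; rewrite (g_far h).
- by move=> i j h; rewrite (g_anti h) mul_scalar_mx scaleN1r.
Qed.

Definition gens_act (h : H) : 'M[k]_d := gens_eval (repr h).

Lemma gens_act_class x : gens_act (hc_class v x) = gens_eval x.
Proof. exact: gens_eval_cong (hc_reprP v x). Qed.

Fact gens_act_linear : linear gens_act.
Proof.
move=> a; elim/hc_classW=> x; elim/hc_classW=> y.
rewrite [X in gens_act (X + _)]/GRing.scale /= hc_scaleqE [X in gens_act X]/GRing.add /= hc_addqE.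
by rewrite !gens_act_class /= mul_scalar_mx.
Qed.

HB.instance Definition _ := GRing.isLinear.Build k H 'M[k]_d *:%R gens_act gens_act_linear.

Lemma gens_actM x y : gens_act (x * y) = gens_act x *m gens_act y.
Proof.
elim/hc_classW: x => x; elim/hc_classW: y => y.
by rewrite [X in gens_act X]/GRing.mul /= hc_mulqE !gens_act_class.
Qed.

Fact gens_act_monoid : monoid_morphism gens_act.
Proof. by split; [exact: gens_act_class|exact: gens_actM]. Qed.

Fact gens_act_parity b x : hc_homog b x -> Q *m gens_act x = (-1) ^+ b *: (gens_act x *m Q).
Proof.
elim=> {b x} [a|i|j|b|b x y _ IHx _ IHy|b b' x y _ IHx _ IHy].
- by rewrite linearZ /= gens_act_monoid.1 -scalemxAr -scalemxAl mulmx1 mul1mx scale1r.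
- by rewrite gens_act_class /= QT scale1r.
- by rewrite gens_act_class /= QC scaleN1r.
- by rewrite raddf0 mulmx0 mul0mx scaler0.
- by rewrite raddfD /= mulmxDr mulmxDl IHx IHy scalerDr.
- by rewrite gens_actM mulmxA IHx -scalemxAl -mulmxA IHy -scalemxAr scalerA signr_addb mulmxA.
Qed.

Definition gens_sm : supermodule n v := build_sm two_neq0 gens_act_monoid QK gens_act_parity.

Lemma gens_sm_word (w : seq ('I_n.-1 + 'I_n)) :
  smact gens_sm (hc_word w) =
    foldr mulmx 1%:M [seq match s with inl i => gT i | inr j => gC j end | s <- w].
Proof.
rewrite /= /hc_word; elim: w => [|s w IH]; first by rewrite big_nil gens_act_monoid.1.
rewrite big_cons gens_actM IH /=; congr (_ *m _).
by case: s => [i|j]; rewrite gens_act_class.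
Qed.

End ModuleOfGenerators.

(** * The operators on tensor space *)

(** The tensor space, as functions on its basis: a basis vector carries a
    parity and a colour at each position. *)
Section TensorOperators.
Variables (n : nat) (S : finType).
Variables (flip : 'I_n -> S -> S) (swap : 'I_n.-1 -> S -> S).
Variables (eps : S -> 'I_n -> bool) (col : S -> 'I_n -> nat).

Definition lo (i : 'I_n.-1) : 'I_n := widen_ord (leq_pred n) i.

Fact hi_subproof (i : 'I_n.-1) : (i.+1 < n)%N.
Proof. by rewrite -ltn_predRL. Qed.

Definition hi (i : 'I_n.-1) : 'I_n := Ordinal (hi_subproof i).

Hypotheses
  (eps_flip : forall j s l, eps (flip j s) l = eps s l (+) (l == j))
  (col_flip : forall j s l, col (flip j s) l = col s l)
  (eps_swap : forall i s l, eps (swap i s) l = eps s l)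
  (col_swap : forall i s l, col (swap i s) l = col s (tperm (lo i) (hi i) l))
  (ext : forall s t, (forall l, eps s l = eps t l) -> (forall l, col s l = col t l) -> s = t).

Variable R : comNzRingType.
Variable v : R.
Local Notation z := (v - 1).
Implicit Types (f g : S -> R) (s : S).

Definition sgn (j : 'I_n) s : R := (-1) ^+ (\sum_(l < n | (l < j)%N) eps s l)%N.

Definition clifford_op j f s : R := sgn j s * f (flip j s).

Definition keep_coef (x y : nat) : R := if x == y then v else if (y < x)%N then z else 0.
Definition swap_coef (x y : nat) : R := if x == y then 0 else if (y < x)%N then 1 else v.

(** The classical action of the Hecke algebra on a tensor power: [keep_coef] and
    [swap_coef] are the entries of its R-matrix. *)
Definition swap_op i f s : R :=
  keep_coef (col s (lo i)) (col s (hi i)) * f s + swap_coef (col s (lo i)) (col s (hi i)) * f (swap i s).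

Definition fflip i s := flip (lo i) (flip (hi i) s).

(** The action of [T_i] on the module induced from [swap_op]. The four cases are
    obtained by moving [T_i] to the right of [c_i], [c_(i+1)] or both, with
    [T_i c_i = c_(i+1) T_i] and [(T_i - z) c_(i+1) = c_i (T_i - z)]. *)
Definition hecke_op i f s : R :=
  if eps s (lo i) then
    if eps s (hi i) then - swap_op i f s + z * f s else swap_op i f (fflip i s) - z * f (fflip i s)
  else if eps s (hi i) then swap_op i f (fflip i s) + z * f s else swap_op i f s + z * f (fflip i s).

Definition parity_op f s : R := (-1) ^+ (\sum_(l < n) eps s l)%N * f s.

Lemma lo_neq_hi i : lo i != hi i.
Proof. by rewrite -val_eqE /= ltn_eqF. Qed.

Lemma flipC i j s : flip i (flip j s) = flip j (flip i s).
Proof. by apply: ext => l; rewrite ?col_flip // !eps_flip addbAC. Qed.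

Lemma flipK j s : flip j (flip j s) = s.
Proof. by apply: ext => l; rewrite ?col_flip // !eps_flip -addbA addbb addbF. Qed.

Lemma flip_swap i j s : flip j (swap i s) = swap i (flip j s).
Proof. by apply: ext => l; rewrite ?(col_flip, col_swap, eps_flip, eps_swap). Qed.

Lemma swapK i s : swap i (swap i s) = s.
Proof. by apply: ext => l; rewrite ?eps_swap // !col_swap tpermK. Qed.

Lemma ord_neq (a b : 'I_n) : (a : nat) <> b -> a != b.
Proof. by move=> h; apply/eqP => e; case: h; rewrite e. Qed.

Lemma swap_far (i j : 'I_n.-1) s : (i.+1 < j)%N -> swap i (swap j s) = swap j (swap i s).
Proof.
move=> ij; apply: ext => l; rewrite ?eps_swap // !col_swap; congr (col s _).
rewrite -!permM; congr (fun_of_perm _ l).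
rewrite conjgC tpermJ !tpermD //; apply: ord_neq => /=; lia.
Qed.

Lemma swap_braid (i j : 'I_n.-1) s : j = i.+1 :> nat ->
  swap i (swap j (swap i s)) = swap j (swap i (swap j s)).
Proof.
move=> ij; apply: ext => l; rewrite ?eps_swap // !col_swap; congr (col s _).
have hij : hi i = lo j by apply/val_inj; rewrite /= ij.
rewrite -!permM; congr (fun_of_perm _ l).
have := tpermJ (lo i) (hi i) (tperm (lo j) (hi j)); rewrite conjgE tpermV => ->.
have := tpermJ (lo j) (hi j) (tperm (lo i) (hi i)); rewrite conjgE tpermV => ->.
rewrite hij tpermL tpermR !tpermD //; apply: ord_neq => /=; lia.
Qed.

Lemma swap_op_quad i f s : swap_op i (swap_op i f) s = z * swap_op i f s + v * f s.
Proof.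
rewrite /swap_op swapK !col_swap tpermL tpermR /keep_coef /swap_coef.
by case: ltngtP => _; ring.
Qed.

Lemma swap_op_far (i j : 'I_n.-1) f s : (i.+1 < j)%N -> swap_op i (swap_op j f) s = swap_op j (swap_op i f) s.
Proof.
move=> ij; rewrite /swap_op !col_swap (swap_far _ ij) !tpermD; try by apply: ord_neq => /=; lia.
ring.
Qed.

Lemma swap_op_braid (i j : 'I_n.-1) f s : j = i.+1 :> nat ->
  swap_op i (swap_op j (swap_op i f)) s = swap_op j (swap_op i (swap_op j f)) s.
Proof.
move=> ij; have hij : hi i = lo j by apply/val_inj; rewrite /= ij.
rewrite /swap_op !col_swap hij !tpermL !tpermR.
have d1 : tperm (lo i) (lo j) (hi j) = hi j by rewrite tpermD //; apply: ord_neq => /=; lia.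
have d2 : tperm (lo j) (hi j) (lo i) = lo i by rewrite tpermD //; apply: ord_neq => /=; lia.
rewrite !(d1, d2, tpermL, tpermR) !swapK (swap_braid s ij).
set x := col s (lo i); set y := col s (lo j); set w := col s (hi j).
rewrite /keep_coef /swap_coef; case: (ltngtP x y) => xy; case: (ltngtP y w) => yw; case: (ltngtP x w) => xw;
  try (by exfalso; lia); ring.
Qed.

Lemma sgn_flip j l s : sgn j (flip l s) = (if (l < j)%N then - sgn j s else sgn j s).
Proof.
rewrite /sgn; case: ifP => lj; last first.
  congr (_ ^+ _); apply: eq_bigr => a aj; rewrite eps_flip.
  by case: eqP => [e|_]; [rewrite -e aj in lj|rewrite addbF].
rewrite (bigD1 l) //= [in RHS](bigD1 l) //= eps_flip eqxx addbT.
rewrite (eq_bigr (fun a => nat_of_bool (eps s a))) => [|a /andP[_ /negPf ajl]]; last first.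
  by rewrite eps_flip ajl addbF.
by rewrite !exprD; case: (eps s l); rewrite /= ?expr0 ?expr1; ring.
Qed.

Lemma sgn_swap j i s : sgn j (swap i s) = sgn j s.
Proof. by congr (_ ^+ _); apply: eq_bigr => a _; rewrite eps_swap. Qed.

Lemma sgn_hi i s : sgn (hi i) s = (if eps s (lo i) then - sgn (lo i) s else sgn (lo i) s).
Proof.
rewrite /sgn (bigD1 (lo i)) //= (eq_bigl (fun l : 'I_n => (l < i)%N)) => [|l]; last first.
  by rewrite ltnS andbC -val_eqE /= -ltn_neqAle.
by rewrite exprD; case: ifP => _; rewrite ?expr0 ?expr1; ring.
Qed.

Lemma sgn_sq j s : sgn j s * sgn j s = 1.
Proof. by rewrite /sgn -exprD addnn -mul2n exprM sqrrN expr1n expr1n. Qed.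

Lemma swap_op_clifford i j f s : swap_op i (clifford_op j f) s = clifford_op j (swap_op i f) s.
Proof. by rewrite /swap_op /clifford_op !col_flip sgn_swap flip_swap; ring. Qed.

Lemma clifford_op_sq j f s : clifford_op j (clifford_op j f) s = f s.
Proof. by rewrite /clifford_op flipK sgn_flip ltnn mulrA sgn_sq mul1r. Qed.

Lemma clifford_op_anti i j f s : i != j -> clifford_op i (clifford_op j f) s = - clifford_op j (clifford_op i f) s.
Proof.
move=> ij; rewrite /clifford_op (flipC j i) !sgn_flip.
by case: ltngtP => [_|_|/val_inj e]; rewrite ?e ?eqxx // in ij *; ring.
Qed.

Lemma fflip_eps i s l : eps (fflip i s) l = eps s l (+) ((l == lo i) || (l == hi i)).
Proof.
rewrite /fflip !eps_flip -addbA; congr (_ (+) _).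
by case: (l =P lo i) => [->|_]; rewrite ?(negPf (lo_neq_hi i)) ?addbF.
Qed.

Lemma flip_fflip i j s : flip j (fflip i s) = fflip i (flip j s).
Proof. by rewrite /fflip (flipC j) (flipC j). Qed.

Lemma flip_lo_fflip i s : fflip i (flip (lo i) s) = flip (hi i) s.
Proof. by rewrite /fflip (flipC (hi i) (lo i)) flipK. Qed.

Lemma flip_hi_fflip i s : fflip i (flip (hi i) s) = flip (lo i) s.
Proof. by rewrite /fflip flipK. Qed.

Lemma lt_lo_hi i : (lo i < hi i)%N.
Proof. by rewrite /= ltnSn. Qed.

Lemma lt_hi_lo i : (hi i < lo i)%N = false.
Proof. by rewrite /= ltnNge leqnSn. Qed.

Lemma hecke_op_clifford_lo i f s : hecke_op i (clifford_op (lo i) f) s = clifford_op (hi i) (hecke_op i f) s.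
Proof.
rewrite /hecke_op !swap_op_clifford /clifford_op !eps_flip eqxx (negPf (lo_neq_hi i)) !addbF !addbT.
rewrite !flip_fflip !flip_lo_fflip !flip_hi_fflip.
rewrite /fflip !sgn_flip !sgn_hi !(ltnn, lt_lo_hi, lt_hi_lo).
by case: (eps s (lo i)); case: (eps s (hi i)) => /=; ring.
Qed.

Lemma hecke_op_clifford_hi i f s :
  hecke_op i (clifford_op (hi i) f) s - z * clifford_op (hi i) f s = clifford_op (lo i) (hecke_op i f) s - z * clifford_op (lo i) f s.
Proof.
rewrite /hecke_op !swap_op_clifford /clifford_op !eps_flip eqxx eq_sym (negPf (lo_neq_hi i)) !addbF !addbT.
rewrite !flip_fflip !flip_lo_fflip !flip_hi_fflip.
rewrite /fflip !sgn_flip !sgn_hi !(ltnn, lt_lo_hi, lt_hi_lo).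
by case: (eps s (lo i)); case: (eps s (hi i)) => /=; ring.
Qed.

Lemma hecke_op_clifford_far i j f s : j != lo i -> j != hi i -> hecke_op i (clifford_op j f) s = clifford_op j (hecke_op i f) s.
Proof.
move=> jl jh; rewrite /hecke_op !swap_op_clifford /clifford_op !eps_flip.
rewrite !(eq_sym _ j) (negPf jl) (negPf jh) !addbF !flip_fflip.
have -> : sgn j (fflip i s) = sgn j s.
  have e : (hi i < j)%N = (lo i < j)%N by rewrite [RHS]leq_eqVlt; case: eqP => // e; case/eqP: jh; apply/val_inj.
  by rewrite /fflip !sgn_flip e; case: (lo i < j)%N; rewrite ?opprK.
by case: (eps s (lo i)); case: (eps s (hi i)) => /=; ring.
Qed.

Lemma par_flip j s : (-1) ^+ (\sum_(l < n) eps (flip j s) l)%N =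
  - (-1) ^+ (\sum_(l < n) eps s l)%N :> R.
Proof.
rewrite (bigD1 j) //= [in RHS](bigD1 j) //= eps_flip eqxx addbT.
rewrite (eq_bigr (fun a => nat_of_bool (eps s a))) => [|a /negPf ajl]; last first.
  by rewrite eps_flip ajl addbF.
by rewrite !exprD; case: (eps s j); rewrite /= ?expr0 ?expr1; ring.
Qed.

Lemma parity_op_sq f s : parity_op (parity_op f) s = f s.
Proof. by rewrite /parity_op mulrA -exprD addnn -mul2n exprM sqrrN expr1n expr1n mul1r. Qed.

Lemma parity_op_clifford j f s : parity_op (clifford_op j f) s = - clifford_op j (parity_op f) s.
Proof. by rewrite /parity_op /clifford_op par_flip; ring. Qed.

Lemma parity_op_hecke i f s : parity_op (hecke_op i f) s = hecke_op i (parity_op f) s.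
Proof.
have pS t : swap_op i (parity_op f) t = parity_op (swap_op i f) t.
  have e : (\sum_(l < n) eps (swap i t) l = \sum_(l < n) eps t l)%N.
    by apply: eq_bigr => l _; rewrite eps_swap.
  by rewrite /swap_op /parity_op e; ring.
rewrite /hecke_op !pS /parity_op /fflip !par_flip.
by case: (eps s (lo i)); case: (eps s (hi i)) => /=; ring.
Qed.

Fixpoint word_op (w : seq ('I_n.-1 + 'I_n)) f : S -> R :=
  match w with
  | [::] => f
  | inl i :: w' => hecke_op i (word_op w' f)
  | inr j :: w' => clifford_op j (word_op w' f)
  end.

Definition diag_entry i s : R :=
  let a := keep_coef (col s (lo i)) (col s (hi i)) in
  if eps s (lo i) then if eps s (hi i) then z - a else 0
  else if eps s (hi i) then z else a.

(** The function [f] is supported on the states that agree with [s] at the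
    positions up to [i]. *)
Definition agree_upto (i : nat) s f :=
  forall t (l : 'I_n), (l <= i)%N -> eps t l != eps s l \/ col t l != col s l -> f t = 0.

Lemma hecke_op_agree (i : nat) (j : 'I_n.-1) s f : (i < j)%N -> agree_upto i s f -> agree_upto i s (hecke_op j f).
Proof.
move=> ij fs t l li tl.
have ll : (l == lo j) = false by apply/negbTE; rewrite -val_eqE /= neq_ltn (leq_ltn_trans li ij).
have lh : (l == hi j) = false.
  by apply/negbTE; rewrite -val_eqE /= neq_ltn (leq_ltn_trans li) // ltnW.
have tau : tperm (lo j) (hi j) l = l by rewrite tpermD // eq_sym ?ll ?lh.
have f1 : f t = 0 by apply: (fs t l).
have f2 : f (swap j t) = 0 by apply: (fs _ l); rewrite // eps_swap col_swap tau.
have f3 : f (fflip j t) = 0 by apply: (fs _ l); rewrite // /fflip !eps_flip !col_flip ll lh !addbF.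
have f4 : f (swap j (fflip j t)) = 0.
  by apply: (fs _ l); rewrite // eps_swap col_swap tau /fflip !eps_flip !col_flip ll lh !addbF.
rewrite /hecke_op /swap_op f1 f2 f3 f4 !(mulr0, addr0, oppr0).
by case: (eps t (lo j)); case: (eps t (hi j)).
Qed.

(** The other terms of [hecke_op i f s] are values of [f] at states that differ
    from [s] at position [i], or have coefficient zero. *)
Lemma hecke_op_diag (i : 'I_n.-1) s f : agree_upto i s f -> hecke_op i f s = diag_entry i s * f s.
Proof.
move=> fs; have f3 : f (fflip i s) = 0.
  apply: (fs _ (lo i)) => //; left; rewrite fflip_eps eqxx addbT; by case: eps.
have f4 : f (swap i (fflip i s)) = 0.
  apply: (fs _ (lo i)) => //; left; rewrite eps_swap fflip_eps eqxx addbT; by case: eps.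
have f2 : swap_coef (col s (lo i)) (col s (hi i)) * f (swap i s) = 0.
  rewrite /swap_coef; case: eqP => [|ne]; first by rewrite mul0r.
  rewrite (fs _ (lo i)) ?mulr0 //; right; rewrite col_swap tpermL; apply/eqP => e.
  exact: ne.
rewrite /hecke_op /swap_op /diag_entry f2 f3 f4 !mulr0 !addr0.
by case: (eps s (lo i)); case: (eps s (hi i)); ring.
Qed.

(** A product of [T]'s with increasing indices has diagonal entries that are
    products: a position that has been passed is not changed any more. *)
Lemma word_op_diag (r : seq 'I_n.-1) s f : sorted (fun i j : 'I_n.-1 => (i < j)%N) r ->
  (forall i : nat, agree_upto i s f) ->
  word_op [seq inl i | i <- r] f s = (\prod_(i <- r) diag_entry i s) * f s.
Proof.
move=> + fs; elim: r => [|i r IH] rs /=; first by rewrite big_nil mul1r.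
rewrite big_cons -mulrA -IH; last exact: path_sorted rs.
apply: hecke_op_diag; have : all (fun j : 'I_n.-1 => (i < j)%N) r.
  by apply: order_path_min rs => a b c; exact: ltn_trans.
elim: r {IH rs} => [|j r IH] /=; first by move=> _; exact: fs.
by case/andP=> ij /IH h; exact: hecke_op_agree.
Qed.

End TensorOperators.

Lemma word_op_map n (S : finType) flip swap (eps : S -> 'I_n -> bool) col
    (R R' : comNzRingType) (h : {rmorphism R -> R'}) (v : R) w (f : S -> R) s :
  word_op flip swap eps col (h v) w (fun t => h (f t)) s =
  h (word_op flip swap eps col v w f s).
Proof.
have hSop i g t : swap_op swap col (h v) i (fun u => h (g u)) t = h (swap_op swap col v i g t).
  rewrite /swap_op rmorphD !rmorphM /keep_coef /swap_coef; congr (_ * _ + _ * _).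
    by case: ifP => _; [|case: ifP => _]; rewrite ?rmorphB ?rmorph1 ?rmorph0.
  by case: ifP => _; [|case: ifP => _]; rewrite ?rmorph1 ?rmorph0.
elim: w s => [//|[i|j] w IH] s /=.
  rewrite (_ : word_op _ _ _ _ _ w _ = fun t => h (word_op flip swap eps col v w f t)); last first.
    by apply/funext => t; exact: IH.
  rewrite /hecke_op !hSop; case: ifP => _; case: ifP => _;
    by rewrite ?(rmorphD, rmorphB, rmorphN, rmorphM, rmorph1).
by rewrite /clifford_op IH rmorphM /sgn rmorphXn rmorphN1.
Qed.

Lemma word_op_val n (S S' : finType) (iota : S -> S') flip swap (eps : S' -> 'I_n -> bool) col
    flip' swap' (R : comNzRingType) (v : R) w (f : S' -> R) s :
  (forall j s, iota (flip' j s) = flip j (iota s)) ->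
  (forall i s, iota (swap' i s) = swap i (iota s)) ->
  word_op flip' swap' (fun s => eps (iota s)) (fun s => col (iota s)) v w (fun s => f (iota s)) s =
  word_op flip swap eps col v w f (iota s).
Proof.
move=> hf hs; elim: w s => [//|[i|j] w IH] s /=.
  rewrite (_ : word_op flip' _ _ _ _ w _ = fun t => word_op flip swap eps col v w f (iota t)); last first.
    by apply/funext => t; exact: IH.
  by rewrite /hecke_op /swap_op /fflip !hs !hf.
by rewrite /clifford_op IH hf.
Qed.

(** * Commutation of the relation defects with Clifford generators *)

(** The defect of each Hecke relation is moved past the Clifford generators by
    the mixed relations. With [Tb = T - z], the inverse of [T] up to the
    factor [v], one has [T c_i = c_(i+1) T] and [Tb c_(i+1) = c_i Tb]; each
    defect is written with that mixture of [T] and [Tb] for which this applies. *)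
Section RelationDefects.
Variables (A : pzRingType) (z v : A).
Hypotheses (zC : forall x : A, z * x = x * z) (vC : forall x : A, v * x = x * v).

Lemma quad_defect_lo (T c c' : A) : T * c = c' * T -> (T - z) * c' = c * (T - z) ->
  (T * (T - z) - v) * c = c * (T * (T - z) - v).
Proof.
move=> h h'; rewrite mulrBl [RHS]mulrBr vC; congr (_ - _).
have TzC : T * (T - z) = (T - z) * T by rewrite mulrBr mulrBl zC.
by rewrite TzC -mulrA h mulrA h' mulrA.
Qed.

Lemma quad_defect_hi (T c c' : A) : T * c = c' * T -> (T - z) * c' = c * (T - z) ->
  (T * (T - z) - v) * c' = c' * (T * (T - z) - v).
Proof.
by move=> h h'; rewrite mulrBl [RHS]mulrBr vC -mulrA h' mulrA h mulrA.
Qed.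

Lemma far_defect_shift (T T' : A) : T * T' - T' * T = (T - z) * T' - T' * (T - z).
Proof. by rewrite mulrBl mulrBr zC opprB addrA subrK. Qed.

Lemma far_defect (T T' c c' : A) : T * c = c' * T -> T' * c = c * T' -> T' * c' = c' * T' ->
  (T * T' - T' * T) * c = c' * (T * T' - T' * T).
Proof.
by move=> h h1 h2; rewrite mulrBl [RHS]mulrBr -!mulrA h1 h !mulrA h h2.
Qed.

Section Braid.
Variables T1 T2 c1 c2 c3 : A.
Hypotheses (h11 : T1 * c1 = c2 * T1) (h12 : (T1 - z) * c2 = c1 * (T1 - z))
  (h13 : T1 * c3 = c3 * T1) (h21 : T2 * c1 = c1 * T2) (h22 : T2 * c2 = c3 * T2)
  (h23 : (T2 - z) * c3 = c2 * (T2 - z))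
  (q1 : T1 * (T1 - z) = v) (q2 : T2 * (T2 - z) = v).
Local Notation D := (T1 * T2 * T1 - T2 * T1 * T2).

Lemma braid_defect1 : D * c1 = c3 * D.
Proof.
rewrite [LHS]mulrBl [RHS]mulrBr; congr (_ - _).
  by rewrite -[LHS]mulrA h11 [LHS]mulrA -(mulrA T1 T2 c2) h22 (mulrA T1) h13 !mulrA.
by rewrite -[LHS]mulrA h21 [LHS]mulrA -(mulrA T2 T1 c1) h11 (mulrA T2) h22 !mulrA.
Qed.

Lemma braid_defect2 : D * c2 = c2 * D.
Proof.
have -> : D = T1 * T2 * (T1 - z) - (T2 - z) * T1 * T2.
  by rewrite mulrBr mulrBl -zC mulrBl mulrA opprB addrA subrK.
rewrite [LHS]mulrBl [RHS]mulrBr; congr (_ - _).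
  by rewrite -[LHS]mulrA h12 [LHS]mulrA -(mulrA T1 T2 c1) h21 (mulrA T1) h11 !mulrA.
by rewrite -[LHS]mulrA h22 [LHS]mulrA -(mulrA (T2 - z) T1 c3) h13 (mulrA (T2 - z)) h23 !mulrA.
Qed.

Lemma braid_defect3 : D * c3 = c1 * D.
Proof.
have q1' : (T1 - z) * T1 = v by rewrite -q1 mulrBr mulrBl zC.
have -> : D = (T1 - z) * (T2 - z) * T1 - T2 * (T1 - z) * (T2 - z).
  have -> : (T1 - z) * (T2 - z) * T1 = T1 * T2 * T1 - z * (T2 * T1) - z * v.
    by rewrite (mulrBr _ T2) [LHS]mulrBl -(zC (T1 - z)) -(mulrA z (T1 - z)) q1' !mulrBl !mulrA.
  have -> : T2 * (T1 - z) * (T2 - z) = T2 * T1 * T2 - z * (T2 * T1) - z * v.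
    by rewrite (mulrBr T2) [LHS]mulrBl -(zC T2) -(mulrA z T2) q2 (mulrBr (T2 * T1)) -(zC (T2 * T1)).
  rewrite -(addrA (T1 * T2 * T1)) -(addrA (T2 * T1 * T2)) (opprD (T2 * T1 * T2)).
  by rewrite addrACA subrr addr0.
rewrite [LHS]mulrBl [RHS]mulrBr; congr (_ - _).
  by rewrite -[LHS]mulrA h13 [LHS]mulrA -(mulrA (T1 - z) (T2 - z) c3) h23 (mulrA (T1 - z)) h12 !mulrA.
by rewrite -[LHS]mulrA h23 [LHS]mulrA -(mulrA T2 (T1 - z) c2) h12 (mulrA T2) h21 !mulrA.
Qed.

End Braid.
End RelationDefects.

(** * Induced modules on tensor space *)

Section FunctionMatrices.
Variables (k : fieldType) (S : finType).
Implicit Types (X Y : (S -> k) -> S -> k) (f g : S -> k).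

Definition funvec f : 'cV[k]_#|S| := \col_p f (enum_val p).

Definition pulse (t : S) : S -> k := fun s => (s == t)%:R.

Definition funmx X : 'M[k]_#|S| := \matrix_(p, q) X (pulse (enum_val q)) (enum_val p).

Definition linop X := forall a f g s, X (fun t => a * f t + g t) s = a * X f s + X g s.

Lemma linop_sum X (r : seq S) f s : linop X ->
  X (fun t => \sum_(u <- r) f u * pulse u t) s = \sum_(u <- r) f u * X (pulse u) s.
Proof.
move=> Xl; elim: r => [|u r IH].
  rewrite big_nil; set X0 := X _ s.
  have E : X0 = 1 * X0 + X0.
    rewrite /X0 -Xl; congr (X _ s); apply/funext=> t.
    by rewrite !big_nil mulr0 addr0.
  by apply: (addrI X0); rewrite addr0 {3}E mul1r.
rewrite big_cons -IH -Xl; congr (X _ s); apply/funext=> t.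
by rewrite big_cons.
Qed.

Lemma pulse_sum f s : f s = \sum_u f u * pulse u s.
Proof.
rewrite (bigD1 s) //= /pulse eqxx mulr1 big1 ?addr0 // => u /negPf us.
by rewrite eq_sym us mulr0.
Qed.

Lemma funmxE X f : linop X -> funmx X *m funvec f = funvec (X f).
Proof.
move=> Xl; apply/colP => p; rewrite !mxE.
have -> : f = fun t => \sum_u f u * pulse u t by apply/funext=> t; exact: pulse_sum.
rewrite linop_sum // [RHS](reindex enum_val (onW_bij _ (@enum_val_bij S))).
by apply: eq_bigr => q _; rewrite !mxE -pulse_sum mulrC.
Qed.

Lemma funvec_surj u : exists f, u = funvec f.
Proof.
by exists (fun s => u (enum_rank s) 0); apply/colP => p; rewrite mxE enum_valK.
Qed.

Lemma funmx_ext (A B : 'M[k]_#|S|) : (forall f, A *m funvec f = B *m funvec f) -> A = B.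
Proof. by move=> AB; apply: mulmx_colP => u; have [f ->] := funvec_surj u. Qed.

Lemma funvecD f g : funvec f + funvec g = funvec (fun s => f s + g s).
Proof. by apply/colP=> p; rewrite !mxE. Qed.

Lemma funvecN f : - funvec f = funvec (fun s => - f s).
Proof. by apply/colP=> p; rewrite !mxE. Qed.

Lemma funvecZ a f : a *: funvec f = funvec (fun s => a * f s).
Proof. by apply/colP=> p; rewrite !mxE. Qed.

Lemma funvec_eq f g : f =1 g -> funvec f = funvec g.
Proof. by move=> fg; apply/colP=> p; rewrite !mxE. Qed.

Lemma funvec0 f : (forall s, f s = 0) -> funvec f = 0.
Proof. by move=> f0; apply/colP=> p; rewrite !mxE. Qed.

Lemma funmx_trace X : \tr (funmx X) = \sum_s X (pulse s) s.
Proof.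
rewrite /mxtrace [RHS](reindex enum_val (onW_bij _ (@enum_val_bij S))).
by apply: eq_bigr => q _; rewrite mxE.
Qed.

End FunctionMatrices.

Section TensorModule.
Variables (n : nat) (S : finType).
Variables (flip : 'I_n -> S -> S) (swap : 'I_n.-1 -> S -> S).
Variables (eps : S -> 'I_n -> bool) (col : S -> 'I_n -> nat).
Hypotheses
  (eps_flip : forall j s l, eps (flip j s) l = eps s l (+) (l == j))
  (col_flip : forall j s l, col (flip j s) l = col s l)
  (eps_swap : forall i s l, eps (swap i s) l = eps s l)
  (col_swap : forall i s l, col (swap i s) l = col s (tperm (lo i) (hi i) l))
  (ext : forall s t, (forall l, eps s l = eps t l) -> (forall l, col s l = col t l) -> s = t).
Variables (k : fieldType) (v : k).
Hypothesis two_neq0 : (2 : k) != 0.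

Local Notation cop := (@clifford_op n S flip eps k).
Local Notation Sop := (@swap_op n S swap col k v).
Local Notation Top := (@hecke_op n S flip swap eps col k v).
Local Notation par := (@parity_op n S eps k).
Local Notation z := (v - 1).
Local Notation d := #|S|.

Lemma cop_lin j : linop (cop j).
Proof. by move=> a f g s; rewrite /clifford_op; ring. Qed.

Lemma Sop_lin i : linop (Sop i).
Proof. by move=> a f g s; rewrite /swap_op; ring. Qed.

Lemma Top_lin i : linop (Top i).
Proof.
move=> a f g s; rewrite /hecke_op !Sop_lin.
by case: (eps s (lo i)); case: (eps s (hi i)); ring.
Qed.

Lemma par_lin : linop par.
Proof. by move=> a f g s; rewrite /parity_op; ring. Qed.

Let T i := funmx (Top i).
Let C j := funmx (cop j).

Let TE i f : T i *m funvec f = funvec (Top i f) := funmxE f (@Top_lin i).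
Let CE j f : C j *m funvec f = funvec (cop j f) := funmxE f (@cop_lin j).

Lemma C_sq j : C j *m C j = 1%:M.
Proof.
apply: funmx_ext => f; rewrite -mulmxA !CE mul1mx; apply: funvec_eq => s.
exact: (clifford_op_sq eps_flip col_flip ext).
Qed.

Lemma C_anti i j : i != j -> C i *m C j = - (C j *m C i).
Proof.
move=> ij; apply: funmx_ext => f; rewrite mulNmx -!mulmxA !CE funvecN.
by apply: funvec_eq => s; exact: (clifford_op_anti eps_flip col_flip ext).
Qed.

Lemma TC_lo i : T i *m C (lo i) = C (hi i) *m T i.
Proof.
apply: funmx_ext => f; rewrite -!mulmxA !CE !TE !CE; apply: funvec_eq => s.
exact: (hecke_op_clifford_lo eps_flip col_flip eps_swap col_swap ext).
Qed.

Lemma TC_hi i : (T i - z%:M) *m C (hi i) = C (lo i) *m (T i - z%:M).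
Proof.
apply: funmx_ext => f; rewrite mulmxBl mulmxBr mul_scalar_mx mul_mx_scalar.
rewrite !mulmxBl -!scalemxAl -!mulmxA !CE !TE !CE !funvecZ !funvecN !funvecD.
by apply: funvec_eq => s; exact: (hecke_op_clifford_hi eps_flip col_flip eps_swap col_swap ext).
Qed.

Lemma TC_far i j : j != lo i -> j != hi i -> T i *m C j = C j *m T i.
Proof.
move=> jl jh; apply: funmx_ext => f; rewrite -!mulmxA !CE !TE !CE; apply: funvec_eq => s.
exact: (hecke_op_clifford_far eps_flip col_flip eps_swap col_swap ext).
Qed.

Definition even_supp (f : S -> k) := forall s l, eps s l -> f s = 0.

(** The module is generated over the Clifford algebra by the vectors supported on
    the basis elements without odd positions. *)
Lemma vacuum_generates (D : 'M[k]_d) :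
  (forall j u, D *m u = 0 :> 'cV_d -> D *m (C j *m u) = 0) ->
  (forall f, even_supp f -> D *m funvec f = 0) -> D = 0.
Proof.
move=> DC Dv.
have D0 s : D *m funvec (pulse k s) = 0.
  have [c] := ubnP (\sum_l eps s l)%N; elim: c s => // c IH s; rewrite ltnS => sc.
  have [[j sj]|none] := pselect (exists j, eps s j); last first.
    apply: Dv => t l tl; rewrite /pulse; case: eqP => // ts.
    by case: none; exists l; rewrite -ts.
  have -> : funvec (pulse k s) =
      @sgn n S eps k j s *: (C j *m funvec (pulse k (flip j s))).
    rewrite CE funvecZ; apply: funvec_eq => t; rewrite /clifford_op /pulse.
    rewrite (can_eq (flipK eps_flip col_flip ext j)); case: eqP => [->|_]; last by rewrite !mulr0.
    by rewrite mulr1 sgn_sq.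
  rewrite -scalemxAr DC ?scaler0 //; apply: IH; apply: leq_trans sc.
  rewrite (bigD1 j) //= [X in (_ < X)%N](bigD1 j) //= eps_flip eqxx sj /= add0n add1n ltnS.
  apply: leq_sum => l lj; by rewrite eps_flip (negPf lj) addbF.
apply: funmx_ext => f; rewrite mul0mx.
have -> : funvec f = \sum_s f s *: funvec (pulse k s).
  by apply/colP=> p; rewrite summxE mxE pulse_sum; apply: eq_bigr => s _; rewrite !mxE.
by rewrite mulmx_sumr big1 // => s _; rewrite -scalemxAr D0 scaler0.
Qed.

Lemma Sop_even i f : even_supp f -> even_supp (Sop i f).
Proof.
move=> fe s l sl; rewrite /swap_op (fe _ _ sl) (fe (swap i s) l) ?eps_swap //.
by rewrite !mulr0 addr0.
Qed.

Lemma Top_even i f : even_supp f -> Top i f =1 Sop i f.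
Proof.
move=> fe s; rewrite /hecke_op; have Se := Sop_even i fe.
have feps := fflip_eps eps_flip i s.
case lE: (eps s (lo i)).
  case hE: (eps s (hi i)); first by rewrite (Se _ _ lE) (fe _ _ lE) oppr0 mulr0 addr0.
  have h : eps (fflip flip i s) (hi i) by rewrite feps hE eqxx orbT.
  by rewrite (Se _ _ h) (fe _ _ h) (Se _ _ lE) mulr0 subr0.
case hE: (eps s (hi i)).
  have h : eps (fflip flip i s) (lo i) by rewrite feps lE eqxx.
  by rewrite (Se _ _ h) (fe _ _ hE) (Se _ _ hE) mulr0 addr0.
have h : eps (fflip flip i s) (lo i) by rewrite feps lE eqxx.
by rewrite (fe _ _ h) mulr0 addr0.
Qed.

Lemma TE_even i f : even_supp f -> T i *m funvec f = funvec (Sop i f).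
Proof. by move=> fe; rewrite TE; apply: funvec_eq; exact: Top_even. Qed.

Lemma scalarC (a : k) (A : 'M[k]_d) : a%:M * A = A * a%:M.
Proof. by rewrite -[LHS]/(_ *m _) -[RHS]/(_ *m _) mul_scalar_mx mul_mx_scalar. Qed.

(** The defect of a relation moves past the Clifford generators, so the relation
    only has to be checked where [T_i] acts by [swap_op]. *)
Lemma vacuum_relation (D : 'M[k]_d) :
  (forall j, exists j', D * C j = C j' * D) ->
  (forall f, even_supp f -> D *m funvec f = 0) -> D = 0.
Proof.
move=> DC; apply: vacuum_generates => j u Du; have [j' e] := DC j.
by rewrite mulmxA [D *m C j]e -[_ * D *m u]mulmxA Du mulmx0.
Qed.

(** The quadratic relation in the form [T (T - z) = v]. *)
Lemma T_shift i : T i * (T i - z%:M) - v%:M = 0.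
Proof.
apply: vacuum_relation => [j|f fe].
  have [->|jl] := eqVneq j (lo i).
    by exists (lo i); apply: quad_defect_lo (TC_lo i) (TC_hi i); exact: scalarC.
  have [->|jh] := eqVneq j (hi i).
    by exists (hi i); apply: quad_defect_hi (TC_lo i) (TC_hi i); exact: scalarC.
  exists j; have TC := TC_far jl jh; have {}TC : T i * C j = C j * T i := TC.
  rewrite mulrBl [RHS]mulrBr scalarC; congr (_ - _).
  by rewrite mulrA -TC -!mulrA; congr (_ * _); rewrite mulrBl [RHS]mulrBr scalarC TC.
rewrite mulmxBl -[_ * _ *m _]mulmxA mulmxBl TE_even // !mul_scalar_mx mulmxBr -scalemxAr.
rewrite !TE_even //; last exact: Sop_even.
rewrite !funvecZ !funvecN !funvecD; apply: funvec0 => s.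
by rewrite (swap_op_quad eps_swap col_swap ext); ring.
Qed.

Lemma T_quad i : (T i - v%:M) *m (T i + 1%:M) = 0.
Proof.
rewrite -[RHS](T_shift i) mulmxBl !mulmxDr !mulmx1 opprD addrA [X in _ = X - _]mulrBr.
rewrite -[T i * T i]/(T i *m T i) -[T i * z%:M]/(T i *m z%:M) mul_mx_scalar mul_scalar_mx.
rewrite scalerBl scale1r opprB; congr (_ - _).
by rewrite addrA.
Qed.

Lemma T_far (i j : 'I_n.-1) : (i.+1 < j)%N -> T i *m T j = T j *m T i.
Proof.
move=> ij; apply/eqP; rewrite -subr_eq0; apply/eqP.
have farij : T i *m C (lo j) = C (lo j) *m T i /\ T i *m C (hi j) = C (hi j) *m T i.
  by split; apply: TC_far; apply: ord_neq => /=; lia.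
have farji : T j *m C (lo i) = C (lo i) *m T j /\ T j *m C (hi i) = C (hi i) *m T j.
  by split; apply: TC_far; apply: ord_neq => /=; lia.
have [il ih] := farij; have [jl jh] := farji.
apply: vacuum_relation => [a|f fe]; last first.
  rewrite mulmxBl -!mulmxA !TE_even // ?TE_even //; try exact: Sop_even.
  rewrite funvecN funvecD; apply: funvec0 => s.
  by rewrite (swap_op_far _ _ ext) // subrr.
have [->|al] := eqVneq a (lo i).
  by exists (hi i); apply: far_defect; [exact: TC_lo|exact: jl|exact: jh].
have [->|ah] := eqVneq a (hi i).
  exists (lo i); rewrite (far_defect_shift (scalarC z)).
  by apply: far_defect; [exact: TC_hi|exact: jh|exact: jl].
have [->|bl] := eqVneq a (lo j).
  exists (hi j); rewrite -opprB mulNr mulrN; congr (- _).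
  by apply: far_defect; [exact: TC_lo|exact: il|exact: ih].
have [->|bh] := eqVneq a (hi j).
  exists (lo j); rewrite -opprB mulNr mulrN (far_defect_shift (scalarC z)); congr (- _).
  by apply: far_defect; [exact: TC_hi|exact: ih|exact: il].
by exists a; apply: far_defect; exact: TC_far.
Qed.

Lemma T_braid (i j : 'I_n.-1) : j = i.+1 :> nat -> T i *m T j *m T i = T j *m T i *m T j.
Proof.
move=> ij; apply/eqP; rewrite -subr_eq0; apply/eqP.
have hij : lo j = hi i by apply/val_inj; rewrite /= ij.
have h13 : T i *m C (hi j) = C (hi j) *m T i by apply: TC_far; apply: ord_neq => /=; lia.
have h21 : T j *m C (lo i) = C (lo i) *m T j by apply: TC_far; apply: ord_neq => /=; lia.
have h22 : T j *m C (hi i) = C (hi j) *m T j by rewrite -hij TC_lo.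
have h23 : (T j - z%:M) *m C (hi j) = C (hi i) *m (T j - z%:M) by rewrite -hij TC_hi.
have q a : T a * (T a - z%:M) = v%:M by apply/eqP; rewrite -subr_eq0; apply/eqP/T_shift.
apply: vacuum_relation => [a|f fe]; last first.
  rewrite mulmxBl -!mulmxA; do !(rewrite TE_even; last by do ?apply: Sop_even).
  rewrite funvecN funvecD; apply: funvec0 => s.
  by rewrite (swap_op_braid eps_swap col_swap ext) // subrr.
have [->|a1] := eqVneq a (lo i).
  by exists (hi j); exact: (braid_defect1 (TC_lo i) h13 h21 h22).
have [->|a2] := eqVneq a (hi i).
  by exists (hi i); exact: (braid_defect2 (scalarC z) (TC_lo i) (TC_hi i) h13 h21 h22 h23).
have [->|a3] := eqVneq a (hi j).
  by exists (lo i); exact: (braid_defect3 (scalarC z) (TC_hi i) h13 h21 h23 (q i) (q j)).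
have hi' : T i * C a = C a * T i := TC_far a1 a2.
have hj' : T j * C a = C a * T j by apply: TC_far; rewrite ?hij.
exists a; rewrite mulrBl [RHS]mulrBr; congr (_ - _).
  by rewrite -!mulrA hi' (mulrA (T j)) hj' !mulrA hi'.
by rewrite -!mulrA hj' (mulrA (T i)) hi' !mulrA hj'.
Qed.

Lemma T_C (i : 'I_n.-1) (j j' : 'I_n) : j = i :> nat -> j' = i.+1 :> nat ->
  T i *m C j = C j' *m T i.
Proof.
move=> ji ji'; have -> : j = lo i by apply/val_inj.
have -> : j' = hi i by apply/val_inj.
exact: TC_lo.
Qed.

Lemma T_Cfar (i : 'I_n.-1) (j : 'I_n) : j <> i :> nat -> j <> i.+1 :> nat ->
  T i *m C j = C j *m T i.
Proof. by move=> h1 h2; apply: TC_far; apply/eqP => e; [apply: h1|apply: h2]; rewrite e. Qed.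

Let Par := funmx par.
Let PE f : Par *m funvec f = funvec (par f) := funmxE f par_lin.

Lemma Par_sq : Par *m Par = 1%:M.
Proof.
apply: funmx_ext => f; rewrite -mulmxA !PE mul1mx; apply: funvec_eq => s.
exact: parity_op_sq.
Qed.

Lemma Par_T i : Par *m T i = T i *m Par.
Proof.
apply: funmx_ext => f; rewrite -!mulmxA !(PE, TE) ?PE ?TE; apply: funvec_eq => s.
by apply: parity_op_hecke.
Qed.

Lemma Par_C j : Par *m C j = - (C j *m Par).
Proof.
apply: funmx_ext => f; rewrite mulNmx -!mulmxA CE !PE CE funvecN; apply: funvec_eq => s.
exact: (parity_op_clifford eps_flip).
Qed.

Definition tensor_sm : supermodule n v :=
  gens_sm two_neq0 T_quad T_far T_braid C_sq C_anti T_Cfar T_C Par_sq Par_T Par_C.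

Local Notation word_op := (@word_op n S flip swap eps col k v).

Lemma tensor_char w : smchar tensor_sm (hc_word w) = \sum_s word_op w (pulse k s) s.
Proof.
rewrite /smchar gens_sm_word -funmx_trace; congr (\tr _); apply: funmx_ext => f.
have wl w' : linop (word_op w').
  elim: w' => [//|[i|j] w' IH] a g h s /=.
    by rewrite -Top_lin; congr (hecke_op _ _ _ _ _ _ _ s); apply/funext => t; exact: IH.
  by rewrite -cop_lin; congr (clifford_op _ _ _ _ s); apply/funext => t; exact: IH.
rewrite funmxE //; elim: w => [|[i|j] w IH] /=; first by rewrite mul1mx.
  by rewrite -mulmxA IH TE.
by rewrite -mulmxA IH CE.
Qed.

End TensorModule.

(** * Sums over chains of states *)

Section Sequences.
Variables (St : finType) (A : comNzRingType).

Fixpoint words (r : nat) : seq (seq St) :=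
  if r is r'.+1 then [seq a :: s | a <- enum St, s <- words r'] else [:: [::]].

Lemma mem_words r s : (s \in words r) = (size s == r).
Proof.
elim: r s => [|r IH] s; first by rewrite inE; case: s.
apply/allpairsP/eqP => [[[a t] /= [_ + ->]]|]; first by rewrite IH /= => /eqP->.
case: s => // a s [sr]; exists (a, s); rewrite mem_enum IH sr eqxx; split=> //.
Qed.

Lemma words_uniq r : uniq (words r).
Proof.
elim: r => //= r IH; apply: allpairs_uniq => //; first exact: enum_uniq.
by move=> [a s] [b t] _ _ /= [-> ->].
Qed.

Definition statelist n (b : {ffun 'I_n -> St}) : seq St := [seq b i | i <- enum 'I_n].

Lemma nth_statelist n (b : {ffun 'I_n -> St}) x0 (i : 'I_n) : nth x0 (statelist b) i = b i.
Proof. by rewrite (nth_map i) ?size_enum_ord // nth_ord_enum. Qed.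

Lemma size_statelist n (b : {ffun 'I_n -> St}) : size (statelist b) = n.
Proof. by rewrite size_map size_enum_ord. Qed.

Lemma big_words n (F : seq St -> A) :
  \sum_(b : {ffun 'I_n -> St}) F (statelist b) = \sum_(s <- words n) F s.
Proof.
rewrite -(big_map (@statelist n) predT F) /=.
apply: perm_big; apply: uniq_perm; rewrite ?words_uniq //.
  rewrite map_inj_uniq ?index_enum_uniq // => b c bc; apply/ffunP => i.
  by rewrite -(nth_statelist b (b i)) -(nth_statelist c (b i)) bc.
move=> s; rewrite mem_words; apply/mapP/eqP => [[b _ ->]|sn]; first exact: size_statelist.
case: s sn => [|x0 s] sn.
  have e (i : 'I_n) : St by have := ltn_ord i; rewrite -{2}sn.
  exists [ffun i => e i]; first by rewrite mem_index_enum.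
  by apply/esym/size0nil; rewrite size_statelist -sn.
exists [ffun i : 'I_n => nth x0 (x0 :: s) i]; first by rewrite mem_index_enum.
apply: (@eq_from_nth _ x0); first by rewrite size_statelist.
move=> i; rewrite sn => i_n.
by rewrite (nth_statelist _ x0 (Ordinal i_n)) ffunE.
Qed.

Lemma sum_words_cat p q (F G : seq St -> A) :
  \sum_(s <- words (p + q)) F (take p s) * G (drop p s) =
  (\sum_(s <- words p) F s) * \sum_(s <- words q) G s.
Proof.
elim: p F => [|p IH] F.
  rewrite big_seq1 mulr_sumr; apply: eq_bigr => s _; by rewrite take0 drop0.
rewrite !big_allpairs_dep /= mulr_suml; apply: eq_bigr => a _ /=.
exact: (IH (fun s => F (a :: s))).
Qed.

End Sequences.

(** The trace of [T_1 .. T_(r-1)], weighted by monomials, is a weighted count of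
    chains of states. *)
Section Chains.
Variables (m : nat) (A : comNzRingType) (v : A) (x : 'I_m -> A).
Local Notation z := (v - 1).
Local Notation state := (bool * 'I_m)%type.

(** The diagonal entry of a generator [T_i], as a function of the states at the
    positions [i] and [i+1]. *)
Definition link (a b : state) : A :=
  let c := keep_coef v a.2 b.2 in
  if a.1 then if b.1 then z - c else 0 else if b.1 then z else c.

Fixpoint chain (a : state) (s : seq state) : A :=
  if s is b :: s' then link a b * chain b s' else 1.

Definition chain_weight (s : seq state) : A :=
  (\prod_(a <- s) x a.2) * (if s is a :: s' then chain a s' else 1).

Definition chain_from (r : nat) (a : state) : A :=
  \sum_(s <- words ((bool * 'I_m)%type : finType) r) chain_weight (a :: s).

Definition chain_sum (r : nat) : A := \sum_(s <- words ((bool * 'I_m)%type : finType) r) chain_weight s.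

Lemma chain_fromS r a :
  chain_from r.+1 a = x a.2 * \sum_b link a b * chain_from r b.
Proof.
rewrite /chain_from big_allpairs_dep /= big_enum mulr_sumr; apply: eq_bigr => b _.
rewrite mulr_sumr mulr_sumr; apply: eq_bigr => s _.
by rewrite /chain_weight big_cons /=; ring.
Qed.

Lemma chain_from0 a : chain_from 0 a = x a.2.
Proof. by rewrite /chain_from big_seq1 /chain_weight big_seq1 /= mulr1. Qed.

Lemma chain_sumS r : chain_sum r.+1 = \sum_a chain_from r a.
Proof. by rewrite /chain_sum big_allpairs_dep /= big_enum. Qed.

Lemma sum_states (F : state -> A) : \sum_a F a = \sum_i F (true, i) + \sum_i F (false, i).
Proof.
rewrite (eq_bigr (fun a : state => F (a.1, a.2))) => [|[]//].
by rewrite -(pair_bigA _ (fun e i => F (e, i))) /= big_bool.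
Qed.

(** An odd state is followed by odd states only, of larger or equal colour. *)
Lemma chain_from_odd r i : chain_from r.+1 (true, i) =
  x i * (z * \sum_(j < m | (i < j)%N) chain_from r (true, j) - chain_from r (true, i)).
Proof.
rewrite chain_fromS sum_states /= [X in _ + X]big1 ?addr0 => [|j _]; last by rewrite mul0r.
congr (_ * _); rewrite (bigD1 i) //= [z * _]mulr_sumr addrC; congr (_ + _); last first.
  by rewrite /link /= /keep_coef eqxx; ring.
rewrite [RHS]big_mkcond [LHS]big_mkcond; apply: eq_bigr => j _.
rewrite /link /= /keep_coef val_eqE eq_sym; case: eqP => [->|ne]; first by rewrite ltnn.
case: ltngtP => [||/val_inj e]; last by case: ne.
- by move=> _; rewrite subrr mul0r.
- by rewrite subr0.
Qed.

(** An even state is followed by an even state of smaller or equal colour, or by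
    any odd state. *)
Lemma chain_from_even r i : chain_from r.+1 (false, i) =
  x i * (v * chain_from r (false, i) + z * \sum_(j < m | (j < i)%N) chain_from r (false, j)
    + z * \sum_j chain_from r (true, j)).
Proof.
rewrite chain_fromS sum_states /= addrC; congr (_ * (_ + _)); last first.
  by rewrite [RHS]mulr_sumr.
rewrite (bigD1 i) //= /link /= /keep_coef eqxx; congr (_ + _); rewrite [RHS]mulr_sumr.
rewrite [RHS]big_mkcond [LHS]big_mkcond; apply: eq_bigr => j _.
rewrite val_eqE eq_sym; case: eqP => [->|ne]; first by rewrite ltnn.
case: ltngtP => [||/val_inj e]; last by case: ne.
- by [].
- by rewrite mul0r.
Qed.

(** At [v = 1] only constant chains survive; an odd constant chain of length [r]
    counts with the sign [(-1) ^ (r - 1)]. *)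
Lemma chain_sum_v1 r : v = 1 -> odd r -> chain_sum r = (\sum_i x i ^+ r) *+ 2.
Proof.
move=> v1; case: r => // r odd_r; rewrite chain_sumS sum_states mulr2n.
have z0 : z = 0 by rewrite v1 subrr.
congr (_ + _); apply: eq_bigr => i _; last first.
  elim: r {odd_r} => [|r IH]; first by rewrite chain_from0.
  by rewrite chain_from_even IH z0 v1 !mul0r mul1r !addr0 -exprS.
have -> : chain_from r (true, i) = (-1) ^+ r * x i ^+ r.+1.
  elim: r {odd_r} => [|r IH]; first by rewrite chain_from0 mul1r.
  by rewrite chain_from_odd IH z0 mul0r sub0r !exprS; ring.
by move: odd_r => /= /negPf odd_r; rewrite -signr_odd odd_r mul1r.
Qed.

End Chains.

Section ChainSeries.
Variables (m : nat) (A : comNzRingType) (v : A) (x : 'I_m -> A).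
Local Notation z := (v - 1).

Let u (i : 'I_m) : nat -> A := ps_mul (ps_lin (v * x i)) (ps_geom (- x i)).
Let w (i : 'I_m) : nat -> A := ps_mul (ps_lin (- x i)) (ps_geom (v * x i)).

(* The chains that start at odd states of colour at least [j] are counted by
   [G j]; those that start at an odd state or at an even state of colour less
   than [j] are counted by [Hs j]. *)
Let G (j : nat) : nat -> A := \big[@ps_mul A/@ps_one A]_(b < m | (j <= b)%N) u b.
Let Hs (j : nat) : nat -> A :=
  ps_mul (\big[@ps_mul A/@ps_one A]_(b < m | (b < j)%N) w b) (G 0).

Lemma ps_lin_geomS (a b : A) (f g : nat -> A) r :
  f = ps_mul (ps_mul (ps_lin a) (ps_geom b)) g ->
  f r.+1 = b * f r + g r.+1 + a * g r.
Proof.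
move=> fE; have h : ps_mul (ps_lin (- b)) f = ps_mul (ps_lin a) g.
  rewrite fE (ps_mulC (ps_lin a)) !ps_mulA ps_lin_geom ps_mul1 //.
have := congr1 (fun h => h r.+1) h; rewrite /= !ps_linS => /eqP.
by rewrite mulNr subr_eq => /eqP ->; ring.
Qed.

Lemma Gstep (i : 'I_m) : G i = ps_mul (u i) (G i.+1).
Proof.
rewrite /G (bigD1 i) //=; congr (ps_mul _ _); apply: eq_bigl => b.
by rewrite andbC -val_eqE /= eq_sym -ltn_neqAle.
Qed.

Lemma Hstep (i : 'I_m) : Hs i.+1 = ps_mul (w i) (Hs i).
Proof.
rewrite /Hs [in RHS]ps_mulA (bigD1 i) //=; congr (ps_mul (ps_mul _ _) _).
by apply: eq_bigl => b; rewrite ltnS andbC -val_eqE /= -ltn_neqAle.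
Qed.

Lemma G0 j : G j 0 = 1.
Proof.
rewrite /G; elim/big_rec: _ => // i p _ IH.
by rewrite /ps_mul big_ord1 /= IH /u ps_lin0 !mulr1.
Qed.

Lemma Hs0 j : Hs j 0 = 1.
Proof.
rewrite /Hs /ps_mul big_ord1 /= G0 mulr1; elim/big_rec: _ => // i p _ IH.
by rewrite /ps_mul big_ord1 /= IH /w ps_lin0 !mulr1.
Qed.

Lemma Gm : G m = @ps_one A.
Proof. by rewrite /G big_pred0 // => i; rewrite leqNgt ltn_ord. Qed.

Lemma Gsum (j : nat) r : (j <= m)%N ->
  \sum_(b < m | (j <= b)%N) (G b r - G b.+1 r) = G j r - G m r.
Proof.
move=> jm; rewrite -(big_geq_mkord _ _ predT (fun b => G b r - G b.+1 r)) /=.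
rewrite -[RHS]opprB -(telescope_sumr (fun b => G b r) jm) -sumrN.
by apply: eq_bigr => b _; rewrite opprB.
Qed.

Lemma Hsum (j : nat) r : (j <= m)%N ->
  \sum_(b < m | (b < j)%N) (Hs b.+1 r - Hs b r) = Hs j r - Hs 0 r.
Proof.
move=> jm; rewrite -(telescope_sumr (fun b => Hs b r) (leq0n j)) big_mkord.
by rewrite (big_ord_widen m (fun b => Hs b.+1 r - Hs b r)).
Qed.

(** Both sides satisfy the same recursion: [G i] is [G i.+1] times one factor
    [(1 + v x_i t) / (1 + x_i t)], and [chain_from_odd] telescopes. *)
Lemma chain_odd_gf r i : z * chain_from v x r (true, i) = G i r.+1 - G i.+1 r.+1.
Proof.
elim: r i => [|r IH] i.
  by rewrite chain_from0 (ps_lin_geomS 0 (Gstep i)) !G0; ring.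
rewrite chain_from_odd (ps_lin_geomS r.+1 (Gstep i)).
have -> : z * (x i * (z * (\sum_(j < m | (i < j)%N) chain_from v x r (true, j)) -
    chain_from v x r (true, i))) =
   x i * (z * (\sum_(j < m | (i < j)%N) z * chain_from v x r (true, j))
      - z * chain_from v x r (true, i)) by rewrite -mulr_sumr; ring.
under eq_bigr => j _ do rewrite IH.
by rewrite Gsum // Gm IH /ps_one /=; ring.
Qed.

Lemma chain_even_gf r i : z * chain_from v x r (false, i) = Hs i.+1 r.+1 - Hs i r.+1.
Proof.
elim: r i => [|r IH] i.
  by rewrite chain_from0 (ps_lin_geomS 0 (Hstep i)) !Hs0; ring.
rewrite chain_from_even (ps_lin_geomS r.+1 (Hstep i)).
have -> : z * (x i * (v * chain_from v x r (false, i)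
     + z * (\sum_(j < m | (j < i)%N) chain_from v x r (false, j))
     + z * (\sum_j chain_from v x r (true, j)))) =
   x i * (v * (z * chain_from v x r (false, i))
     + z * (\sum_(j < m | (j < i)%N) z * chain_from v x r (false, j))
     + z * (\sum_(j < m | (0 <= j)%N) z * chain_from v x r (true, j))).
  by rewrite -!mulr_sumr; ring.
under eq_bigr => j _ do rewrite IH.
under [X in _ + _ * X]eq_bigr => j _ do rewrite chain_odd_gf.
have H0E : Hs 0 = G 0 by rewrite /Hs big_pred0 ?ps_mul1.
by rewrite Hsum ?Gsum // 1?ltnW // Gm IH H0E /ps_one /=; ring.
Qed.

(** Summing [chain_odd_gf] and [chain_even_gf] over all states telescopes to
    [Hs m], which is the full product. *)
Lemma chain_sum_gf r : (0 < r)%N -> z * chain_sum v x r =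
  (\big[@ps_mul A/@ps_one A]_(i < m)
     ps_mul (ps_mul (ps_lin (- x i)) (ps_geom (- x i)))
            (ps_mul (ps_lin (v * x i)) (ps_geom (v * x i)))) r.
Proof.
case: r => // r _; rewrite chain_sumS sum_states mulrDr !mulr_sumr.
rewrite (eq_bigr _ (fun i _ => chain_odd_gf r i)) (eq_bigr _ (fun i _ => chain_even_gf r i)).
have -> : \sum_(i < m) (Hs i.+1 r.+1 - Hs i r.+1) = Hs m r.+1 - Hs 0 r.+1.
  by rewrite -(Hsum _ (leqnn m)); apply: eq_bigl => i; rewrite ltn_ord.
rewrite (@Gsum 0 r.+1 (leq0n m)).
have H0E : Hs 0 = G 0 by rewrite /Hs big_pred0 ?ps_mul1.
rewrite H0E Gm /ps_one subr0 addrC subrK /Hs.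
rewrite (eq_bigl predT) => [|i]; last by rewrite ltn_ord.
rewrite /G -big_split /=; congr (_ r.+1); apply: eq_bigr => i _.
rewrite /u /w (ps_mulC (ps_lin (v * x i))) Monoid.mulmACA /=.
by rewrite (ps_mulC (ps_geom (v * x i))).
Qed.

End ChainSeries.

(** [p] is the number of positions before the first block. *)
Fixpoint block_indices (p : nat) (mu : seq nat) : seq nat :=
  if mu is r :: mu' then iota p r.-1 ++ block_indices (p + r) mu' else [::].

Lemma block_indices_bound p mu : all (leq 1) mu ->
  all (fun i => (p <= i)%N && (i.+1 < p + sumn mu)%N) (block_indices p mu).
Proof.
elim: mu p => //= r mu IH p /andP[r0 mu0]; rewrite all_cat; apply/andP; split.
  apply/allP => i; rewrite mem_iota; lia.
by apply/allP => i /(allP (IH (p + r)%N mu0)); lia.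
Qed.

Lemma block_indices_sorted p mu : all (leq 1) mu -> sorted ltn (block_indices p mu).
Proof.
elim: mu p => //= r mu IH p /andP[r0 mu0].
rewrite (sorted_pairwise ltn_trans) pairwise_cat -!(sorted_pairwise ltn_trans) iota_ltn_sorted IH // !andbT.
apply/allrelP => i j; rewrite mem_iota => /andP[_ ib] /(allP (block_indices_bound (p + r) mu0)).
by case/andP=> jb _; rewrite /=; lia.
Qed.

Lemma hc_Tw_word n (k : fieldType) (v : k) (mu : seq nat) :
  hc_Tw mu = hc_word [seq inl i | i <- pmap insub (block_indices 0 mu)] :> hecke_clifford n v.
Proof.
rewrite /hc_word big_map /hc_Tw.
suff h p : \prod_(j < size mu)
    \prod_(i <- pmap insub (iota (p + sumn (take j mu)) (nth 0%N mu j).-1)) hcT i =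
    \prod_(i <- pmap insub (block_indices p mu)) hcT i :> hecke_clifford n v.
  by rewrite -h.
elim: mu p => [|r mu IH] p; first by rewrite big_ord0 big_nil.
rewrite big_ord_recl /= addn0 pmap_cat big_cat -IH; congr (_ * _).
by apply: eq_bigr => j _; rewrite ?lift0 /= addnA.
Qed.

(** * Weight modules *)

Section BlockProducts.
Variables (m : nat) (A : comNzRingType) (v : A) (x : 'I_m -> A).
Local Notation state := (bool * 'I_m)%type.

Definition chain_start (s : seq state) : A := if s is a :: s' then chain v a s' else 1.

(** The chains of the blocks of [mu] are independent of each other, since the
    generator that joins two blocks is missing from [T_(w_mu)]. *)
Fixpoint block_chain (mu : seq nat) (s : seq state) : A :=
  if mu is r :: mu' then chain_start (take r s) * block_chain mu' (drop r s) else 1.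

Lemma chain_prod x0 a (s : seq state) : chain v a s =
  \prod_(0 <= i < size s) link v (nth x0 (a :: s) i) (nth x0 (a :: s) i.+1).
Proof.
elim: s a => [|b s IH] a; first by rewrite big_geq.
by rewrite big_nat_recl //= IH.
Qed.

Lemma block_chain_prod x0 p mu (s : seq state) : all (leq 1) mu -> size s = (p + sumn mu)%N ->
  \prod_(i <- block_indices p mu) link v (nth x0 s i) (nth x0 s i.+1) =
  block_chain mu (drop p s).
Proof.
elim: mu p => [|r mu IH] p /=; first by rewrite big_nil.
case/andP=> r0 mu0 sz; rewrite big_cat /= IH //; last by rewrite sz addnA.
rewrite drop_drop addnC; congr (_ * _).
have szd : size (take r (drop p s)) = r.
  by rewrite size_takel // size_drop sz; lia.
case E : (take r (drop p s)) szd => [|a t] szd /=; first by rewrite -szd in r0.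
have it : iota p r.-1 = [seq (p + i)%N | i <- iota 0 (size t)].
  by rewrite -iotaDl addn0 -szd.
rewrite (chain_prod x0) it big_map /index_iota subn0.
apply: eq_big_seq => i; rewrite mem_iota add0n => /andP[_ i_t].
have ir : (i.+1 < r)%N by rewrite -szd /=.
by rewrite -E !nth_take ?nth_drop ?addnS // ltnW.
Qed.

Lemma sum_block_chain mu :
  \sum_(s <- words ((bool * 'I_m)%type : finType) (sumn mu)) (\prod_(a <- s) x a.2) * block_chain mu s =
  \prod_(r <- mu) chain_sum v x r.
Proof.
elim: mu => [|r mu IH]; first by rewrite big_nil /= big_seq1 big_nil mulr1.
rewrite big_cons -IH /chain_sum -sum_words_cat /=; apply: eq_bigr => s _.
rewrite -[in LHS](cat_take_drop r s) big_cat /= cat_take_drop /chain_weight.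
rewrite -[if _ is _ :: _ then _ else _]/(chain_start (take r s)).
by ring.
Qed.

End BlockProducts.

Lemma big_subtype (A : nmodType) (T : finType) (P : pred T) (F : T -> A) :
  \sum_(s : {b : T | P b}) F (val s) = \sum_(b | P b) F b.
Proof.
rewrite -(big_map (val : {b : T | P b} -> T) predT F) -[RHS]big_filter.
apply: perm_big; apply: uniq_perm.
- by rewrite map_inj_uniq ?index_enum_uniq //; exact: val_inj.
- by rewrite filter_uniq ?index_enum_uniq.
move=> b; rewrite mem_filter mem_index_enum andbT; apply/mapP/idP => [[s _ ->]|Pb].
  exact: (valP s).
by exists (Sub b Pb); rewrite ?mem_index_enum ?SubK.
Qed.

Section TensorBasis.
Variables (n m : nat).
Local Notation state := (bool * 'I_m)%type.
Local Notation basis := {ffun 'I_n -> state}.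
Implicit Types b : basis.

Definition bflip (j : 'I_n) b : basis := [ffun l => ((b l).1 (+) (l == j), (b l).2)].
Definition bswap (i : 'I_n.-1) b : basis :=
  [ffun l => ((b l).1, (b (tperm (lo i) (hi i) l)).2)].
Definition beps b (l : 'I_n) : bool := (b l).1.
Definition bcol b (l : 'I_n) : nat := (b l).2.
(** The number of positions of each colour. It is preserved by the operators,
    so that tensor space is the sum of its weight modules. *)
Definition content b : 'X_{1..m} := (\sum_(l < n) U_((b l).2))%MM.

Lemma beps_flip j b l : beps (bflip j b) l = beps b l (+) (l == j).
Proof. by rewrite /beps ffunE. Qed.

Lemma bcol_flip j b l : bcol (bflip j b) l = bcol b l.
Proof. by rewrite /bcol ffunE. Qed.

Lemma beps_swap i b l : beps (bswap i b) l = beps b l.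
Proof. by rewrite /beps ffunE. Qed.

Lemma bcol_swap i b l : bcol (bswap i b) l = bcol b (tperm (lo i) (hi i) l).
Proof. by rewrite /bcol ffunE. Qed.

Lemma content_flip j b : content (bflip j b) = content b.
Proof. by apply: eq_bigr => l _; rewrite ffunE. Qed.

Lemma content_swap i b : content (bswap i b) = content b.
Proof.
rewrite /content (reindex_inj (@perm_inj _ (tperm (lo i) (hi i)))) /=.
by apply: eq_bigr => l _; rewrite ffunE /= tpermK.
Qed.

Lemma mdeg_content b : mdeg (content b) = n.
Proof.
rewrite /content mdeg_sum (eq_bigr (fun=> 1%N)) => [|l _]; last by rewrite mdeg1.
by rewrite sum1_card card_ord.
Qed.

Variable alpha : 'X_{1..m}.
Definition weight_basis := {b : basis | content b == alpha}.

Fact sflip_subproof j (s : weight_basis) : content (bflip j (val s)) == alpha.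
Proof. by rewrite content_flip (valP s). Qed.
Definition sflip j (s : weight_basis) : weight_basis := Sub (bflip j (val s)) (sflip_subproof j s).

Fact sswap_subproof i (s : weight_basis) : content (bswap i (val s)) == alpha.
Proof. by rewrite content_swap (valP s). Qed.
Definition sswap i (s : weight_basis) : weight_basis := Sub (bswap i (val s)) (sswap_subproof i s).

Definition seps (s : weight_basis) := beps (val s).
Definition scol (s : weight_basis) := bcol (val s).

Lemma seps_flip j s l : seps (sflip j s) l = seps s l (+) (l == j).
Proof. by rewrite /seps /beps SubK ffunE. Qed.

Lemma scol_flip j s l : scol (sflip j s) l = scol s l.
Proof. by rewrite /scol /bcol SubK ffunE. Qed.

Lemma seps_swap i s l : seps (sswap i s) l = seps s l.
Proof. by rewrite /seps /beps SubK ffunE. Qed.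

Lemma scol_swap i s l : scol (sswap i s) l = scol s (tperm (lo i) (hi i) l).
Proof. by rewrite /scol /bcol SubK ffunE. Qed.

Lemma weight_ext s t : (forall l, seps s l = seps t l) -> (forall l, scol s l = scol t l) -> s = t.
Proof.
move=> e c; apply/val_inj/ffunP => l; have := e l; have := c l.
rewrite /seps /scol /beps /bcol; case: (val s l) => [a i]; case: (val t l) => [a' i'] /=.
by move=> /val_inj -> ->.
Qed.

(** Stated over every commutative ring, so that [v] may also be an indeterminate. *)
Definition weight_trace (R : comNzRingType) (v : R) w : R :=
  \sum_(b | content b == alpha) word_op bflip bswap beps bcol v w (fun c => (c == b)%:R) b.

Lemma weight_trace_map (R R' : comNzRingType) (h : {rmorphism R -> R'}) (v : R) w :
  h (weight_trace v w) = weight_trace (h v) w.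
Proof.
rewrite rmorph_sum; apply: eq_bigr => b _; rewrite -word_op_map; congr (word_op _ _ _ _ _ _ _ _).
by apply/funext => c; rewrite rmorph_nat.
Qed.

Variables (k : fieldType) (v : k).
Hypothesis two_neq0 : (2 : k) != 0.

Definition weight_sm : supermodule n v :=
  tensor_sm seps_flip scol_flip seps_swap scol_swap weight_ext v two_neq0.

Lemma weight_char w : smchar weight_sm (hc_word w) = weight_trace v w.
Proof.
pose F b := word_op bflip bswap beps bcol v w (fun c => (c == b)%:R : k) b.
rewrite tensor_char -[RHS]/(\sum_(b | content b == alpha) F b) -(big_subtype _ F).

apply: eq_bigr => s _; rewrite /F.
rewrite -(@word_op_val _ _ _ (val : weight_basis -> basis) _ _ _ _ sflip sswap).
- by [].
- by move=> j t; rewrite SubK.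
by move=> i t; rewrite SubK.
Qed.

End TensorBasis.

Section TotalTrace.
Variables (n m : nat) (k : fieldType) (v : k).
Hypotheses (n_gt0 : (0 < n)%N).
Local Notation basis := {ffun 'I_n -> bool * 'I_m}.

Lemma weight_trace_sum w :
  \sum_(al : 'X_{1..m < n.+1}) weight_trace al v w *: 'X_[al] =
  \sum_(b : basis) word_op (@bflip n m) (@bswap n m) (@beps n m) (@bcol n m) v w
      (fun c => (c == b)%:R) b *: 'X_[content b] :> {mpoly k[m]}.
Proof.
have bd (b : basis) : (mdeg (content b) < n.+1)%N by rewrite mdeg_content.
rewrite [RHS](partition_big (fun b => BMultinom (bd b)) predT) //=.
apply: eq_bigr => al _; rewrite scaler_suml; apply: eq_big => b.
  by rewrite -val_eqE.
by move=> /eqP ->.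
Qed.

Lemma mpolyX_content (b : basis) :
  'X_[content b] = \prod_(a <- statelist b) 'X_(a.2) :> {mpoly k[m]}.
Proof.
rewrite /statelist big_map big_enum /content.
by apply: (big_morph (fun al => 'X_[al] : {mpoly k[m]})) => [al be|]; rewrite ?mpolyXD ?mpolyX0.
Qed.

Lemma mpolyC_link a b : (link v a b)%:MP_[m] = @link m {mpoly k[m]} v%:MP a b.
Proof.
rewrite /link /keep_coef; case: a b => [[] i] [[] j] /=; do ?case: ifP => _;
  by rewrite ?mpolyCB ?mpolyC1 ?mpolyC0.
Qed.

(** The indices in [T_(w_mu)] increase, so that its diagonal entries are products
    of entries of single generators; these group into the blocks of [mu]. *)
Lemma weight_trace_Tw mu : all (leq 1) mu -> sumn mu = n ->
  \sum_(al : 'X_{1..m < n.+1})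
     weight_trace al v [seq inl i | i <- pmap insub (block_indices 0 mu) : seq (ordinal n.-1)] *: 'X_[al] =
  \prod_(r <- mu) chain_sum v%:MP (fun i : 'I_m => 'X_i : {mpoly k[m]}) r.
Proof.
move=> mu0 mun; rewrite weight_trace_sum -sum_block_chain mun -big_words.
apply: eq_bigr => b _; rewrite -mpolyX_content mulrC -mul_mpolyC; congr (_ * _).
pose x0 := b (Ordinal n_gt0).
have sz : size (statelist b) = (0 + sumn mu)%N by rewrite size_statelist mun.
have bnd := block_indices_bound 0 mu0.
have iv : map val (pmap insub (block_indices 0 mu) : seq 'I_n.-1) = block_indices 0 mu.
  rewrite pmap_filter; last exact: insubK.
  apply/all_filterP/allP => i /(allP bnd); rewrite mun add0n => /andP[_ i_n].
  by rewrite /= isSome_insub ltn_predRL.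
rewrite (word_op_diag (@beps_flip n m) (@bcol_flip n m) (@beps_swap n m) (@bcol_swap n m)).
- rewrite eqxx mulr1 -[statelist b in RHS]drop0 -(block_chain_prod _ x0 mu0 sz) -[in RHS]iv big_map rmorph_prod.
  apply: eq_bigr => i _; rewrite -mpolyC_link.
  have := nth_statelist b x0 (lo i); have := nth_statelist b x0 (hi i); rewrite /= => -> ->.
  by [].
- have := block_indices_sorted 0 mu0; rewrite -[X in sorted _ X]iv sorted_map.
  exact.
by move=> i t l _ tl; case: (t =P b) => [tb|//]; case: tl; rewrite tb eqxx.
Qed.

End TotalTrace.

(** * The regular module *)

Section RegularModule.
Variable n : nat.
Local Notation letter := ('I_n.-1 + 'I_n)%type.
Local Notation basis := {ffun 'I_n -> bool * 'I_n}.
Implicit Types (b : basis) (w s c : seq letter).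

Definition ones : 'X_{1..n} := [multinom 1%N | _ < n].

Lemma mdeg_ones : mdeg ones = n.
Proof. by rewrite mdegE (eq_bigr (fun=> 1%N)) ?sum1_card ?card_ord // => i _; rewrite mnmE. Qed.

Lemma content_ones b : (content b == ones) = injectiveb [ffun l => (b l).2].
Proof.
apply/eqP/injectiveP => [bn l l'|inj].
  rewrite !ffunE => e; apply/eqP; apply: contraT => ll'.
  have := congr1 (fun al : 'X_{1..n} => al (b l).2) bn.
  rewrite /content (bigD1 l) //= (bigD1 l') 1?eq_sym //= -e.
  by rewrite !mnmDE !mnm1E eqxx [ones _]mnmE.
rewrite /content; transitivity (\sum_(l < n) U_(l))%MM.
  rewrite [RHS](reindex_inj inj); by apply: eq_bigr => l _; rewrite ffunE.
apply/mnmP => i; rewrite mnm_sumE mnmE (bigD1 i) //= mnm1E eqxx big1 // => j /negPf ji.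
by rewrite mnm1E ji.
Qed.

Lemma card_content_ones : #|[pred b : basis | content b == ones]| = (n`! * 2 ^ n)%N.
Proof.
pose h (p : {ffun 'I_n -> bool} * {ffun 'I_n -> 'I_n}) : basis := [ffun l => (p.1 l, p.2 l)].
pose g b : {ffun 'I_n -> bool} * {ffun 'I_n -> 'I_n} := ([ffun l => (b l).1], [ffun l => (b l).2]).
have hb : {on [pred b : basis | content b == ones], bijective h}.
  exists g => [[e f] _|b _]; last by apply/ffunP => l; rewrite !ffunE -surjective_pairing.
  by congr (_, _); apply/ffunP => l; rewrite !ffunE.
rewrite -sum1_card (reindex h hb) /=.
rewrite (eq_bigl (fun p : {ffun 'I_n -> bool} * {ffun 'I_n -> 'I_n} => predT p.1 && injectiveb p.2)) => [|[e f]]; last first.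
  rewrite inE content_ones (_ : [ffun l => (h (e, f) l).2] = f) //.
  by apply/ffunP => l; rewrite !ffunE.
rewrite -(pair_big predT (fun f : {ffun 'I_n -> 'I_n} => injectiveb f) (fun _ _ => 1%N)) /=.
rewrite sum_nat_const sum1_card card_ffun card_bool card_ord mulnC; congr (_ * _)%N.
by have := card_inj_ffuns 'I_n 'I_n; rewrite cardsE card_ord ffactnn.
Qed.

Lemma size_group_words : size (group_words n) = (n`! * 2 ^ n)%N.
Proof.
rewrite size_allpairs; congr (_ * _)%N.
  suff h K : size (perm_words n K) = K`! by [].
  by elim: K => // K IH; rewrite [perm_words n K.+1]/(allpairs_dep _ (iota 0 K.+1) _) size_allpairs size_iota IH.
suff h j : size (cliff_words n j) = (2 ^ j)%N by [].
by elim: j => // j IH; rewrite /= size_cat size_map IH expnS mul2n addnn.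
Qed.

(** At [v = 1], a generator sends a basis vector of distinct colours to plus or
    minus a basis vector. *)
Definition step (x : letter) b : basis :=
  match x with
  | inl i => [ffun l => b (tperm (lo i) (hi i) l)]
  | inr j => bflip j b
  end.

Definition walk w b := foldl (fun b x => step x b) b w.

(** The position whose colour ends up at [l]. *)
Definition position w (l : 'I_n) : 'I_n :=
  foldr (fun x p => if x is inl i then tperm (lo i) (hi i) p else p) l w.

Lemma walk_colour w b l : (walk w b l).2 = (b (position w l)).2.
Proof. by elim: w b => [|[i|j] w IH] b //=; rewrite IH ffunE. Qed.

Lemma step_inj x b : injective (fun l => (b l).2) -> injective (fun l => (step x b l).2).
Proof.
move=> inj l l'; case: x => [i|j] /=; rewrite !ffunE; last exact: inj.
by move=> /inj /perm_inj.
Qed.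

Lemma word_op_walk (A : comNzRingType) w (f : basis -> A) b : injective (fun l => (b l).2) ->
  exists e : bool, word_op (@bflip n n) (@bswap n n) (@beps n n) (@bcol n n) 1 w f b =
    (-1) ^+ e * f (walk w b).
Proof.
elim: w b => [|x w IH] b inj; first by exists false; rewrite mul1r.
have [e eE] := IH _ (step_inj (x := x) inj).
case: x eE => [i|j] eE /=; last first.
  rewrite /clifford_op /sgn -signr_odd eE mulrA -signr_addb; by eexists.
set g := word_op _ _ _ _ _ w f.
have colN : bcol b (lo i) == bcol b (hi i) = false.
  apply/negbTE/eqP => /val_inj /inj /eqP; exact/negP/lo_neq_hi.
have gS b' : (forall l, bcol b' l = bcol b l) -> @swap_op n _ (@bswap n n) (@bcol n n) A 1 i g b' = g (bswap i b').
  by move=> b'b; rewrite /swap_op /keep_coef /swap_coef !b'b colN /= subrr !if_same mul0r add0r mul1r.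
have stepE b' : (forall l, bcol b' l = bcol b l) ->
    (forall l, (b' l).1 = (b (tperm (lo i) (hi i) l)).1) -> bswap i b' = step (inl i) b.
  move=> h1 h2; apply/ffunP => l; rewrite !ffunE h2 [RHS]surjective_pairing; congr (_, _).
  exact: val_inj (h1 _).
have same : (b (lo i)).1 = (b (hi i)).1 -> bswap i b = step (inl i) b.
  move=> h; apply: stepE => // l; case: tpermP => [->|->|] //.
have diff : (b (lo i)).1 = ~~ (b (hi i)).1 -> bswap i (fflip (@bflip n n) i b) = step (inl i) b.
  move=> h; apply: stepE => l; first by rewrite /bcol /fflip !ffunE.
  rewrite /fflip !ffunE; case: tpermP => [->|->|/eqP/negPf -> /eqP/negPf ->].
  - by rewrite eqxx (negPf (lo_neq_hi i)) addbT addbF h negbK.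
  - by rewrite eqxx eq_sym (negPf (lo_neq_hi i)) addbT addbF h.
  - by rewrite !addbF.
have fc l : bcol (fflip (@bflip n n) i b) l = bcol b l by rewrite /bcol /fflip !ffunE.
rewrite /hecke_op subrr !mul0r !subr0 !addr0 !gS // /beps.
case e1 : (b (lo i)).1; case e2 : (b (hi i)).1.
- rewrite same ?e1 ?e2 // /g eE; exists (~~ e); by case: (e); rewrite ?expr0 ?expr1 ?mul1r ?mulN1r ?opprK.
- by rewrite diff ?e1 ?e2 // /g eE; exists e.
- by rewrite diff ?e1 ?e2 // /g eE; exists e.
- by rewrite same ?e1 ?e2 // /g eE; exists e.
Qed.

Lemma ones_trace_moved (A : comNzRingType) w :
  (forall b, injective (fun l => (b l).2) -> walk w b != b) -> weight_trace ones (1 : A) w = 0.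
Proof.
move=> mv; rewrite /weight_trace big1 // => b.
rewrite content_ones => /injectiveP inj.
have inj' : injective (fun l => (b l).2) by move=> l l' h; apply: inj; rewrite !ffunE.
by have [e ->] := @word_op_walk A w (fun b' => (b' == b)%:R) b inj'; rewrite (negPf (mv b inj')) mulr0.
Qed.

Lemma ones_trace_nil (A : comNzRingType) :
  weight_trace ones (1 : A) ([::] : seq letter) = (size (group_words n))%:R.
Proof.
rewrite size_group_words -card_content_ones -sum1_card natr_sum; apply: eq_bigr => b _.
by rewrite /= eqxx.
Qed.

Local Notation run j K := (flatten [seq s_word n i | i <- iota j K]).

Lemma s_word_nonempty i : (i < n.-1)%N -> exists x, s_word n i = [:: inl x] /\ x = i :> nat.
Proof. by move=> h; exists (Ordinal h); rewrite s_wordE. Qed.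

Lemma position_cat w1 w2 l : position (w1 ++ w2) l = position w1 (position w2 l).
Proof. by rewrite /position foldr_cat. Qed.

Lemma position_run j K (l l' : 'I_n) : l = (j + K)%N :> nat -> l' = j :> nat ->
  position (run j K) l = l'.
Proof.
elim: K j l' => [|K IH] j l' lE l'E /=; first by apply/val_inj; rewrite /= lE l'E addn0.
have jn : (j < n.-1)%N by have := ltn_ord l; rewrite lE; lia.
have [x [-> xj]] := s_word_nonempty jn; rewrite cat_cons /=.
rewrite (IH j.+1 (hi x)) ?xj ?lE //= ?xj ?addSnnS // tpermR.
by apply/val_inj; rewrite /= l'E.
Qed.

Lemma position_run_out j K (l : 'I_n) : (j + K < l)%N -> position (run j K) l = l.
Proof.
elim: K j => // K IH j jl; rewrite /= position_cat IH ?addSnnS //.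
have jn : (j < n.-1)%N by have := ltn_ord l; lia.
have [x [-> xj]] := s_word_nonempty jn; rewrite /= tpermD //; apply: ord_neq => /=; rewrite xj; lia.
Qed.

Lemma mem_perm_wordsS K s : reflect (exists2 j, (j <= K)%N & exists2 w, w \in perm_words n K & s = run j (K - j) ++ w)
  (s \in perm_words n K.+1).
Proof.
apply: (iffP (@allpairsPdep _ _ _ _ _ _ _)) => [[j [w [jK wK ->]]]|[j jK [w wK ->]]].
  by move: jK; rewrite mem_iota => /andP[_ jK]; exists j => //; exists w.
by exists j, w; rewrite mem_iota.
Qed.

Lemma position_perm_words_out K s (l : 'I_n) : s \in perm_words n K -> (K <= l)%N -> position s l = l.
Proof.
elim: K s => [|K IH] s; first by rewrite inE => /eqP->.
case/mem_perm_wordsS => j jK [w wK ->] Kl; rewrite position_cat (IH w) ?(ltnW Kl) //.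
by rewrite position_run_out // subnKC.
Qed.

Lemma run_nonempty j K : (j < K <= n.-1)%N -> run j (K - j) != [::].
Proof.
case/andP=> jK Kn; rewrite -[(K - j)%N]prednK ?subn_gt0 //=.
by have [x [-> _]] := @s_word_nonempty j (leq_trans jK Kn).
Qed.

(** In a word of [perm_words K.+1] with a nonempty first run, the last position
    [K] is only moved by that run. *)
Lemma position_perm_words K s : (K <= n)%N -> s \in perm_words n K -> s != [::] -> exists l, position s l != l.
Proof.
elim: K s => [|K IH] s Kn; first by rewrite inE => ->.
case/mem_perm_wordsS => j jK [w wK ->]; have [->|ne] := eqVneq j K.
  by rewrite subnn; apply: IH => //; exact: ltnW.
have jK' : (j < K)%N by rewrite ltn_neqAle ne.
move=> _; exists (Ordinal Kn); rewrite position_cat (position_perm_words_out wK) //.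
by rewrite (@position_run j _ (Ordinal Kn) (Ordinal (ltn_trans jK' Kn))) /= ?subnKC.
Qed.

Lemma sum_perm_words (A : nmodType) K (F : seq letter -> A) : (K <= n)%N ->
  (forall s, s \in perm_words n K -> s != [::] -> F s = 0) -> \sum_(s <- perm_words n K) F s = F [::].
Proof.
elim: K => [|K IH] Kn F0; first by rewrite big_seq1.
have Kn1 : (K <= n.-1)%N by move: Kn; case: (n).
rewrite [perm_words n K.+1]/(allpairs_dep _ (iota 0 K.+1) _) big_allpairs_dep.
rewrite -[iota 0 K.+1]/(index_iota 0 K.+1) big_nat_recr //= subnn big_nat_cond big1 ?add0r.
  apply: IH => [|s sK]; first exact: ltnW.
  by apply: F0; apply/mem_perm_wordsS; exists K => //; exists s => //; rewrite subnn.
move=> j; rewrite andbT => /andP[_ jK]; rewrite big_seq big1 // => w wK; apply: F0.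
  by apply/mem_perm_wordsS; exists j; [exact: ltnW|exists w].
by have := @run_nonempty j K; rewrite jK Kn1 => /(_ isT); case: flatten.
Qed.

Definition flipped w (l : 'I_n) : bool :=
  foldr (fun x p => if x is inr j then p (+) (l == j) else p) false w.

Lemma walk_cliff_words j c b l : c \in cliff_words n j -> (walk c b l).1 = (b l).1 (+) flipped c l.
Proof.
elim: j c b => [|j IH] c b; first by rewrite inE => /eqP->; rewrite addbF.
rewrite /= mem_cat => /orP[|/mapP[w wj ->]]; first exact: IH.
rewrite /walk /flipped foldl_cat foldr_cat -/(walk _ _) IH // /c_word /=.
by case: insubP => //= x _ _; rewrite ffunE /= -addbA (addbC (l == x)).
Qed.

Lemma flipped_out j c (l : 'I_n) : c \in cliff_words n j -> (j <= l)%N -> flipped c l = false.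
Proof.
elim: j c => [|j IH] c; first by rewrite inE => /eqP->.
rewrite /= mem_cat => /orP[cj|/mapP[w wj ->]] jl; first by apply: IH => //; exact: ltnW.
rewrite /flipped foldr_cat -/(flipped _ _) IH ?(ltnW jl) // /c_word /=.
by case: insubP => //= x _ xj; rewrite -val_eqE /= xj gtn_eqF.
Qed.

Lemma flipped_cliff_words j c : (j <= n)%N -> c \in cliff_words n j -> c != [::] -> exists l, flipped c l.
Proof.
elim: j c => [|j IH] c jn; first by rewrite inE => ->.
rewrite /= mem_cat => /orP[cj|/mapP[w wj ->] _]; first by apply: IH => //; exact: ltnW.
exists (Ordinal jn); rewrite /flipped foldr_cat -/(flipped _ _) (flipped_out wj) //.
by rewrite c_wordE /= -val_eqE /= eqxx.
Qed.

Lemma sum_cliff_words (A : nmodType) j (F : seq letter -> A) : (j <= n)%N ->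
  (forall c, c \in cliff_words n j -> c != [::] -> F c = 0) -> \sum_(c <- cliff_words n j) F c = F [::].
Proof.
elim: j => [|j IH] jn F0; first by rewrite big_seq1.
rewrite /= big_cat big_map /= [X in _ + X]big_seq [X in _ + X]big1 ?addr0 => [|w wj].
  by apply: IH (ltnW jn) _ => c cj; apply: F0; rewrite /= mem_cat cj.
apply: F0; first by rewrite /= mem_cat map_f ?orbT.
by rewrite c_wordE.
Qed.

Lemma walk_cat w1 w2 b : walk (w1 ++ w2) b = walk w2 (walk w1 b).
Proof. by rewrite /walk foldl_cat. Qed.

Lemma walk_cliff_words_colour j c b l : c \in cliff_words n j -> (walk c b l).2 = (b l).2.
Proof.
elim: j c b => [|j IH] c b; first by rewrite inE => /eqP->.
rewrite /= mem_cat => /orP[|/mapP[w wj ->]]; first exact: IH.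
rewrite walk_cat IH // /c_word /=.
by case: insubP => //= x _ _; rewrite ffunE.
Qed.

(** The weight module of weight [(1,..,1)] behaves like the regular representation:
    a nonempty normal form moves a colour or changes a parity, and fixes no
    basis vector up to sign. *)
Lemma sum_ones_trace (A : comNzRingType) (chi : seq letter -> A) :
  \sum_(w <- group_words n) weight_trace ones (1 : A) w * chi w =
  (size (group_words n))%:R * chi [::].
Proof.
rewrite /group_words big_allpairs_dep /=.
rewrite (@sum_perm_words _ n (fun s => \sum_(c <- cliff_words n n) weight_trace ones 1 (s ++ c) * chi (s ++ c))) //.
  rewrite (@sum_cliff_words _ n (fun c => weight_trace ones 1 ([::] ++ c) * chi ([::] ++ c))) //.
    by rewrite ones_trace_nil.
  move=> c cn c0; rewrite ones_trace_moved ?mul0r // => b _.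
  have [l fl] := flipped_cliff_words (leqnn n) cn c0; apply/eqP => /ffunP/(_ l)/(congr1 fst).
  by rewrite (walk_cliff_words _ _ cn) fl addbT; case: (b l).1.
move=> s sn s0; rewrite big_seq big1 // => c cn; rewrite ones_trace_moved ?mul0r // => b inj.
have [l pl] := position_perm_words (leqnn n) sn s0; apply/eqP => /ffunP/(_ l)/(congr1 snd).
by rewrite walk_cat (walk_cliff_words_colour _ _ cn) walk_colour => /inj /eqP; rewrite (negPf pl).
Qed.

End RegularModule.

(** * Normalization at v = 1 *)

Lemma smchar1 n (k : fieldType) (v : k) (M : supermodule n v) : smchar M 1 = (smdim M)%:R.
Proof. by rewrite /smchar (smact_mul M).1 mxtrace1. Qed.

Lemma hc_word_nil n (k : fieldType) (v : k) : hc_word [::] = 1 :> hecke_clifford n v.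
Proof. by rewrite /hc_word big_nil. Qed.

(** The generating polynomial of the multiplicities of an irreducible in the
    weight modules. *)
Definition mult_poly (A : nzRingType) n m (I : Type) (mult : 'X_{1..m} -> I -> nat) (la : I) : {mpoly A[m]} :=
  \sum_(al : 'X_{1..m < n.+1}) (mult al la)%:R *: 'X_[al].

(** Two evaluations of the weighted traces of [T_(w_mu)]: over states, and over
    irreducible constituents. *)
Lemma chain_sum_characters n m (k : fieldType) (v : k) (I : finType) (U : I -> supermodule n v)
    (mult : 'X_{1..m} -> I -> nat) mu :
  (0 < n)%N -> all (leq 1) mu -> sumn mu = n ->
  (forall al w, weight_trace al v w = \sum_la (mult al la)%:R * smchar (U la) (hc_word w)) ->
  \prod_(r <- mu) chain_sum v%:MP (fun i : 'I_m => 'X_i : {mpoly k[m]}) r =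
  \sum_la smchar (U la) (hc_Tw mu) *: mult_poly k n mult la.
Proof.
move=> n_gt0 mu0 mun dec; rewrite -(weight_trace_Tw _ _ n_gt0) //.
under eq_bigr => al _ do rewrite dec -hc_Tw_word scaler_suml.
rewrite exchange_big /=; apply: eq_bigr => la _; rewrite /mult_poly scaler_sumr.
by apply: eq_bigr => al _; rewrite scalerA mulrC.
Qed.

Lemma char0_natr_inj (k : idomainType) : (forall n, n.+1%:R != 0 :> k) -> injective (fun n => n%:R : k).
Proof.
move=> k0 a b /=; wlog ab : a b / (a <= b)%N => [h|].
  by case/orP: (leq_total a b) => ab e; [|symmetry]; apply: h.
move/eqP; rewrite eq_sym -subr_eq0 -natrB //.
case E : (b - a)%N => [|c]; last by rewrite (negPf (k0 c)).
by move=> _; apply/eqP; rewrite eqn_leq ab /= -subn_eq0 E.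
Qed.

Lemma exprz2_inj (k : fieldType) (z : int) (h : nat) : (forall n, n.+1%:R != 0 :> k) ->
  2%:R ^ z = h%:R :> k -> (h == 1%N) || (h == 2%N) -> z = h.-1%:Z.
Proof.
move=> k0; have inj := char0_natr_inj k0; case: z => [p|p].
  rewrite -exprnP -natrX => /inj <-.
  by case: p => [|[|p]] //; rewrite !expnS; case: (2 ^ p)%N (expn_gt0 2 p) => // q _; lia.
rewrite NegzE -exprnN => e hP.
have : 1%:R = (h * 2 ^ p.+1)%:R :> k.
  by rewrite natrM natrX -e mulVf // expf_eq0 (negPf (k0 1%N)).
move/inj; rewrite expnS; have := expn_gt0 2 p; nia.
Qed.

Lemma qfam_one (A : comNzRingType) (I : finType) (y : I -> A) :
  qfam setT y 1 = (\sum_i y i) *+ 2.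
Proof.
have := qfam_rec setT y 1; rewrite mul1r big_ltn_cond // big_geq //= addr0 subnn qfam0 mulr1 => ->.
by congr (_ *+ 2); apply: eq_big => i; rewrite ?inE ?expr1.
Qed.

Section Normalization.
Variables (n : nat) (k : closedFieldType).
Hypotheses (n_gt0 : (0 < n)%N) (k_char0 : forall n, n.+1%:R != 0 :> k).
Variables (U1 : SP n -> supermodule n (1 : k)) (irrU1 : all_irreducibles U1).
Variable a : SP n -> int.
Hypothesis labelling : forall la : SP n,
  \sum_(mu : npartition n | is_OP mu)
    ((zmu (parts mu))%:R^-1 * smchar (U1 la) (hc_Tw (parts mu))) *: ppoly k n (parts mu)
  = 2%:R ^ a la *: Qpoly k n (SP_parts la).
Variable mult : forall m, 'X_{1..m} -> SP n -> nat.
Hypothesis decomposition : forall m (al : 'X_{1..m}) w,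
  weight_trace al (1 : k) w = \sum_la (mult al la)%:R * smchar (U1 la) (hc_word w).
Implicit Type la : SP n.

Local Notation aw m la := (mult_poly k n (@mult m) la).
Local Notation e la := ((2%:R : k) ^ a la).
Local Notation l la := (size (SP_parts la)).

Let two_neq0 : (2 : k) != 0 := k_char0 1.

Lemma aw_psum m (mu : npartition n) : is_OP mu ->
  \prod_(r <- parts mu) ((\sum_(i < m) 'X_i ^+ r) *+ 2) =
  \sum_la smchar (U1 la) (hc_Tw (parts mu)) *: aw m la.
Proof.
move=> mu_odd; have /and3P[_ mu0 /eqP mun] := parts_partition mu.
rewrite -(chain_sum_characters n_gt0 mu0 mun (@decomposition m)).
rewrite big_seq [RHS]big_seq.
apply: eq_bigr => r r_mu.
by rewrite chain_sum_v1 ?mpolyC1 //; exact: (allP mu_odd).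
Qed.

Lemma Q_mult m la : Qpoly k m (SP_parts la) = (2 ^+ l la * e la) *: aw m la.
Proof. exact: (Q_aw k_char0 aw_psum labelling). Qed.

(** In the regular module an irreducible module of dimension [d] has multiplicity
    [d / h], where [h] is the dimension of its endomorphism ring. *)
Lemma mult_ones_dim la : exists2 h : nat, (h == 1%N) || (h == 2%N) &
  (mult (ones n) la)%:R * h%:R = (smdim (U1 la))%:R :> k.
Proof.
have [irr sep _] := irrU1.
have [h hP hE] := char_pairing_irr k_char0 (irr la); exists h => //.
have gn : (size (group_words n))%:R != 0 :> k.
  by rewrite size_group_words; case: (_ * _)%N (muln_gt0 n`! (2 ^ n)) => [|g]; rewrite ?k_char0 // fact_gt0 expn_gt0.
apply: (mulfI gn); have := sum_ones_trace (fun w : seq ('I_n.-1 + 'I_n) => smchar (U1 la) (hc_word (rev w))).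
rewrite hc_word_nil smchar1 => <-; under eq_bigr => w _ do rewrite decomposition mulr_suml.
rewrite exchange_big (bigD1 la) //= [X in _ = _ + X]big1 ?addr0 => [|nu nula].
  by rewrite mulrCA -hE mulr_sumr; apply: eq_bigr => w _; rewrite mulrA.
under eq_bigr => w _ do rewrite -mulrA.
rewrite -mulr_sumr (char_pairing_noniso k_char0 (irr nu) (irr la)) ?mulr0 //.
by move/sep => eq_la; rewrite eq_la eqxx in nula.
Qed.

Lemma aw_ones la : (aw n la)@_(ones n) = (mult (ones n) la)%:R.
Proof.
have d1 : (mdeg (ones n) < n.+1)%N by rewrite mdeg_ones.
rewrite /mult_poly raddf_sum (bigD1 (BMultinom d1)) //= mcoeffZ mcoeffX eqxx mulr1 big1 ?addr0 //.
by move=> al /negPf h; rewrite mcoeffZ mcoeffX; move: h; rewrite -val_eqE /= => ->; rewrite mulr0.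
Qed.

(** Expand [(2 p_1)^n] in the [Q la] in two ways: by characters at the identity,
    which are dimensions, and by the Cauchy kernel at the monomial
    [x_1 .. x_n], whose coefficients are the multiplicities in the regular
    module. *)
Lemma dim_mult_ones la :
  (smdim (U1 la))%:R = 2 ^+ l la * e la * e la * (mult (ones n) la)%:R :> k.
Proof.
have c0 nu : 2 ^+ l nu * e nu != 0 by rewrite mulf_neq0 ?expf_neq0 ?expfz_neq0.
have lhs : \prod_(r <- nseq n 1%N) ((\sum_(i < n) 'X_i ^+ r) *+ 2) =
    \sum_nu (smdim (U1 nu))%:R *: aw n nu :> {mpoly k[n]}.
  have mu0 : all (leq 1) (nseq n 1%N) by rewrite all_nseq orbT.
  have mun : sumn (nseq n 1%N) = n by rewrite sumn_nseq mul1n.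
  have := chain_sum_characters n_gt0 mu0 mun (@decomposition n).
  rewrite big_seq => h; rewrite big_seq -[RHS](_ : \sum_nu smchar (U1 nu) (hc_Tw (nseq n 1%N)) *: aw n nu = _).
    rewrite -h; apply: eq_bigr => r /nseqP[-> _].
    by rewrite chain_sum_v1 ?mpolyC1.
  apply: eq_bigr => nu _; rewrite hc_Tw_word (_ : block_indices 0 _ = [::]) ?hc_word_nil ?smchar1 //.
  have b0 p q : block_indices q (nseq p 1%N) = [::] by elim: p q => //= p IH q; rewrite IH.
  exact: b0.
have rhs : \prod_(r <- nseq n 1%N) ((\sum_(i < n) 'X_i ^+ r) *+ 2) =
    \sum_nu (e nu * (mult (ones n) nu)%:R) *: Qpoly k n (SP_parts nu) :> {mpoly k[n]}.
  have := q_expand2 k_char0 aw_psum labelling (mdeg_ones n).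
  under [in RHS]eq_bigr => nu _ do rewrite aw_ones.
  move=> <-; under [RHS]eq_bigr => j _ do rewrite mnmE qfam_one.
  rewrite big_nseq iter_mulr_1 prodr_const card_ord.
  by under eq_bigr => i _ do rewrite expr1.
have z : \sum_nu ((smdim (U1 nu))%:R / (2 ^+ l nu * e nu) - e nu * (mult (ones n) nu)%:R)
     *: Qpoly k n (SP_parts nu) = 0.
  under eq_bigr => nu _ do rewrite scalerBl.
  rewrite sumrB -rhs lhs; apply/eqP; rewrite subr_eq0; apply/eqP/eq_bigr => nu _.
  by rewrite Q_mult scalerA divfK.
have := Q_free k_char0 z la; move/eqP; rewrite subr_eq0 => /eqP h.
by rewrite -[LHS](divfK (c0 la)) h; ring.
Qed.

(** By [mult_ones_dim] and [dim_mult_ones], the power [2 ^ (size la + 2 a)] is the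
    dimension [1] or [2] of an endomorphism ring, which determines [a]. *)
Lemma Q_mult_normalized m la : Qpoly k m (SP_parts la) = 2 ^+ half_len (SP_parts la) *: aw m la.
Proof.
rewrite Q_mult; congr (_ *: _).
have [h hP hE] := mult_ones_dim la.
have [irr _ _] := irrU1; have [d0 _] := irr la.
have dn0 : (smdim (U1 la))%:R != 0 :> k by case: smdim d0 => // d _; exact: k_char0.
have r0 : (mult (ones n) la)%:R != 0 :> k by apply: contra_eq_neq hE => ->; rewrite mul0r eq_sym.
have hz : 2%:R ^ ((l la)%:Z + a la + a la) = h%:R :> k.
  apply: (mulfI r0); rewrite hE dim_mult_ones !expfzDr // -exprnP; ring.
have za := exprz2_inj k_char0 hz hP.
rewrite exprnP -expfzDr // exprnP; congr (_ ^ _).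
by rewrite /half_len; case/orP: hP za => /eqP-> /=; have := odd_double_half (l la); case: odd; lia.
Qed.

End Normalization.

(** * Specialization and the product formula *)

Lemma hc_word_homog n (k : fieldType) (v : k) w : exists b, hc_homog b (hc_word w : hecke_clifford n v).
Proof.
elim: w => [|x w [b wb]].
  by exists false; rewrite /hc_word big_nil -[1]scale1r; exact: homog_scal.
rewrite /hc_word big_cons; case: x => [i|j].
  by exists (false (+) b); apply: homog_mul => //; exact: homog_T.
by exists (true (+) b); apply: homog_mul => //; exact: homog_c.
Qed.

(** Stated with [weight_trace], which unlike the modules can be compared for
    different values of [v]. *)
Lemma weight_multiplicities n m (k : fieldType) (v : k) (I : finType) (U : I -> supermodule n v)
    (al : 'X_{1..m}) : (2 : k) != 0 -> all_irreducibles U ->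
  exists mu : I -> nat, forall w,
    weight_trace al v w = \sum_la (mu la)%:R * smchar (U la) (hc_word w).
Proof.
move=> k2 irrU; have [mu muP] := char_decomposition k2 irrU (weight_sm n al v k2).
exists mu => w; rewrite -(weight_char al v k2).
by have [b wb] := hc_word_homog v w; exact: muP wb.
Qed.

Lemma map_mult_poly (A B : nzRingType) (f : {rmorphism A -> B}) n m (I : Type)
    (mult : 'X_{1..m} -> I -> nat) la :
  map_mpoly f (mult_poly A n mult la) = mult_poly B n mult la.
Proof.
rewrite /mult_poly raddf_sum; apply: eq_bigr => al _.
by rewrite /= map_mpolyZ rmorph_nat map_mpolyX.
Qed.

Lemma map_mpoly_inj (A B : nzRingType) (f : {rmorphism A -> B}) m :
  injective f -> injective (map_mpoly f : {mpoly A[m]} -> {mpoly B[m]}).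
Proof.
move=> inj p q e; apply/mpolyP => al; apply: inj.
by rewrite -!mcoeff_map_mpoly e.
Qed.

Section Specialization.
Variables (R : realType) (K : fieldExtType (Cq R)) (dom : {pred K}) (phi : K -> R[i]).
Hypothesis hphi : specialization_at_1 dom phi.

Lemma dom0 : 0 \in dom.
Proof. by have [[d1 dB _] _ _ _ _] := hphi; rewrite -(subrr 1) dB. Qed.

Lemma domD x y : x \in dom -> y \in dom -> x + y \in dom.
Proof.
have [[_ dB _] _ _ _ _] := hphi => xd yd.
by rewrite -[y]opprK -[- y]sub0r dB // dB // dom0.
Qed.

Lemma phi0 : phi 0 = 0.
Proof.
have [_ pD _ _ _] := hphi; apply: (addrI (phi 0)).
by rewrite -pD ?dom0 // !addr0.
Qed.

Lemma constK_int (z : int) : constK K z%:~R = z%:~R.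
Proof.
rewrite /constK -(rmorph_int (in_alg K)); congr (in_alg K _).
by rewrite !rmorph_int.
Qed.

Lemma phi_int (z : int) : z%:~R \in dom /\ phi z%:~R = z%:~R.
Proof. by have [_ _ _ /(_ z%:~R) + _] := hphi; rewrite constK_int. Qed.

Lemma phi_sum (I : Type) (s : seq I) (F : I -> K) : (forall j, F j \in dom) ->
  \sum_(j <- s) F j \in dom /\ phi (\sum_(j <- s) F j) = \sum_(j <- s) phi (F j).
Proof.
have [_ pD _ _ _] := hphi => Fd; elim: s => [|j s [sd sE]].
  by rewrite !big_nil dom0 phi0.
by rewrite !big_cons domD ?pD ?sE.
Qed.

(** Traces on weight modules are values of integer polynomials in [v]. *)
Definition evalz (A : comNzRingType) (a : A) : {rmorphism {poly int} -> A} :=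
  horner_morph (fun z : int => mulrC a z%:~R).

Lemma evalzX (A : comNzRingType) (a : A) : evalz a 'X = a.
Proof. exact: horner_morphX. Qed.

Lemma phi_evalz (p : {poly int}) :
  evalz (vK K) p \in dom /\ phi (evalz (vK K) p) = evalz (1 : R[i]) p.
Proof.
have [[_ _ dM] pD pM _ [vd v1]] := hphi.
elim/poly_ind: p => [|p c [pd pE]]; first by rewrite !rmorph0 dom0 phi0.
have [cd cE] := phi_int c.
have C (A : comNzRingType) (a : A) : evalz a (p * 'X + c%:P) = evalz a p * a + c%:~R.
  by rewrite rmorphD rmorphM evalzX; congr (_ + _); exact: horner_morphC.
by rewrite !C domD ?dM // pD ?dM // pM // pE v1 cE.
Qed.

Lemma phi_weight_trace n m (al : 'X_{1..m}) (w : seq ('I_n.-1 + 'I_n)) :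
  phi (weight_trace al (vK K) w) = weight_trace al 1 w.
Proof.
have h (A : comNzRingType) (a : A) : weight_trace al a w = evalz a (weight_trace al 'X w).
  by rewrite weight_trace_map evalzX.
by rewrite (h _ (vK K)) (h _ (1 : R[i])); case: (phi_evalz (weight_trace al 'X w)).
Qed.

End Specialization.

Lemma vq_neq1 (R : realType) : vq R != 1.
Proof.
rewrite /vq /vhalf -tofracXn -tofrac1 tofrac_eq.
apply/eqP => /(congr1 (fun p : {poly R[i]} => size p)) /eqP.
by rewrite size_polyXn size_poly1.
Qed.

Lemma complex_char0 (R : realType) p : p.+1%:R != 0 :> R[i].
Proof. by rewrite Num.Theory.pnatr_eq0. Qed.

Lemma fieldExt_char0 (R : realType) (K : fieldExtType (Cq R)) p : p.+1%:R != 0 :> K.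
Proof.
have -> : p.+1%:R = in_alg K (tofrac (p.+1%:R%:P : {poly R[i]})).
  by rewrite !rmorph_nat.
rewrite fmorph_eq0 tofrac_eq0 polyC_eq0.
exact: complex_char0.
Qed.

Lemma scst_scale (k : fieldType) m (a : k) (p : {mpoly k[m]}) :
  tofrac (a *: p) = scst m a * tofrac p.
Proof. by rewrite -mul_mpolyC tofracM. Qed.

Lemma gtilde_chain_sum (k : fieldType) m (v : k) r : v != 1 -> (0 < r)%N ->
  gtilde m v r = chain_sum v%:MP (fun i : 'I_m => 'X_i) r.
Proof.
move=> v1 r0; rewrite /gtilde.
have := chain_sum_gf v%:MP (fun i : 'I_m => 'X_i : {mpoly k[m]}) r0; rewrite -/(gseries m v) => <-.
by rewrite -mpolyC1 -mpolyCB mul_mpolyC scalerA mulVf ?scale1r // subr_eq0.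
Qed.

Theorem theorem3p7 (R : realType) (n : nat) (n_gt0 : (0 < n)%N)
    (K : fieldExtType (Cq R)) (r : 'I_n -> K) (hK : sqrt_extension r)
    (dom : {pred K}) (phi : K -> R[i]) (hphi : specialization_at_1 dom phi)
    (U1 : SP n -> supermodule n (1 : R[i]))
    (hU1 : all_irreducibles U1) (hQ : schurQ_labelling U1)
    (U : SP n -> supermodule n (vK K))
    (hU : all_irreducibles U)
    (hlab : forall la : SP n, char_specializes dom phi (U la) (U1 la))
    (mu : npartition n) (m : nat) (m_gt0 : (0 < m)%N) :
  gtilde_mu m (vK K) (parts mu) =
  \sum_(la : SP n)
     scst m (2%:R ^- half_len (SP_parts la)) * schurQ K m (SP_parts la)
       * scst m (smchar (U la) (hc_Tw (parts mu))).
Proof.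
have K0 := @fieldExt_char0 R K.
have C0 := @complex_char0 R.
(* multiplicities in the weight modules over [K] *)
have exm m' (al : 'X_{1..m'}) := weight_multiplicities al (K0 1%N) hU.
pose mult m' (al : 'X_{1..m'}) := projT1 (cid (exm m' al)).
have multE m' (al : 'X_{1..m'}) w : weight_trace al (vK K) w =
    \sum_la (mult m' al la)%:R * smchar (U la) (hc_word w).
  exact: projT2 (cid (exm m' al)) w.
(* they are natural numbers, so the decomposition specializes to [v = 1] *)
have multE1 m' (al : 'X_{1..m'}) w : weight_trace al (1 : R[i]) w =
    \sum_la (mult m' al la)%:R * smchar (U1 la) (hc_word w).
  rewrite -(phi_weight_trace hphi) multE.
  have [[_ _ dM] _ pM _ _] := hphi.
  have nat_phi p : p%:R \in dom /\ phi p%:R = p%:R := phi_int hphi p.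
  have [|_ ->] := phi_sum hphi (index_enum _)
      (F := fun la => (mult m' al la)%:R * smchar (U la) (hc_word w)).
    by move=> la; apply: dM; [exact: (nat_phi _).1|exact: (hlab la w).1].
  apply: eq_bigr => la _; rewrite pM; last 2 first.
  - exact: (nat_phi _).1.
  - exact: (hlab la w).1.
  by rewrite (nat_phi _).2 (hlab la w).2.
pose a la := projT1 (cid (hQ la)).
have labelling la : \sum_(mu : npartition n | is_OP mu)
    ((zmu (parts mu))%:R^-1 * smchar (U1 la) (hc_Tw (parts mu))) *: ppoly R[i] n (parts mu)
  = 2%:R ^ a la *: Qpoly R[i] n (SP_parts la).
  apply: (@tofrac_inj {mpoly R[i][n]}); rewrite scst_scale -schurQ_Qpoly ?SP_sorted ?SP_pos //.
  rewrite -(projT2 (cid (hQ la)) n) rmorph_sum; apply: eq_bigr => nu _.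
  rewrite [LHS]scst_scale; congr (_ * _).
  rewrite /ppoly /psum rmorph_prod; apply: eq_bigr => q _.
  by rewrite rmorph_sum; apply: eq_bigr => i _; exact: tofracXn.
(* the identification of the multiplicity polynomials is an identity of
   integer polynomials, and so holds over [K] as well *)
have QZ la : Qpoly int m (SP_parts la) =
    2 ^+ half_len (SP_parts la) *: mult_poly int n (mult m) la.
  apply: (@map_mpoly_inj _ _ (intr : {rmorphism int -> R[i]})); first exact: intr_inj.
  rewrite map_Qpoly (Q_mult_normalized n_gt0 C0 hU1 labelling multE1).
  by rewrite map_mpolyZ map_mult_poly rmorphXn rmorph_nat.
have QK la : mult_poly K n (mult m) la =
    2%:R ^- half_len (SP_parts la) *: Qpoly K m (SP_parts la).
  rewrite -(map_Qpoly (intr : {rmorphism int -> K})) QZ map_mpolyZ map_mult_poly.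
  by rewrite rmorphXn rmorph_nat scalerA mulVf ?scale1r // expf_neq0 // K0.
have /and3P[_ mu0 /eqP mun] := parts_partition mu.
have v1 : vK K != 1.
  rewrite /vK -[X in _ != X](rmorph1 (in_alg K)) -[_%:A]/(in_alg K _) (inj_eq (fmorph_inj _)).
  exact: vq_neq1.
have -> : gtilde_mu m (vK K) (parts mu) =
    tofrac (\sum_la smchar (U la) (hc_Tw (parts mu)) *: mult_poly K n (mult m) la).
  rewrite -(chain_sum_characters n_gt0 mu0 mun (multE m)) /gtilde_mu; congr (tofrac _).
  rewrite big_seq [RHS]big_seq; apply: eq_bigr => q q_mu.
  by rewrite gtilde_chain_sum //; exact: (allP mu0).
rewrite rmorph_sum; apply: eq_bigr => la _.
rewrite [LHS]scst_scale QK scst_scale -schurQ_Qpoly ?SP_sorted ?SP_pos //.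
by rewrite mulrC.
Qed.
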